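(* Let $(M,g)$ be a compact $n$-dimensional Riemannian manifold with smooth boundary $\partial M$, let $h$ be a smooth function on $M$, and let $f$ be a smooth function on $M$. Then $$\int_{M}\left(|L_hf|^2-|D^2f|^2\right)dm=\int_M \mathrm{Ric}^h(\nabla f,\nabla f)\,dm+\int_{\partial M}\left(Hf_{\nu}-\langle\nabla h,\nabla f\rangle+\Delta_{\partial}f\right)f_{\nu}\,dm+\int_{\partial M}\left(\mathrm{II}(\nabla_{\partial} f,\nabla_{\partial} f)-\langle\nabla_{\partial}f,\nabla_{\partial}f_{\nu}\rangle\right)dm.$$
   Context: $\nabla$ and $D^2$ denote the gradient (or Levi-Civita connection) and Hessian of $(M,g)$, $\Delta$ is the Laplace-Beltrami operator (the trace of the Hessian), and $\langle\cdot,\cdot\rangle=g$. The drifting Laplacian (h-Laplacian) is $L_h f=\Delta_h f=\Delta f-\langle\nabla h,\nabla f\rangle$. The Bakry-Emery-Ricci tensor is $\mathrm{Ric}^h=\mathrm{Ric}+D^2h$. The weighted measure is $dm=e^{-h}dv$, where $dv$ is the Riemannian volume measure on $M$; in integrals over $\partial M$, $dm$ denotes $e^{-h}$ times the Riemannian volume measure of the metric induced on $\partial M$. $\nu$ is the unit outward normal to $\partial M$, $f_\nu=\langle\nabla f,\nu\rangle$, the second fundamental form of $\partial M$ is $\mathrm{II}(X,Y)=g(\nabla_X\nu,Y)$ for $X,Y$ tangent to $\partial M$, and $H$ is its trace (the mean curvature). $\nabla_\partial$ and $\Delta_\partial$ are the gradient and Laplacian of the induced metric on $\partial M$, applied to restrictions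 of functions to $\partial M$. *)

(* Defs.v *)
From HB Require Import structures.
From mathcomp Require Import all_boot all_order all_algebra.
From mathcomp Require Import all_classical all_reals all_analysis.

Set Implicit Arguments.
Unset Strict Implicit.
Unset Printing Implicit Defensive.
Import Order.TTheory GRing.Theory Num.Theory.
Import numFieldNormedType.Exports.
Local Open Scope classical_set_scope.
Local Open Scope ring_scope.

(* Manifolds with boundary are given by an atlas of charts valued in the
   half-space {x | 0 <= x_0}.  A tangent vector at p is the row vector of its
   components in the preferred chart [chart_at p], a bilinear form on the
   tangent space is its matrix, and geometric operations are the usual
   coordinate expressions (Einstein indices written out). *)

Section Smoothness.
Context {R : realType} {n : nat}.
Implicit Types (W V : set 'rV[R]_n) (F G : 'rV[R]_n -> R).

Fixpoint Ck_on (k : nat) W G : Prop :=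
  (forall x, W x -> {for x, continuous G}) /\
  if k is k'.+1 then
    forall j : 'I_n, (forall x, W x -> derivable G x (delta_mx 0 j)) /\
                     Ck_on k' W (fun x => 'D_(delta_mx 0 j) G x)
  else True.

Definition smooth_on W G := forall k, Ck_on k W G.

(* V need not be open: smoothness means that F locally extends to a smooth
   function on an open subset of R^n. *)
Definition smooth_within V F :=
  forall x, V x -> exists W G,
    [/\ open W, W x, smooth_on W G & forall y, W y -> V y -> F y = G y].

End Smoothness.

Section Coordinates.
Context {R : realType} {d : nat}.
(* [D] is the model space (half-space or whole space), [g] the matrix of the
   metric in a chart. *)
Variables (D : set 'rV[R]_d) (g : 'rV[R]_d -> 'M[R]_d).
Implicit Types (F : 'rV[R]_d -> R) (V : 'rV[R]_d -> 'rV[R]_d).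
Implicit Types (x u v : 'rV[R]_d) (T : 'M[R]_d) (i j k l : 'I_d).

(* The difference quotient only sees points of D, so this is a one-sided
   derivative in the transverse direction at the boundary of a half-space and
   the ordinary partial derivative at interior points. *)
Definition pd k F x : R :=
  lim ((F (x + t *: delta_mx 0 k) - F x) / t
    @[t --> within [set t | D (x + t *: delta_mx 0 k)] 0^']).

Definition bilin T u v : R := (u *m T *m v^T) 0 0.

Definition ginv x : 'M[R]_d := invmx (g x).

Definition cgrad F x : 'rV[R]_d := \row_k \sum_l ginv x k l * pd l F x.

(* christoffel k i j = Gamma^k_{ij} *)
Definition christoffel k i j x : R :=
  2^-1 * \sum_l ginv x k l *
    (pd i (fun y => g y j l) x + pd j (fun y => g y i l) x
     - pd l (fun y => g y i j) x).

(* nabla_u V, for a vector field V *)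
Definition covd V u x : 'rV[R]_d :=
  \row_k \sum_i u 0 i *
    (pd i (fun y => V y 0 k) x + \sum_j christoffel k i j x * V x 0 j).

Definition chess F x : 'M[R]_d :=
  \matrix_(i, j) (pd i (pd j F) x - \sum_k christoffel k i j x * pd k F x).

Definition gtrace x T : R := \sum_i \sum_j ginv x i j * T i j.

Definition gnorm2 x T : R :=
  \sum_i \sum_j \sum_k \sum_l ginv x i k * ginv x j l * T i j * T k l.

(* riemann l i j k is the l-th component of
   R(e_i,e_j)e_k = nabla_i nabla_j e_k - nabla_j nabla_i e_k *)
Definition riemann l i j k x : R :=
  pd i (christoffel l j k) x - pd j (christoffel l i k) x
  + \sum_m (christoffel l i m x * christoffel m j k x
            - christoffel l j m x * christoffel m i k x).

(* Ric(Y,Z) = tr (X |-> R(X,Y)Z) *)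
Definition cricci x : 'M[R]_d := \matrix_(j, k) \sum_i riemann i i j k x.

End Coordinates.

(* Lebesgue integral over R^d of a nonnegative Borel function, as an iterated
   integral (Tonelli); R^0 is a point of mass 1. *)
Fixpoint iint {R : realType} (d : nat) : ('rV[R]_d -> \bar R) -> \bar R :=
  if d is d'.+1 then fun F : 'rV[R]_(1 + d') -> \bar R =>
    (\int[lebesgue_measure]_(t in [set: R])
       iint (fun y : 'rV[R]_d' => F (row_mx (t%:M : 'rV[R]_1) y)))%E
  else fun F => F 0.

Section HalfSpace.
Context {R : realType} {n : nat}.

Definition halfspace : set 'rV[R]_n.+1 := [set x | 0 <= x 0 0].

(* R^n as the boundary of the half-space *)
Definition bemb (y : 'rV[R]_n) : 'rV[R]_n.+1 := row_mx (0 : 'rV[R]_1) y.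

Definition bproj (x : 'rV[R]_n.+1) : 'rV[R]_n := @rsubmx R 1 1 n x.

(* first fundamental form of {x_0 = 0} *)
Definition induced_metric (g : 'rV[R]_n.+1 -> 'M[R]_n.+1)
    (y : 'rV[R]_n) : 'M[R]_n :=
  @drsubmx R 1 n 1 n (g (bemb y)).

(* nu^k = - g^{0k} / sqrt (g^{00}), i.e. - grad x_0 / |grad x_0|; see
   [outward_normal_spec]. *)
Definition outward_normal (g : 'rV[R]_n.+1 -> 'M[R]_n.+1)
    (x : 'rV[R]_n.+1) : 'rV[R]_n.+1 :=
  - (Num.sqrt (ginv g x 0 0))^-1 *: row 0 (ginv g x).

Definition posdef (A : 'M[R]_n.+1) :=
  A^T = A /\ forall v : 'rV[R]_n.+1, v != 0 -> 0 < bilin A v v.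

Lemma posdef_unit A : posdef A -> A \in unitmx.
Proof.
move=> [_ Apos]; rewrite -row_free_unit -kermx_eq0; apply/eqP/row_matrixP => i.
rewrite row0; apply/eqP/negPn/negP => /Apos.
by rewrite /bilin -row_mul mulmx_ker row0 mul0mx mxE ltxx.
Qed.

Lemma outward_normal_spec g x : posdef (g x) ->
  let nu := outward_normal g x in
  [/\ bilin (g x) nu nu = 1,
      forall y, bilin (g x) nu (bemb y) = 0 &
      nu 0 0 < 0].
Proof.
move=> gpos nu; have gU := posdef_unit gpos; have [_ Apos] := gpos.
have rowE v : bilin (g x) (row 0 (ginv g x)) v = v 0 0.
  by rewrite /bilin /ginv -row_mul mulVmx // row1 -rowE !mxE.
have g00 : 0 < ginv g x 0 0.
  have := Apos (row 0 (ginv g x)); rewrite rowE mxE; apply.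
  apply/eqP => r0; have := congr1 (fun r => (r *m g x) 0 0) r0.
  rewrite -row_mul mulVmx // mul0mx !mxE eqxx => /eqP.
  by rewrite oner_eq0.
have s_gt0 : 0 < Num.sqrt (ginv g x 0 0) by rewrite sqrtr_gt0.
have nuE v : bilin (g x) nu v = - (Num.sqrt (ginv g x 0 0))^-1 * v 0 0.
  by rewrite -rowE /bilin /nu /outward_normal -!scalemxAl mxE.
have nu0 : nu 0 0 = - Num.sqrt (ginv g x 0 0).
  rewrite /nu /outward_normal !mxE -{2}(sqr_sqrtr (ltW g00)) expr2 mulNr mulrA.
  by rewrite mulVf ?mul1r // gt_eqF.
split=> [|y|].
- by rewrite nuE nu0 mulrNN mulVf // gt_eqF.
- by rewrite nuE /bemb mxE; case: split_ordP => // k _; rewrite mxE mulr0.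
- by rewrite nu0 oppr_lt0.
Qed.

End HalfSpace.

(* Nonempty smooth (n+1)-dimensional manifolds with (possibly empty) boundary.
   The maps [chart i] and [chart_inv i] are meaningful on [chart_dom i] and on
   its image only. *)
Record manifold (R : realType) (n : nat) := Manifold {
  carrier :> ptopologicalType;
  manifold_hausdorff : hausdorff_space carrier;
  manifold_second_countable : @second_countable carrier;
  chart_index : Type;
  chart_dom : chart_index -> set carrier;
  chart : chart_index -> carrier -> 'rV[R]_n.+1;
  chart_inv : chart_index -> 'rV[R]_n.+1 -> carrier;
  chart_at : carrier -> chart_index;
  chart_at_dom : forall p, chart_dom (chart_at p) p;
  chart_dom_open : forall i, open (chart_dom i);
  chart_image_open : forall i, exists2 W : set 'rV[R]_n.+1,
    open W & chart i @` chart_dom i = W `&` halfspace;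
  chartK : forall i p, chart_dom i p -> chart_inv i (chart i p) = p;
  chart_continuous : forall i, {within chart_dom i, continuous (chart i)};
  chart_inv_continuous : forall i,
    {within chart i @` chart_dom i, continuous (chart_inv i)};
  transition_smooth : forall i j k,
    smooth_within (chart i @` (chart_dom i `&` chart_dom j))
      (fun x => chart j (chart_inv i x) 0 k)
}.

Definition smooth_fun {R : realType} {n} {M : manifold R n} (f : M -> R) :=
  forall i : chart_index M,
    smooth_within (chart i @` chart_dom i) (f \o chart_inv i).

(* [jacobian i j x a b] is the derivative of the b-th coordinate of chart j
   with respect to the a-th coordinate of chart i. *)
Definition jacobian {R : realType} {n} {M : manifold R n}
    (i j : chart_index M) (x : 'rV[R]_n.+1) : 'M[R]_n.+1 :=
  \matrix_(a, b) pd halfspace a (fun y => chart j (chart_inv i y) 0 b) x.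

Record riemannian_metric {R : realType} {n} (M : manifold R n) := Metric {
  metric_mx :> chart_index M -> 'rV[R]_n.+1 -> 'M[R]_n.+1;
  metric_smooth : forall i a b,
    smooth_within (chart i @` chart_dom i) (fun x => metric_mx i x a b);
  metric_posdef : forall i p, chart_dom i p -> posdef (metric_mx i (chart i p));
  metric_compat : forall i j p, chart_dom i p -> chart_dom j p ->
    metric_mx i (chart i p) =
      jacobian i j (chart i p) *m metric_mx j (chart j p)
      *m (jacobian i j (chart i p))^T
}.

Section Geometry.
Context {R : realType} {n : nat} {M : manifold R n}.
Variable g : riemannian_metric M.
Implicit Types (f h : M -> R) (p : M).

Definition boundary : set M :=
  [set p | exists2 i, chart_dom i p & chart i p 0 0 = 0].

Definition coord p : 'rV[R]_n.+1 := chart (chart_at p) p.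

Definition rep p f : 'rV[R]_n.+1 -> R := f \o chart_inv (chart_at p).

Definition metric_at p : 'rV[R]_n.+1 -> 'M[R]_n.+1 := g (chart_at p).

Definition inner p (u v : 'rV[R]_n.+1) : R := bilin (metric_at p (coord p)) u v.

Definition grad f p : 'rV[R]_n.+1 :=
  cgrad halfspace (metric_at p) (rep p f) (coord p).

Definition hess f p : 'M[R]_n.+1 :=
  chess halfspace (metric_at p) (rep p f) (coord p).

Definition laplacian f p : R := gtrace (metric_at p) (coord p) (hess f p).

Definition hess_norm2 f p : R := gnorm2 (metric_at p) (coord p) (hess f p).

Definition drift_laplacian h f p : R :=
  laplacian f p - inner p (grad h p) (grad f p).

Definition ricci p : 'M[R]_n.+1 := cricci halfspace (metric_at p) (coord p).

Definition bakry_emery_ricci h p : 'M[R]_n.+1 := ricci p + hess h p.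

(* The operations below are meaningful at boundary points p only.  A vector
   tangent to the boundary is given by its last n components X : 'rV_n, so it
   is [bemb X] as a tangent vector of M. *)

Definition boundary_coord p : 'rV[R]_n := bproj (coord p).

Definition boundary_rep p f : 'rV[R]_n -> R := rep p f \o bemb.

Definition boundary_metric p : 'rV[R]_n -> 'M[R]_n :=
  induced_metric (metric_at p).

Definition normal p : 'rV[R]_n.+1 := outward_normal (metric_at p) (coord p).

Definition normal_derivative f p : R := inner p (grad f p) (normal p).

(* Only tangential derivatives of the normal occur, so the extension of the
   normal off the boundary given by [outward_normal] is irrelevant. *)
Definition second_form p (X Y : 'rV[R]_n) : R :=
  inner p
    (covd halfspace (metric_at p) (outward_normal (metric_at p))
       (bemb X) (coord p))
    (bemb Y).

Definition mean_curvature p : R :=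
  gtrace (boundary_metric p) (boundary_coord p)
    (\matrix_(a, b) second_form p (delta_mx 0 a) (delta_mx 0 b)).

Definition boundary_inner p (X Y : 'rV[R]_n) : R :=
  bilin (boundary_metric p (boundary_coord p)) X Y.

Definition boundary_grad f p : 'rV[R]_n :=
  cgrad setT (boundary_metric p) (boundary_rep p f) (boundary_coord p).

Definition boundary_laplacian f p : R :=
  gtrace (boundary_metric p) (boundary_coord p)
    (chess setT (boundary_metric p) (boundary_rep p f) (boundary_coord p)).

Definition borel := g_sigma_algebraType (@open M).

(* The Riemannian volume measure is the Borel measure with density
   sqrt (det g) in every chart. *)
Definition is_volume (vol : {measure set borel -> \bar R}) :=
  forall i (A : set borel), measurable A -> A `<=` chart_dom i ->
    vol A = iint (fun x : 'rV[R]_n.+1 =>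
      (\1_(chart i @` A) x * Num.sqrt (\det (g i x)))%:E).

(* Volume measure of the induced metric on the boundary, seen as a measure on
   M; it gives mass 0 to the complement of the boundary. *)
Definition is_boundary_volume (sigma : {measure set borel -> \bar R}) :=
  forall i (A : set borel), measurable A -> A `<=` chart_dom i ->
    sigma A = iint (fun y : 'rV[R]_n =>
      (\1_(chart i @` A) (bemb y)
       * Num.sqrt (\det (induced_metric (g i) y)))%:E).

End Geometry.

Arguments borel {R n} M.
Arguments boundary {R n} M.

(* Main.v *)
(* Let X = grad f and Z = (L_h f) X - nabla_X X.  Bochner's formula says that the
   weighted divergence of Z is (L_h f)^2 - |D^2 f|^2 - Ric^h(X, X), and the Gauss
   formula for the Hessian on the boundary says that <Z, nu> is the sum of the two
   boundary integrands, so the theorem is the divergence theorem for Z with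
   respect to dm.  Both identities are computed in one chart, where partial
   derivatives at boundary points are one-sided.  They transfer to all charts
   because a Hessian is determined by the brackets <grad u, grad v> of functions,
   and because a transition map cannot send an interior point to the boundary:
   its 0-th coordinate would have a minimum there.  The divergence theorem follows
   by a partition of unity from its version on the half-space, which is Fubini's
   theorem and the fundamental theorem of calculus. *)
Require Import Defs.
From HB Require Import structures.
From mathcomp Require Import all_boot all_order all_algebra.
From mathcomp Require Import perm.
From mathcomp Require Import all_classical all_reals all_analysis.
From mathcomp Require Import measurable_realfun ring lra.

Set Implicit Arguments.
Unset Strict Implicit.
Unset Printing Implicit Defensive.
Import Order.TTheory GRing.Theory Num.Theory.
Import numFieldNormedType.Exports.
Local Open Scope classical_set_scope.
Local Open Scope ring_scope.

(** * Calculus on half-spaces *)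

(** A function read in a chart has meaningful values only on the chart image, so regularity is
    stated through [germ]: local agreement, on the model space, with a [C^k] function on an open set
    of [R^d]. The one-sided [pd] is then the ordinary partial derivative of the extension, and
    product rule, chain rule and symmetry of second derivatives hold up to the boundary. No
    transformation law is proved for Christoffel symbols or for curvature. Laplacians and brackets
    are invariant; [nabla_X X] is half the gradient of [<X, X>], so the divergence of [Z] is a
    combination of Laplacians and brackets; and Bochner's formula read backwards makes [Ric^h(X, X)]
    invariant. The integrals take values in the extended reals, where sums are separated by
    integrating each term. Hence the curvature term, the divergence and each boundary integrand are
    separately shown to be continuous. For this each needs one expression valid in a whole chart,
    while the definitions may use another preferred chart at every point. *)

Section LineCalculus.
Context {R : realType} {d : nat}.
Implicit Types (W V D : set 'rV[R]_d) (F G : 'rV[R]_d -> R) (x y v : 'rV[R]_d).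
Local Notation e_ k := (delta_mx 0 k : 'rV[R]_d).

Lemma is_derive_line G y v s : derivable G (y + s *: v) v ->
  is_derive s 1 (fun t => G (y + t *: v)) ('D_v G (y + s *: v)).
Proof.
have E : (fun h : R => h^-1 *: (((fun t : R => G (y + t *: v)) \o shift s) (h *: (1:R)) - G (y + s *: v))) =
   (fun h : R => h^-1 *: ((G \o shift (y + s *: v)) (h *: v) - G (y + s *: v))).
  apply/funext => h /=; congr (_ *: (G _ - _)).
  by rewrite /shift /= [h *: 1]mulr1 scalerDl addrCA.
move=> dG; split; first by rewrite /derivable E.
by rewrite /derive E.
Qed.

Lemma continuous_line y v : continuous (fun t : R => y + t *: v).
Proof.
by move=> t; apply: cvgD; [exact: cvg_cst | apply: cvgZr_tmp; exact: cvg_id].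
Qed.

Lemma norm_delta k : `|e_ k| <= 1.
Proof.
rewrite [leLHS]/Num.Def.normr/= mx_normrE; apply: bigmax_le => // i _.
by rewrite mxE; case: (_ && _); rewrite ?normr1 ?normr0.
Qed.

Lemma norm_coord v k : `|v 0 k| <= `|v|.
Proof.
rewrite [leRHS]/Num.Def.normr/= mx_normrE.
by apply: le_trans (le_bigmax _ _ (ord0, k)); rewrite ?ord1.
Qed.

Lemma norm_rV_le v c : 0 <= c -> (forall k, `|v 0 k| <= c) -> `|v| <= c.
Proof.
move=> c0 vc; rewrite [leLHS]/Num.Def.normr/= mx_normrE.
by apply: bigmax_le => // -[i k] _; rewrite (ord1 i); exact: vc.
Qed.

(** The bound [|s| <= |b|] covers both signs of [b]; for [b < 0] the classical theorem is applied on
    [[b, 0]] and the signs are reversed. *)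
Lemma MVT_line G y v (b : R) :
  (forall s, `|s| <= `|b| -> derivable G (y + s *: v) v) ->
  exists2 s, `|s| <= `|b| & G (y + b *: v) - G y = 'D_v G (y + s *: v) * b.
Proof.
move=> dG.
pose f t := G (y + t *: v).
have df (s : R) : `|s| <= `|b| -> is_derive s 1 f ('D_v G (y + s *: v)).
  by move=> /dG; exact: is_derive_line.
have cf s : `|s| <= `|b| -> {for s, continuous f}.
  by move=> /df /@ex_derive/derivable1_diffP/differentiable_continuous.
have G0 : G y = f 0 by rewrite /f scale0r addr0.
case: (leP 0 b) => b0.
  have H s : s \in `[0, b] -> `|s| <= `|b|.
    by rewrite in_itv /= => /andP[s0 sb]; rewrite !ger0_norm.
  have [c cab E] := @MVT_segment R f (fun s => 'D_v G (y + s *: v)) 0 b b0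
    (fun s sab => df s (H s (subset_itv_oo_cc sab)))
    (continuous_in_subspaceT (fun s sab => cf s (H s (set_mem sab)))).
  by exists c; [exact: H | rewrite G0 E subr0].
have H s : s \in `[b, 0] -> `|s| <= `|b|.
  rewrite in_itv /= => /andP[s0 sb]; rewrite ler0_norm// (ltr0_norm b0).
  by rewrite lerN2.
have [c cab E] := @MVT_segment R f (fun s => 'D_v G (y + s *: v)) b 0 (ltW b0)
    (fun s sab => df s (H s (subset_itv_oo_cc sab)))
    (continuous_in_subspaceT (fun s sab => cf s (H s (set_mem sab)))).
exists c; first exact: H.
rewrite G0 -/(f b); move: E; rewrite sub0r mulrN => /(congr1 -%R).
by rewrite opprB opprK.
Qed.

(** Corners of the staircase from 0 to [v] that changes one coordinate at a time. *)
Definition trunc_rV (m : nat) v : 'rV[R]_d :=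
  \row_j (if (j < m)%N then v 0 j else 0).

(** Telescoping along the staircase [trunc_rV], with the mean value theorem on each leg. In the sup
    norm all intermediate points stay within [|v|] of [y]. *)
Lemma MVT_multi G y v (r : R) :
  (forall z k, ball y r z -> derivable G z (e_ k)) -> `|v| < r ->
  exists xi : 'I_d -> 'rV[R]_d, (forall k, `|xi k - y| <= `|v|) /\
    G (y + v) - G y = \sum_k 'D_(e_ k) G (xi k) * v 0 k.
Proof.
move=> dG vr.
have trN m (s : R) (k : 'I_d) : (k : nat) = m -> `|s| <= `|v 0 k| ->
    `|trunc_rV m v + s *: e_ k| <= `|v|.
  move=> km sv; apply: norm_rV_le => // j; rewrite !mxE eqxx /=.
  case: ltnP => jm; last first.
    rewrite add0r; case: eqP => [_|_]; last by rewrite mulr0 normr0.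
    by rewrite mulr1 (le_trans sv)// norm_coord.
  have -> : (j == k) = false by apply: contraTF jm => /eqP ->; rewrite km ltnn.
  by rewrite mulr0 addr0 norm_coord.
have step (k : 'I_d) : exists2 xi, `|xi - y| <= `|v| &
   G (y + trunc_rV k.+1 v) - G (y + trunc_rV k v) = 'D_(e_ k) G xi * v 0 k.
  have -> : y + trunc_rV k.+1 v = (y + trunc_rV k v) + v 0 k *: e_ k.
    rewrite -addrA; congr (_ + _); apply/rowP => j; rewrite !mxE eqxx /= ltnS.
    have [->|jk] := eqVneq j k; first by rewrite leqnn ltnn mulr1 add0r.
    by rewrite mulr0 addr0 leq_eqVlt (inj_eq val_inj) (negbTE jk).
  have [s sv|s sv E] := @MVT_line G (y + trunc_rV k v) (e_ k) (v 0 k).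
    apply: dG; rewrite -ball_normE /ball_ /= -addrA opprD addrA subrr.
    by rewrite sub0r normrN (le_lt_trans _ vr)// trN.
  exists (y + trunc_rV k v + s *: e_ k) => //.
  by rewrite -(addrA y) (addrC y) addrK trN.
pose xi k := projT1 (cid2 (step k)).
exists xi; split; first by move=> k; rewrite /xi; case: cid2.
have -> : \sum_k 'D_(e_ k) G (xi k) * v 0 k =
   \sum_(k < d) (G (y + trunc_rV k.+1 v) - G (y + trunc_rV k v)).
  by apply: eq_bigr => k _; rewrite /xi; case: cid2.
rewrite -(big_mkord xpredT (fun k => G (y + trunc_rV k.+1 v) - G (y + trunc_rV k v))).
rewrite (@telescope_sumr _ 0 d (fun k => G (y + trunc_rV k v)))//.
congr (G _ - G _).
  by congr (_ + _); apply/rowP => j; rewrite !mxE ltn_ord.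
by rewrite -[LHS]addr0; congr (_ + _); apply/rowP => j; rewrite !mxE.
Qed.

End LineCalculus.

(** * Functions of class [C^k] on open sets *)

Section CkOn.
Context {R : realType} {d : nat}.
Implicit Types (W V D : set 'rV[R]_d) (F G : 'rV[R]_d -> R) (x y v : 'rV[R]_d).
Local Notation e_ k := (delta_mx 0 k : 'rV[R]_d).

Lemma near_open W x : open W -> W x -> \forall y \near x, W y.
Proof. by move=> Wo Wx; exact: open_nbhs_nbhs. Qed.

Lemma near_eq_open W F G x : open W -> W x -> (forall y, W y -> F y = G y) ->
  \forall y \near x, F y = G y.
Proof. by move=> Wo Wx FG; apply: filterS (near_open Wo Wx). Qed.

Lemma Ck_on_sub k W V G : V `<=` W -> Ck_on k W G -> Ck_on k V G.
Proof.
elim: k G => [|k IH] G VW /= [cG dG]; split=> //; first by move=> x /VW/cG.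
- by move=> x /VW/cG.
- by move=> j; have [dj Cj] := dG j; split; [move=> x /VW/dj | exact: IH].
Qed.

Lemma Ck_on_ext k W F G : open W -> (forall y, W y -> F y = G y) ->
  Ck_on k W F -> Ck_on k W G.
Proof.
move=> Wo.
have H F' G' : (forall y, W y -> F' y = G' y) ->
    (forall x, W x -> {for x, continuous F'}) ->
    (forall x, W x -> {for x, continuous G'}).
  move=> FG cF x Wx; have := cF x Wx.
  rewrite /prop_for /continuous_at (FG _ Wx) => h; apply: cvg_trans h.
  exact: (near_eq_cvg (near_eq_open Wo Wx FG)).
elim: k F G => [|k IH] F G FG /= [cF dF]; split=> //; try exact: H cF.
- move=> j; have [dj Cj] := dF j; split.
    move=> x Wx; apply: near_eq_derivable (dj x Wx).
    exact: near_eq_open Wo Wx FG.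
  apply: IH Cj => x Wx; apply: near_eq_derive; exact: near_eq_open Wo Wx FG.
Qed.

Lemma Ck_onW k W G : Ck_on k.+1 W G -> Ck_on k W G.
Proof.
elim: k G => [|k IH] G [cG dG]; split=> // j.
by have [dj Cj] := dG j; split=> //; exact: IH.
Qed.

Lemma Ck_on_le k l W G : (k <= l)%N -> Ck_on l W G -> Ck_on k W G.
Proof.
move=> kl; rewrite -(subnK kl); elim: (l - k)%N => // m IH.
by rewrite addSn => /Ck_onW.
Qed.

Lemma Ck_on_cts k W G x : Ck_on k W G -> W x -> {for x, continuous G}.
Proof. by case: k => [|k] [cG _] /cG. Qed.

Lemma Ck_on_derivable k W G x j : Ck_on k.+1 W G -> W x -> derivable G x (e_ j).
Proof. by move=> [_ /(_ j)[dG _]] /dG. Qed.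

Lemma Ck_on_derive k W G j : Ck_on k.+1 W G -> Ck_on k W (fun x => 'D_(e_ j) G x).
Proof. by move=> [_ /(_ j)[]]. Qed.

Lemma Ck_on_cst k W (c : R) : Ck_on k W (fun=> c).
Proof.
have H (b : R) x : W x -> {for x, continuous (fun=> b)} by move=> _; exact: cst_continuous.
elim: k c => [|k IH] c; split=> //; try exact: H.
move=> j; split=> [x _|]; first exact: derivable_cst.
suff -> : (fun x => 'D_(e_ j) (fun=> c) x) = (fun=> 0) by exact: IH.
by apply/funext => x; exact: derive_cst.
Qed.

Lemma is_derive_coord x i v : is_derive x v (fun y : 'rV[R]_d => y 0 i) (v 0 i).
Proof.
have E : (fun h : R => h^-1 *: (((fun y : 'rV[R]_d => y 0 i) \o shift x) (h *: v) - x 0 i))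
   @ 0^' --> v 0 i.
  apply/cvgrPdist_le => /= e e0; near=> h.
  rewrite !mxE addrK /GRing.scale /= mulrA mulVf ?mul1r ?subrr ?normr0 ?ltW//.
  by near: h; exact: (@nbhs_dnbhs_neq _ 0).
split; first by apply/cvg_ex; exists (v 0 i).
exact: cvg_lim E.
Unshelve. all: by end_near. Qed.

Lemma Ck_on_coord k W i : Ck_on k W (fun y => y 0 i).
Proof.
case: k => [|k]; split=> //; try by move=> x _; exact: coord_continuous.
move=> j; split=> [x _|]; first by have [] := is_derive_coord x i (e_ j).
rewrite (_ : (fun x => _) = (fun=> (e_ j) 0 i)); first exact: Ck_on_cst.
by apply/funext => x; have [_ ->] := is_derive_coord x i (e_ j).
Qed.

Lemma is_derive_comp1 (p : R -> R) F (a : R) x v :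
  is_derive (F x) 1 p a -> derivable F x v ->
  is_derive x v (p \o F) (a * 'D_v F x).
Proof.
move=> dp dF.
have dl : is_derive (0 : R) 1 (fun t : R => F (x + t *: v)) ('D_v F x).
  by have := @is_derive_line R d F x v 0; rewrite scale0r addr0; apply.
have dp0 : is_derive (F (x + (0 : R) *: v)) 1 p a by rewrite scale0r addr0.
have dc : is_derive (0 : R) 1 (fun t : R => p (F (x + t *: v))) (a * 'D_v F x).
  have [d1 e1] := dl; have [d2 e2] := dp0.
  split.
    by apply/derivable1_diffP/(differentiable_comp (f := fun t : R => F (x + t *: v)));
      exact/derivable1_diffP.
  rewrite -derive1E (derive1_comp (f := fun t : R => F (x + t *: v)) d1 d2).
  by rewrite !derive1E e1 e2.
have E : (fun h : R => h^-1 *: (((fun t : R => p (F (x + t *: v))) \o shift 0)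
      (h *: (1:R)) - p (F (x + (0 : R) *: v)))) =
    (fun h : R => h^-1 *: (((p \o F) \o shift x) (h *: v) - (p \o F) x)).
  apply/funext => h; rewrite /shift /= scale0r !addr0; congr (_ *: (p (F _) - _)).
  by rewrite [h *: 1]mulr1 addrC.
by case: dc; rewrite /derivable /derive E.
Qed.

Section Closure.
Variables (W : set 'rV[R]_d) (Wo : open W).

(** [Ck_on] speaks of the derivative as a total function, whereas the calculus rules compute it on
    [W] only; this bridges the two and drives the inductions on [k] below. *)
Lemma Ck_onS k G (dG : 'I_d -> 'rV[R]_d -> R) :
  (forall x, W x -> {for x, continuous G}) ->
  (forall j x, W x -> is_derive x (e_ j) G (dG j x)) ->
  (forall j, Ck_on k W (dG j)) -> Ck_on k.+1 W G.
Proof.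
move=> cG idG CG; split=> // j; split=> [x /(idG j)[]//|].
by apply: Ck_on_ext (CG j) => // x /(idG j)[_ ->].
Qed.

Lemma Ck_on_is_derive k G x j : Ck_on k.+1 W G -> W x ->
  is_derive x (e_ j) G ('D_(e_ j) G x).
Proof. by move=> CG Wx; split=> //; exact: Ck_on_derivable CG Wx. Qed.

Lemma Ck_onD k F G : Ck_on k W F -> Ck_on k W G ->
  Ck_on k W (fun x => F x + G x).
Proof.
elim: k F G => [|k IH] F G CF CG.
  by split=> // x Wx; apply: continuousD; [exact: Ck_on_cts CF _|exact: Ck_on_cts CG _].
apply: (Ck_onS (dG := fun j x => 'D_(e_ j) F x + 'D_(e_ j) G x)).
- by move=> x Wx; apply: continuousD; [exact: Ck_on_cts CF _|exact: Ck_on_cts CG _].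
- by move=> j x Wx; apply: (is_deriveD (Ck_on_is_derive j CF Wx) (Ck_on_is_derive j CG Wx)).
- by move=> j; apply: IH; [exact: Ck_on_derive CF|exact: Ck_on_derive CG].
Qed.

Lemma Ck_onM k F G : Ck_on k W F -> Ck_on k W G ->
  Ck_on k W (fun x => F x * G x).
Proof.
elim: k F G => [|k IH] F G CF CG.
  by split=> // x Wx; apply: continuousM; [exact: Ck_on_cts CF _|exact: Ck_on_cts CG _].
apply: (Ck_onS (dG := fun j x => F x * 'D_(e_ j) G x + G x * 'D_(e_ j) F x)).
- by move=> x Wx; apply: continuousM; [exact: Ck_on_cts CF _|exact: Ck_on_cts CG _].
- by move=> j x Wx; apply: (is_deriveM (Ck_on_is_derive j CF Wx) (Ck_on_is_derive j CG Wx)).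
- move=> j; apply: Ck_onD; apply: IH.
  + exact: Ck_onW CF.
  + exact: Ck_on_derive CG.
  + exact: Ck_onW CG.
  + exact: Ck_on_derive CF.
Qed.

(** The derivative of [p] is given as a function [a] of the point [x]. For inverse, exponential and
    square root, [a] is itself built from [p (F x)], so that its regularity is the induction
    hypothesis. *)
Lemma Ck_on_comp1 k (p : R -> R) F (a : 'rV[R]_d -> R) :
  (forall x, W x -> is_derive (F x) 1 p (a x)) ->
  Ck_on k.+1 W F -> Ck_on k W a -> Ck_on k.+1 W (p \o F).
Proof.
move=> dp CF Ca.
have cp x : W x -> {for F x, continuous p}.
  by move=> Wx; apply/differentiable_continuous/derivable1_diffP; have [] := dp x Wx.
apply: (Ck_onS (dG := fun j x => a x * 'D_(e_ j) F x)).
- by move=> x Wx; apply: continuous_comp; [exact: Ck_on_cts CF Wx|exact: cp].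
- move=> j x Wx; apply: is_derive_comp1 (dp x Wx) _; exact: Ck_on_derivable CF Wx.
- by move=> j; apply: Ck_onM => //; exact: Ck_on_derive.
Qed.

Lemma Ck_onN k F : Ck_on k W F -> Ck_on k W (fun x => - F x).
Proof.
move=> CF; apply: (Ck_on_ext (F := fun x => -1 * F x)) => //.
  by move=> y _; rewrite mulN1r.
by apply: Ck_onM => //; exact: Ck_on_cst.
Qed.

Lemma Ck_on_inv k F : (forall x, W x -> F x != 0) ->
  Ck_on k W F -> Ck_on k W (fun x => (F x)^-1).
Proof.
move=> F0; elim: k => [|k IH] CF.
  by split=> // x Wx; apply: continuousV; [exact: F0|exact: Ck_on_cts CF _].
apply: (@Ck_on_comp1 k GRing.inv F (fun x => - (F x)^-1 * (F x)^-1)) => //.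
  move=> x Wx; have := is_deriveV (F0 x Wx) (is_derive_id (F x) (1 : R)).
  by rewrite /= mulNr -expr2 exprVn /GRing.scale /= mulr1.
have C := IH (Ck_onW CF); apply: Ck_onM => //; exact: Ck_onN.
Qed.

Lemma Ck_on_exp k F : Ck_on k W F -> Ck_on k W (fun x => expR (F x)).
Proof.
elim: k => [|k IH] CF.
  split=> // x Wx; apply: (@continuous_comp _ _ _ F expR); first exact: Ck_on_cts CF _.
  exact: continuous_expR.
apply: (@Ck_on_comp1 k expR F (fun x => expR (F x))) CF (IH (Ck_onW CF)).
Qed.

Lemma Ck_on_sqrt k F : (forall x, W x -> 0 < F x) ->
  Ck_on k W F -> Ck_on k W (fun x => Num.sqrt (F x)).
Proof.
move=> F0; elim: k => [|k IH] CF.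
  split=> // x Wx; apply: (@continuous_comp _ _ _ F Num.sqrt); first exact: Ck_on_cts CF _.
  exact: sqrt_continuous.
apply: (@Ck_on_comp1 k Num.sqrt F (fun x => (2 * Num.sqrt (F x))^-1)); last 2 first.
  exact: CF.
  apply: Ck_on_inv => [x Wx|]; first by rewrite mulf_neq0 ?gt_eqF ?sqrtr_gt0 ?F0.
  by apply: Ck_onM; [exact: Ck_on_cst|exact: IH (Ck_onW CF)].
by move=> x Wx; apply: is_derive1_sqrt; exact: F0.
Qed.

End Closure.

End CkOn.

(** * Symmetry of second derivatives and the chain rule *)

Section SchwarzChain.
Context {R : realType} {d : nat}.
Implicit Types (W V D : set 'rV[R]_d) (F G : 'rV[R]_d -> R) (x y v : 'rV[R]_d).
Local Notation e_ k := (delta_mx 0 k : 'rV[R]_d).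

Lemma is_derive_translate G z y v : derivable G (y + z) v ->
  is_derive y v (fun w => G (w + z)) ('D_v G (y + z)).
Proof.
have E : (fun h : R => h^-1 *: (((fun w => G (w + z)) \o shift y) (h *: v) - G (y + z))) =
   (fun h : R => h^-1 *: ((G \o shift (y + z)) (h *: v) - G (y + z))).
  by apply/funext => h /=; rewrite /shift /= addrA.
by move=> dG; split; rewrite /derivable /derive E.
Qed.

(** Two applications of the mean value theorem: to [H y = G (y + t e_j) - G y] along [e_i], then to
    the [i]-th partial derivative of [G] along [e_j]. *)
Lemma second_difference W G x r t i j : (forall y, ball x r y -> W y) ->
  open W -> Ck_on 2 W G -> 0 < t -> 2 * t < r ->
  exists2 xi, `|xi - x| <= 2 * t &
    G (x + t *: e_ i + t *: e_ j) - G (x + t *: e_ i) -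
    (G (x + t *: e_ j) - G x) = 'D_(e_ j) (fun y => 'D_(e_ i) G y) xi * t * t.
Proof.
move=> xrW oW CG t0 tr.
have nb (s u : R) : `|s| <= t -> `|u| <= t ->
    `|x + s *: e_ i + u *: e_ j - x| <= 2 * t.
  move=> st ut; rewrite -(addrA x) (addrC x) addrK.
  rewrite mulr_natl mulr2n (le_trans (ler_normD _ _))// lerD// normrZ.
    by rewrite -[leRHS]mulr1 ler_pM ?norm_delta.
  by rewrite -[leRHS]mulr1 ler_pM ?norm_delta.
have nW (s u : R) : `|s| <= t -> `|u| <= t -> W (x + s *: e_ i + u *: e_ j).
  move=> st ut; apply: xrW; rewrite -ball_normE /ball_ /= distrC.
  exact: le_lt_trans (nb _ _ st ut) tr.
have nW0 (s : R) : `|s| <= t -> W (x + s *: e_ i).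
  by move=> st; have := nW s 0 st; rewrite scale0r addr0 normr0 => H; apply: H; exact: ltW.
have tt : `|t| = t by rewrite gtr0_norm.
pose H y := G (y + t *: e_ j) - G y.
have dH (s : R) : `|s| <= t -> is_derive (x + s *: e_ i) (e_ i) H
    ('D_(e_ i) G (x + s *: e_ i + t *: e_ j) - 'D_(e_ i) G (x + s *: e_ i)).
  move=> st; apply: is_deriveB.
    by apply: is_derive_translate; apply: Ck_on_derivable CG _; apply: nW => //; rewrite tt.
  by apply: Ck_on_is_derive CG _; exact: nW0.
have [s|s st E] := @MVT_line R d H x (e_ i) t.
  by rewrite tt => /dH[].
move: E; rewrite tt in st; have [_ ->] := dH s st.
have [u|u ut ->] := @MVT_line R d (fun y => 'D_(e_ i) G y) (x + s *: e_ i) (e_ j) t.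
  rewrite tt => ut; apply: Ck_on_derivable (Ck_on_derive i CG) _; exact: nW.
rewrite tt in ut.
rewrite /H => E; exists (x + s *: e_ i + u *: e_ j); first exact: nb.
exact: E.
Qed.

Lemma continuous_ball2 F G x e : {for x, continuous F} -> {for x, continuous G} ->
  0 < e -> exists2 s : R, 0 < s & forall y, ball x s y ->
   `|F x - F y| < e /\ `|G x - G y| < e.
Proof.
move=> /cvgrPdist_lt cF /cvgrPdist_lt cG e0.
have /nbhs_ballP[s /= s0 sP] := cF _ e0.
have /nbhs_ballP[r /= r0 rP] := cG _ e0.
exists (Num.min s r); first by rewrite lt_min s0.
move=> y; rewrite -ball_normE /ball_ /= lt_min => /andP[ys yr].
by split; [apply: sP|apply: rP]; rewrite -ball_normE.
Qed.

Lemma second_difference_sym (a b c c' t p q : R) : t != 0 ->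
  a - b - (c - c') = p * t * t -> a - c - (b - c') = q * t * t -> p = q.
Proof.
move=> t0 E1 E2; apply: (mulIf t0); apply: (mulIf t0); rewrite -E1 -E2; ring.
Qed.

Lemma norm_dist_triangle (p q c e : R) : `|p - c| < e / 2 -> `|q - c| < e / 2 ->
  `|p - q| <= e.
Proof.
move=> pc qc; rewrite -(subrKA c) (le_trans (ler_normD _ _))// (splitr e) lerD//.
  exact: ltW.
by rewrite distrC ltW.
Qed.

(** The second difference is symmetric in [i] and [j], so the two mixed derivatives take a common
    value at two points close to [x]; their continuity does the rest. *)
Lemma schwarz W G x i j : open W -> Ck_on 2 W G -> W x ->
  'D_(e_ j) (fun y => 'D_(e_ i) G y) x = 'D_(e_ i) (fun y => 'D_(e_ j) G y) x.
Proof.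
move=> oW CG Wx.
have [r /= r0 xrW] : exists2 r : R, 0 < r & forall y, ball x r y -> W y.
  by have /nbhs_ballP[r /= r0 rW] := near_open oW Wx; exists r.
have cij k l : {for x, continuous (fun y => 'D_(e_ k) (fun z => 'D_(e_ l) G z) y)}.
  by have := Ck_on_derive k (Ck_on_derive l CG) => /Ck_on_cts; apply.
apply/eqP; rewrite -subr_eq0 -normr_le0; apply/ler_addgt0Pr => e e0; rewrite add0r.
have e2 : 0 < e / 2 by rewrite divr_gt0.
have [s s0 sP] := continuous_ball2 (cij j i) (cij i j) e2.
pose m := Num.min r s.
have m0 : 0 < m by rewrite lt_min r0 s0.
have mr : m <= r by rewrite ge_min lexx.
(* This makes [2 * t < m]: the corners of the second difference stay in [W], and both mean value
   points lie in the ball of radius [s]. *)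
pose t := m / 4.
have t0 : 0 < t by rewrite divr_gt0.
have tm : 2 * t < m by rewrite /t; lra.
have [xi1 d1 E1] := @second_difference W G x r t i j xrW oW CG t0 (lt_le_trans tm mr).
have [xi2 d2 E2] := @second_difference W G x r t j i xrW oW CG t0 (lt_le_trans tm mr).
have E : 'D_(e_ j) (fun y => 'D_(e_ i) G y) xi1 = 'D_(e_ i) (fun y => 'D_(e_ j) G y) xi2.
  rewrite (addrAC x (t *: e_ j) (t *: e_ i)) in E2.
  exact: second_difference_sym (lt0r_neq0 t0) E1 E2.
have bs xi : `|xi - x| <= 2 * t -> ball x s xi.
  move=> dx; rewrite -ball_normE /ball_ /= distrC.
  apply: le_lt_trans dx (lt_le_trans tm _).
  by rewrite ge_min lexx orbT.
have [h1 _] := sP _ (bs _ d1); have [_ h2] := sP _ (bs _ d2).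
by rewrite E in h1; exact: norm_dist_triangle h1 h2.
Qed.

(** By [MVT_multi], the difference quotient of [G \o T] is a sum of partial derivatives of [G] at
    points tending to [T a], times difference quotients of the coordinates of [T] along [u]. *)
Lemma is_derive_chain (N : normedModType R) W G (T : N -> 'rV[R]_d) (a u : N)
    (T' : 'I_d -> R) :
  open W -> Ck_on 1 W G -> W (T a) ->
  (forall k, is_derive a u (fun b => T b 0 k) (T' k)) ->
  is_derive a u (G \o T) (\sum_k 'D_(e_ k) G (T a) * T' k).
Proof.
move=> oW CG WT dT.
have [r /= r0 xrW] : exists2 r : R, 0 < r & forall y, ball (T a) r y -> W y.
  by have /nbhs_ballP[r /= r0 rW] := near_open oW WT; exists r.
pose w (h : R) := T (h *: u + a) - T a.
have cw k : (fun h : R => h^-1 *: (w h 0 k)) @ 0^' --> T' k.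
  have [d1 <-] := dT k.
  rewrite [X in X @ _ --> _](_ : _ = (fun h : R => h^-1 *: (((fun b => T b 0 k) \o shift a) (h *: u) - T a 0 k))) //.
  by apply/funext => h /=; rewrite /w !mxE.
have w0 : w @ 0^' --> (0 : 'rV[R]_d).
  have Td : derivable T a u.
    by apply/derivable_mxP => i j; rewrite (ord1 i); have [] := dT j.
  have -> : (0 : 'rV[R]_d) = (0 : R) *: lim ((fun h : R => h^-1 *: ((T \o shift a) (h *: u) - T a)) @ 0^').
    by rewrite scale0r.
  have C : (fun h : R => h *: (h^-1 *: ((T \o shift a) (h *: u) - T a))) @ 0^' -->
    (0 : R) *: lim ((fun h : R => h^-1 *: ((T \o shift a) (h *: u) - T a)) @ 0^').
    by apply: cvgZ => //; apply: cvg_within_filter; exact: cvg_id.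
  apply: cvg_trans C; apply: near_eq_cvg; near=> h.
  by rewrite scalerA mulfV ?scale1r //; near: h; exact: (@nbhs_dnbhs_neq _ 0).
(* The bound on [w h] is put inside the existential, so that [xi] can be chosen for all [h] at once;
   the other [h] get an arbitrary value. *)
have ex h : exists xi : 'I_d -> 'rV[R]_d, `|w h| < r ->
  (forall k, `|xi k - T a| <= `|w h|) /\
    G (T a + w h) - G (T a) = \sum_k 'D_(e_ k) G (xi k) * w h 0 k.
  have [wr|wr] := pselect (`|w h| < r); last by exists (fun=> 0) => /wr.
  have [z k /xrW/(Ck_on_derivable CG)//|xi H] := @MVT_multi R d G (T a) (w h) r _ wr.
  by exists xi.
pose xi h := projT1 (cid (ex h)).
have xiP h : `|w h| < r -> (forall k, `|xi h k - T a| <= `|w h|) /\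
    G (T a + w h) - G (T a) = \sum_k 'D_(e_ k) G (xi h k) * w h 0 k.
  by rewrite /xi; case: cid.
have wr : \forall h \near 0^', `|w h| < r.
  by move/cvgr0Pnorm_lt : w0 => /(_ _ r0).
have cxi k : (fun h => xi h k) @ 0^' --> T a.
  apply/cvgrPdist_lt => e e0; near=> h.
  have hr : `|w h| < r by near: h.
  rewrite distrC; apply: le_lt_trans ((xiP h hr).1 k) _.
  by near: h; move/cvgr0Pnorm_lt : w0 => /(_ _ e0).
have C : (fun h : R => h^-1 *: (((G \o T) \o shift a) (h *: u) - (G \o T) a)) @ 0^'
    --> \sum_k 'D_(e_ k) G (T a) * T' k.
  have C1 : (fun h : R => \sum_k 'D_(e_ k) G (xi h k) * (h^-1 *: (w h 0 k))) @ 0^'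
     --> \sum_k 'D_(e_ k) G (T a) * T' k.
    apply: (@cvg_big _ _ +%R) => [|k _]; first exact: add_continuous.
    apply: cvgM => //.
    have ck : {for T a, continuous (fun y => 'D_(e_ k) G y)}.
      exact: Ck_on_cts (Ck_on_derive k CG) WT.
    exact: (cvg_comp _ _ (cxi k) ck).
  apply: cvg_trans C1; apply: near_eq_cvg; near=> h.
  have hr : `|w h| < r by near: h.
  have /= -> : (G \o T) (shift a (h *: u)) = G (T a + w h) by rewrite /w addrC subrK.
  rewrite (xiP h hr).2 scaler_sumr; apply: eq_bigr => k _.
  by rewrite /GRing.scale /= mulrCA.
split; first by apply/cvg_ex; exists (\sum_k 'D_(e_ k) G (T a) * T' k).
exact: cvg_lim C.
Unshelve. all: by end_near. Qed.

End SchwarzChain.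

(* Moving along a positive coordinate direction stays in D, so that the limits
   defining [pd] are taken along a proper filter. *)
Definition model_space {R : realType} {d} (D : set 'rV[R]_d) :=
  forall x k (t : R), D x -> 0 <= t -> D (x + t *: delta_mx 0 k).

Lemma model_setT {R : realType} {d} : model_space (@setT 'rV[R]_d).
Proof. by []. Qed.

Lemma model_halfspace {R : realType} {n} : model_space (@halfspace R n).
Proof.
move=> x k t; rewrite /halfspace /= !mxE => x0 t0.
by rewrite addr_ge0// mulr_ge0// ler0n.
Qed.

(** Functions read in a chart are controlled only on the chart image, so regularity at [x] means
    having a [C^k] extension near [x]. The extension is not unique, but its first derivatives on [D]
    are, by [pdE]. *)
Definition germ {R : realType} {d} k (D : set 'rV[R]_d) (F : 'rV[R]_d -> R) x :=
  exists W G, [/\ open W, W x, Ck_on k W G & forall y, W y -> D y -> F y = G y].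

Section Germs.
Context {R : realType} {d : nat}.
Variables (D : set 'rV[R]_d) (mD : model_space D).
Implicit Types (F G : 'rV[R]_d -> R) (x y : 'rV[R]_d).
Local Notation e_ k := (delta_mx 0 k : 'rV[R]_d).
Local Notation dir x k := (within [set t : R | D (x + t *: e_ k)] 0^').

Lemma near_eqW F G x : (forall y, F y = G y) -> \forall y \near x, D y -> F y = G y.
Proof. by move=> FG; near=> y => _. Unshelve. all: by end_near. Qed.

Lemma dir_proper x k : D x -> ProperFilter (dir x k).
Proof.
move=> Dx; apply: Build_ProperFilter_ex => A /nbhs_ballP[r /= r0 rA].
exists (r / 2); apply: rA.
- by rewrite -ball_normE /ball_ /= sub0r normrN gtr0_norm ?divr_gt0//; lra.
- by rewrite gt_eqF// divr_gt0.
- by apply: mD => //; rewrite divr_ge0// ltW.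
Qed.

Lemma near_dir x k (P : set 'rV[R]_d) : (\forall y \near x, P y) ->
  \forall t \near dir x k, P (x + t *: e_ k).
Proof.
move=> Px; rewrite near_withinE; near=> t => _; near: t.
apply: cvg_within.
have := @continuous_line R d x (e_ k) 0; rewrite /continuous_at scale0r addr0.
by apply.
Unshelve. all: by end_near. Qed.

Lemma eq_pd k F G x : D x -> (\forall y \near x, D y -> F y = G y) ->
  pd D k F x = pd D k G x.
Proof.
move=> Dx FG.
have Fx : F x = G x by exact: (nbhs_singleton FG).
have E : \forall t \near dir x k, (F (x + t *: e_ k) - F x) / t = (G (x + t *: e_ k) - G x) / t.
  have H := near_dir k FG.
  have H2 : \forall t \near dir x k, D (x + t *: e_ k) by exact: withinT.
  near=> t; rewrite Fx; congr ((_ - _) / _).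
  have Dt : D (x + t *: e_ k) by near: t.
  by move: Dt; near: t.
rewrite /pd; congr (lim _); rewrite eqEsubset; split; apply: near_eq_cvg => //.
by apply: filterS E => t ->.
Unshelve. all: by end_near. Qed.

(** The limit defining [pd] is the two-sided one for [G], taken along a finer filter; that filter is
    proper, so the limit is unique. *)
Lemma pdE k F G x : D x -> (\forall y \near x, D y -> F y = G y) ->
  derivable G x (e_ k) -> pd D k F x = 'D_(e_ k) G x.
Proof.
move=> Dx FG dG; rewrite (eq_pd k Dx FG) /pd.
have PF := dir_proper k Dx.
apply: cvg_lim => //.
have /cvg_within_filter-/(_ [set t | D (x + t *: e_ k)]) H := dG.
apply: cvg_trans H.
rewrite [X in _ `=>` X @ _](_ : _ = fun t => (G (x + t *: e_ k) - G x) / t) //.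
by apply/funext => h; rewrite /= (addrC _ x) mulrC.
Qed.

Lemma pd_is_derive k F G x a : D x -> (\forall y \near x, D y -> F y = G y) ->
  is_derive x (e_ k) G a -> pd D k F x = a.
Proof. by move=> Dx FG [dG <-]; exact: pdE. Qed.

Lemma germ_ext k F G x : (\forall y \near x, D y -> F y = G y) ->
  germ k D F x -> germ k D G x.
Proof.
move=> /nbhs_ballP[r /= r0 rFG] [W [H [Wo Wx CH FH]]].
exists (W `&` (ball x r)^°), H; split.
- by apply: openI => //; exact: open_interior.
- split=> //; exact: nbhsx_ballx.
- by apply: Ck_on_sub CH => y [].
- by move=> y [Wy /interior_subset yr] Dy; rewrite -FH// rFG.
Qed.

Lemma germ_le k l F x : (k <= l)%N -> germ l D F x -> germ k D F x.
Proof.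
move=> kl [W [G [Wo Wx CG FG]]]; exists W, G; split=> //; exact: Ck_on_le kl CG.
Qed.

Lemma germ_cst k (c : R) x : germ k D (fun=> c) x.
Proof. exists setT, (fun=> c); split=> //; [exact: openT|exact: Ck_on_cst]. Qed.

Lemma germ_coord k i x : germ k D (fun y => y 0 i) x.
Proof. exists setT, (fun y => y 0 i); split=> //; [exact: openT|exact: Ck_on_coord]. Qed.

Lemma germ_op2 k (op : R -> R -> R) F G x :
  (forall W F' G', open W -> Ck_on k W F' -> Ck_on k W G' ->
    Ck_on k W (fun x => op (F' x) (G' x))) ->
  germ k D F x -> germ k D G x -> germ k D (fun y => op (F y) (G y)) x.
Proof.
move=> Cop [W1 [F1 [W1o W1x CF1 F1E]]] [W2 [G2 [W2o W2x CG2 G2E]]].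
exists (W1 `&` W2), (fun x => op (F1 x) (G2 x)); split=> //.
- exact: openI.
- apply: Cop; first exact: openI.
    by apply: Ck_on_sub CF1 => y [].
  by apply: Ck_on_sub CG2 => y [].
- by move=> y [W1y W2y] Dy; rewrite F1E// G2E.
Qed.

Lemma germD k F G x : germ k D F x -> germ k D G x ->
  germ k D (fun y => F y + G y) x.
Proof. by apply: germ_op2 => W F' G' Wo; exact: Ck_onD. Qed.

Lemma germM k F G x : germ k D F x -> germ k D G x ->
  germ k D (fun y => F y * G y) x.
Proof. by apply: germ_op2 => W F' G' Wo; exact: Ck_onM. Qed.

Lemma germN k F x : germ k D F x -> germ k D (fun y => - F y) x.
Proof.
move=> [W [G [Wo Wx CG FG]]]; exists W, (fun y => - G y); split=> //.
  exact: Ck_onN.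
by move=> y Wy Dy; rewrite FG.
Qed.

Lemma germB k F G x : germ k D F x -> germ k D G x ->
  germ k D (fun y => F y - G y) x.
Proof. by move=> CF CG; apply: germD => //; exact: germN. Qed.

Lemma germ_exp k F x : germ k D F x -> germ k D (fun y => expR (F y)) x.
Proof.
move=> [W [G [Wo Wx CG FG]]]; exists W, (fun y => expR (G y)); split=> //.
  exact: Ck_on_exp.
by move=> y Wy Dy; rewrite FG.
Qed.

Lemma germ_sum k (I : Type) (r : seq I) (F : I -> 'rV[R]_d -> R) x :
  (forall i, germ k D (F i) x) -> germ k D (fun y => \sum_(i <- r) F i y) x.
Proof.
move=> CF; elim: r => [|a r IH].
  by apply: germ_ext (germ_cst k 0 x); apply: near_eqW => y; rewrite big_nil.
by apply: germ_ext (germD (CF a) IH); apply: near_eqW => y; rewrite big_cons.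
Qed.

Lemma germ_prod k (I : Type) (r : seq I) (F : I -> 'rV[R]_d -> R) x :
  (forall i, germ k D (F i) x) -> germ k D (fun y => \prod_(i <- r) F i y) x.
Proof.
move=> CF; elim: r => [|a r IH].
  by apply: germ_ext (germ_cst k 1 x); apply: near_eqW => y; rewrite big_nil.
by apply: germ_ext (germM (CF a) IH); apply: near_eqW => y; rewrite big_cons.
Qed.

Lemma open_preimage W G (A : set R) : open W -> open A ->
  (forall x, W x -> {for x, continuous G}) -> open (W `&` G @^-1` A).
Proof.
move=> Wo Ao cG; rewrite openE => x [Wx Ax].
have H : nbhs x (G @^-1` A).
  by have := cG x Wx; apply; exact: open_nbhs_nbhs.
exact: filterI (near_open Wo Wx) H.
Qed.

(** The neighbourhood is shrunk to where the extension does not vanish, which the values of [F] on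
    [D] do not control. *)
Lemma germ_inv k F x : D x -> F x != 0 -> germ k D F x ->
  germ k D (fun y => (F y)^-1) x.
Proof.
move=> Dx F0 [W [G [Wo Wx CG FG]]].
have oW : open (W `&` G @^-1` [set t | t != 0]).
  by apply: (open_preimage Wo (@open_neq _ 0)) => y; exact: Ck_on_cts CG.
exists (W `&` G @^-1` [set t | t != 0]), (fun y => (G y)^-1); split=> //.
- by split=> //=; rewrite -FG.
- apply: Ck_on_inv => //; first by move=> y [].
  by apply: Ck_on_sub CG => y [].
- by move=> y [Wy _] Dy; rewrite FG.
Qed.

Lemma germ_sqrt k F x : D x -> 0 < F x -> germ k D F x ->
  germ k D (fun y => Num.sqrt (F y)) x.
Proof.
move=> Dx F0 [W [G [Wo Wx CG FG]]].
have oW : open (W `&` G @^-1` [set t | 0 < t]).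
  by apply: (open_preimage Wo (@open_gt _ 0)) => y; exact: Ck_on_cts CG.
exists (W `&` G @^-1` [set t | 0 < t]), (fun y => Num.sqrt (G y)); split=> //.
- by split=> //=; rewrite -FG.
- apply: Ck_on_sqrt => //; first by move=> y [].
  by apply: Ck_on_sub CG => y [].
- by move=> y [Wy _] Dy; rewrite FG.
Qed.

Lemma germ_pd k j F x : germ k.+1 D F x -> germ k D (pd D j F) x.
Proof.
move=> [W [G [Wo Wx CG FG]]]; exists W, (fun y => 'D_(e_ j) G y); split=> //.
  exact: Ck_on_derive.
move=> y Wy Dy; apply: pdE => //; last exact: Ck_on_derivable CG Wy.
exact: filterS (near_open Wo Wy).
Qed.

Lemma germ_cvg F x : D x -> germ 0 D F x -> F @ within D (nbhs x) --> F x.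
Proof.
move=> Dx [W [G [Wo Wx CG FG]]]; rewrite (FG _ Wx Dx).
have /cvg_within_filter-/(_ D) H := Ck_on_cts CG Wx.
apply: cvg_trans H; apply: near_eq_cvg; rewrite near_withinE.
by apply: filterS (near_open Wo Wx) => y Wy Dy; rewrite FG.
Qed.

Section Rules.
Variables (x : 'rV[R]_d) (Dx : D x).

Lemma pd_cst k c : pd D k (fun=> c) x = 0.
Proof. by apply: pd_is_derive (is_derive_cst c x _) => //; exact: near_eqW. Qed.

Lemma pd_coord k i : pd D k (fun y => y 0 i) x = (i == k)%:R.
Proof.
rewrite (pd_is_derive Dx _ (is_derive_coord x i (e_ k))); last exact: near_eqW.
by rewrite mxE eqxx.
Qed.

Lemma germ1_is_derive F k : germ 1 D F x ->
  exists2 G, is_derive x (e_ k) G (pd D k F x) & \forall y \near x, D y -> F y = G y.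
Proof.
move=> [W [G [Wo Wx CG FG]]].
have E : \forall y \near x, D y -> F y = G y by exact: filterS (near_open Wo Wx).
exists G => //; rewrite (pdE Dx E (Ck_on_derivable CG Wx)).
exact: Ck_on_is_derive CG Wx.
Qed.

Lemma pdD k F G : germ 1 D F x -> germ 1 D G x ->
  pd D k (fun y => F y + G y) x = pd D k F x + pd D k G x.
Proof.
move=> /(germ1_is_derive k)[F' dF FE] /(germ1_is_derive k)[G' dG GE].
apply: pd_is_derive Dx _ (is_deriveD dF dG).
by apply: filterS2 FE GE => y FE GE Dy; rewrite FE// GE.
Qed.

Lemma pdN k F : germ 1 D F x -> pd D k (fun y => - F y) x = - pd D k F x.
Proof.
move=> /(germ1_is_derive k)[F' dF FE].
apply: pd_is_derive Dx _ (is_deriveN dF).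
by apply: filterS FE => y FE Dy; rewrite FE.
Qed.

Lemma pdB k F G : germ 1 D F x -> germ 1 D G x ->
  pd D k (fun y => F y - G y) x = pd D k F x - pd D k G x.
Proof. by move=> CF CG; rewrite pdD ?pdN//; exact: germN. Qed.

Lemma pdM k F G : germ 1 D F x -> germ 1 D G x ->
  pd D k (fun y => F y * G y) x = pd D k F x * G x + F x * pd D k G x.
Proof.
move=> /(germ1_is_derive k)[F' dF FE] /(germ1_is_derive k)[G' dG GE].
rewrite (nbhs_singleton FE)// (nbhs_singleton GE)// addrC [X in _ + X]mulrC.
apply: pd_is_derive Dx _ (is_deriveM dF dG).
by apply: filterS2 FE GE => y FE GE Dy; rewrite FE// GE.
Qed.

Lemma pd_comp1 k (p : R -> R) F a : is_derive (F x) 1 p a -> germ 1 D F x ->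
  pd D k (fun y => p (F y)) x = a * pd D k F x.
Proof.
move=> dp /(germ1_is_derive k)[F' dF FE].
rewrite (nbhs_singleton FE)// in dp.
have [dF1 <-] := dF.
apply: pd_is_derive Dx _ (is_derive_comp1 dp dF1).
by apply: filterS FE => y FE Dy; rewrite FE.
Qed.

Lemma pd_exp k F : germ 1 D F x ->
  pd D k (fun y => expR (F y)) x = expR (F x) * pd D k F x.
Proof. by apply: pd_comp1; exact: is_derive_expR. Qed.

Lemma pd_sum k (I : Type) (r : seq I) (F : I -> 'rV[R]_d -> R) :
  (forall i, germ 1 D (F i) x) ->
  pd D k (fun y => \sum_(i <- r) F i y) x = \sum_(i <- r) pd D k (F i) x.
Proof.
move=> CF; elim: r => [|a r IH].
  rewrite big_nil -[RHS](pd_cst k 0); apply: eq_pd => //.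
  by apply: near_eqW => y; rewrite big_nil.
rewrite big_cons -IH -pdD//; last exact: germ_sum.
by apply: eq_pd => //; apply: near_eqW => y; rewrite big_cons.
Qed.

Lemma pdC i j F : germ 2 D F x -> pd D i (pd D j F) x = pd D j (pd D i F) x.
Proof.
move=> [W [G [Wo Wx CG FG]]].
have E k y : W y -> D y -> pd D k F y = 'D_(e_ k) G y.
  move=> Wy Dy; apply: pdE => //; last exact: Ck_on_derivable CG Wy.
  exact: filterS (near_open Wo Wy).
have E2 k l : pd D k (pd D l F) x = 'D_(e_ k) (fun y => 'D_(e_ l) G y) x.
  apply: pdE => //.
    by apply: filterS (near_open Wo Wx) => y; exact: E.
  exact: (Ck_on_derivable (Ck_on_derive l CG) Wx).
by rewrite !E2; exact: (schwarz j i Wo CG Wx).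
Qed.

(** [T] is replaced by an extension [TT], whose values at points off [D] may leave [D]; this is
    harmless because [F] and [U \o T] are compared on [D] only. *)
Lemma pd_chain k F U (T : 'rV[R]_d -> 'rV[R]_d) :
  (forall c, germ 1 D (fun y => T y 0 c) x) -> D (T x) -> germ 1 D U (T x) ->
  (\forall y \near x, D y -> D (T y) /\ F y = U (T y)) ->
  pd D k F x = \sum_c pd D c U (T x) * pd D k (fun y => T y 0 c) x.
Proof.
move=> CT DT [W [G [Wo WT CG UG]]] FUT.
have /choice[T' T'P] c : exists T'c : 'rV[R]_d -> R,
    is_derive x (e_ k) T'c (pd D k (fun y => T y 0 c) x) /\
    {for x, continuous T'c} /\
    \forall y \near x, D y -> T y 0 c = T'c y.
  have [W' [H [W'o W'x CH TH]]] := CT c; exists H.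
  have E : \forall y \near x, D y -> T y 0 c = H y by exact: filterS (near_open W'o W'x).
  split; last by split=> //; exact: Ck_on_cts CH W'x.
  rewrite (pdE Dx E (Ck_on_derivable CH W'x)); exact: (Ck_on_is_derive _ CH W'x).
pose TT y : 'rV[R]_d := \row_c T' c y.
have TTE : \forall y \near x, D y -> T y = TT y.
  near=> y => Dy; apply/rowP => c; rewrite mxE; move: c Dy; near: y.
  by apply: filter_forall => c; have [_ []] := T'P c.
have TTx : TT x = T x by rewrite (nbhs_singleton TTE).
have cTT : TT @ x --> TT x.
  apply/(@cvgrPdist_lt _ _ _ (nbhs x) (nbhs_filter x) TT (TT x)) => e e0.
  have H : \forall y \near x, forall c, `|T' c x - T' c y| < e / 2.
    have e2 : 0 < e / 2 by rewrite divr_gt0.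
    have cT c : \forall y \near x, `|T' c x - T' c y| < e / 2.
      by have [_ [/cvgrPdist_lt + _]] := T'P c; apply.
    exact: filter_forall cT.
  near=> y.
  apply: (@le_lt_trans _ _ (e / 2)); last by lra.
  apply: norm_rV_le => [|c]; first by rewrite divr_ge0// ltW.
  by rewrite !mxE ltW//; move: c; near: y.
have UE c : pd D c U (T x) = 'D_(e_ c) G (TT x).
  rewrite TTx; apply: pdE => //; last exact: Ck_on_derivable CG WT.
  exact: filterS (near_open Wo WT).
under eq_bigr do rewrite UE.
apply: (pd_is_derive Dx _ (@is_derive_chain R d 'rV[R]_d W G TT x (e_ k) _ Wo CG _ _)).
- have WTT : \forall y \near x, W (TT y).
    by apply: cTT; apply: near_open => //; rewrite TTx.
  near=> y => Dy.
  have WTTy : W (TT y) by near: y.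
  have Ty : T y = TT y by move: Dy; near: y.
  have [DTy ->] : D (T y) /\ F y = U (T y) by move: Dy; near: y.
  by rewrite UG// Ty.
- by rewrite TTx.
- move=> c; rewrite [X in is_derive _ _ X](_ : _ = T' c).
    by have [] := T'P c.
  by apply/funext => y; rewrite mxE.
Unshelve. all: by end_near. Qed.

End Rules.

End Germs.

(** * Riemannian geometry in a chart *)

(* Abstracts sums into variables, so that [ring] does not try to unify them. *)
Ltac gensum := repeat match goal with |- context [@bigop ?A ?B ?c ?d ?e] =>
  let S := fresh "S" in set S := (@bigop A B c d e); clearbody S end.

Section MatrixGerms.
Context {R : realType} {d : nat}.
Variables (D : set 'rV[R]_d) (mD : model_space D).

Lemma germ_det k m (A : 'rV[R]_d -> 'M[R]_m) x :
  (forall i j, germ k D (fun y => A y i j) x) -> germ k D (fun y => \det (A y)) x.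
Proof.
move=> CA; rewrite /determinant; apply: germ_sum => s; apply: germM.
  exact: germ_cst.
by apply: germ_prod.
Qed.

(** Cramer's rule: the entries are polynomials in those of [A], divided by the determinant. *)
Lemma germ_invmx k m (A : 'rV[R]_d -> 'M[R]_m) x i j : D x ->
  (forall i j, germ k D (fun y => A y i j) x) -> A x \in unitmx ->
  (\forall y \near x, D y -> A y \in unitmx) ->
  germ k D (fun y => invmx (A y) i j) x.
Proof.
move=> Dx CA Ax Anear.
apply: (@germ_ext _ _ D k (fun y => (\det (A y))^-1 * cofactor (A y) j i)).
  by apply: filterS Anear => y Ay /Ay Auy; rewrite /invmx Auy !mxE.
apply: germM.
  apply: germ_inv => //; last exact: germ_det.
  by rewrite unitmxE unitfE in Ax.
rewrite /cofactor; apply: germM; first exact: germ_cst.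
apply: germ_det => a b.
by apply: germ_ext (CA (lift j a) (lift i b)); apply: near_eqW => y; rewrite !mxE.
Qed.

Lemma pd_prod k m (F : 'I_m -> 'rV[R]_d -> R) x : D x ->
  (forall i, germ 1 D (F i) x) ->
  pd D k (fun y => \prod_(i < m) F i y) x =
  \sum_(i < m) \prod_(j < m) (if j == i then pd D k (F j) x else F j x).
Proof.
move=> Dx; elim: m F => [|m IH] F CF.
  rewrite big_ord0 -[RHS](pd_cst mD Dx k 1); apply: eq_pd => //.
  by apply: near_eqW => y; rewrite big_ord0.
rewrite (@eq_pd _ _ D k _ (fun y => F ord0 y * \prod_(i < m) F (lift ord0 i) y) x) //; last first.
  by apply: near_eqW => y; rewrite big_ord_recl.
rewrite pdM // ?IH //; last exact: germ_prod.
rewrite big_ord_recl big_ord_recl eqxx; congr (_ * _ + _).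
rewrite mulr_sumr; apply: eq_bigr => i _; rewrite big_ord_recl /=; congr (_ * _).
Qed.

(* Jacobi's formula, before contracting the adjugate with the inverse. *)
Lemma pd_det k m (A : 'rV[R]_d -> 'M[R]_m) x : D x ->
  (forall i j, germ 1 D (fun y => A y i j) x) ->
  pd D k (fun y => \det (A y)) x =
  \sum_i \sum_j pd D k (fun y => A y i j) x * cofactor (A x) i j.
Proof.
move=> Dx CA; rewrite /determinant pd_sum //; last first.
  by move=> s; apply: germM; [exact: germ_cst|exact: germ_prod].
have E s : pd D k (fun y => (-1) ^+ odd_perm s * \prod_i A y i (s i)) x =
    (-1) ^+ odd_perm s * \sum_i \prod_j
      (if j == i then pd D k (fun y => A y j (s j)) x else A x j (s j)).
  rewrite pdM //; [|exact: germ_cst|exact: germ_prod].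
  by rewrite pd_cst // mul0r add0r pd_prod.
under eq_bigr do rewrite E mulr_sumr.
rewrite exchange_big /=; apply: eq_bigr => i _.
(* [B] is [A] with row [i] differentiated. The sum over permutations is its determinant, and the
   cofactors along row [i] do not see that row. *)
pose B := \matrix_(a, b) (if a == i then pd D k (fun y => A y a b) x else A x a b).
transitivity (\det B).
  by apply: eq_bigr => s _; congr (_ * _); apply: eq_bigr => j _; rewrite mxE.
rewrite (expand_det_row B i); apply: eq_bigr => j _; rewrite mxE eqxx; congr (_ * _).
rewrite /cofactor; congr (_ * \det _); apply/matrixP => a b; rewrite !mxE.
by rewrite eq_sym (negbTE (neq_lift _ _)).
Qed.

End MatrixGerms.

(* V is the image of a chart; it is open in the model space D. *)
Record chart_metric {R : realType} {d} (D V : set 'rV[R]_d)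
    (g : 'rV[R]_d -> 'M[R]_d) : Prop := ChartMetric {
  cm_model : model_space D;
  cm_sub : V `<=` D;
  cm_open : forall x, V x -> \forall y \near x, D y -> V y;
  cm_smooth : forall i j k x, V x -> germ k D (fun y => g y i j) x;
  cm_sym : forall x, V x -> (g x)^T = g x;
  cm_det : forall x, V x -> 0 < \det (g x)
}.

Section ChartAlgebra.
Context {R : realType} {d : nat}.
Variables (D V : set 'rV[R]_d) (g : 'rV[R]_d -> 'M[R]_d).
Hypothesis C : chart_metric D V g.
Let mD := cm_model C.
Let VD := cm_sub C.
Let Vopen := cm_open C.
Let g_sym := cm_sym C.
Let det_gt0 := cm_det C.

Definition smoothV (F : 'rV[R]_d -> R) := forall k x, V x -> germ k D F x.

Let g_smooth i j : smoothV (fun y => g y i j) := cm_smooth C i j.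

Lemma g_unit x : V x -> g x \in unitmx.
Proof. by move=> Vx; rewrite unitmxE unitfE gt_eqF // det_gt0. Qed.

Implicit Types (F : 'rV[R]_d -> R) (i j k l m : 'I_d).
Local Notation G := (fun i j x => ginv g x i j).
Local Notation Gam := (christoffel D g).

Lemma eq_pdV k F F' x : V x -> (forall y, V y -> F y = F' y) ->
  pd D k F x = pd D k F' x.
Proof.
move=> Vx FF'; apply: eq_pd; first exact: VD.
by apply: filterS (Vopen Vx) => y Vy /Vy/FF'.
Qed.

Lemma germ_extV (r : nat) F F' x : V x -> (forall y, V y -> F y = F' y) ->
  germ r D F x -> germ r D F' x.
Proof.
move=> Vx FF'; apply: germ_ext.
by apply: filterS (Vopen Vx) => y Vy /Vy/FF'.
Qed.

Lemma smooth_ginv i j : smoothV (G i j).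
Proof.
move=> k x Vx; apply: germ_invmx => //; first exact: VD.
- by move=> a b; exact: g_smooth.
- exact: g_unit.
- by apply: filterS (Vopen Vx) => y Vy /Vy; exact: g_unit.
Qed.

Lemma smooth_pd k F : smoothV F -> smoothV (pd D k F).
Proof. by move=> sF m x Vx; apply: germ_pd => //; exact: sF. Qed.

Lemma smoothVM F F' : smoothV F -> smoothV F' -> smoothV (fun y => F y * F' y).
Proof. by move=> sF sF' k x Vx; apply: germM; [exact: sF|exact: sF']. Qed.

Lemma smoothVD F F' : smoothV F -> smoothV F' -> smoothV (fun y => F y + F' y).
Proof. by move=> sF sF' k x Vx; apply: germD; [exact: sF|exact: sF']. Qed.

Lemma smoothVN F : smoothV F -> smoothV (fun y => - F y).
Proof. by move=> sF k x Vx; apply: germN; exact: sF. Qed.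

Lemma smoothV_sum (I : Type) (r : seq I) (F : I -> 'rV[R]_d -> R) :
  (forall a, smoothV (F a)) -> smoothV (fun y => \sum_(a <- r) F a y).
Proof. by move=> sF k x Vx; apply: germ_sum => i; exact: sF. Qed.

Lemma smoothV_cst c : smoothV (fun=> c).
Proof. by move=> k x Vx; exact: germ_cst. Qed.

Lemma smooth_christoffel k i j : smoothV (Gam k i j).
Proof.
rewrite /christoffel; apply: smoothVM; first exact: smoothV_cst.
apply: smoothV_sum => l; apply: smoothVM; first exact: smooth_ginv.
by apply: smoothVD; [apply: smoothVD|apply: smoothVN]; apply: smooth_pd; exact: g_smooth.
Qed.

Lemma gC i j x : V x -> g x i j = g x j i.
Proof. by move=> Vx; rewrite -{1}(g_sym Vx) mxE. Qed.

Lemma ginvC i j x : V x -> G i j x = G j i x.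
Proof.
move=> Vx; rewrite /ginv -[in RHS](g_sym Vx) -trmx_inv mxE //.
Qed.

Lemma g_ginv i k x : V x -> \sum_j g x i j * G j k x = (i == k)%:R.
Proof.
move=> Vx; have := congr1 (fun A : 'M[R]_d => A i k) (mulmxV (g_unit Vx)).
by rewrite !mxE.
Qed.

Lemma ginv_g i k x : V x -> \sum_j G i j x * g x j k = (i == k)%:R.
Proof.
move=> Vx; have := congr1 (fun A : 'M[R]_d => A i k) (mulVmx (g_unit Vx)).
by rewrite !mxE.
Qed.

Lemma sum_delta (a : 'I_d -> R) k : \sum_i (i == k)%:R * a i = a k.
Proof.
rewrite (bigD1 k) //= eqxx mul1r big1 ?addr0 // => i /negbTE ->.
by rewrite mul0r.
Qed.

Lemma contract_g (a : 'I_d -> R) k x : V x ->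
  \sum_j g x k j * (\sum_l G j l x * a l) = a k.
Proof.
move=> Vx; under eq_bigr do rewrite mulr_sumr.
rewrite exchange_big /=.
transitivity (\sum_l (l == k)%:R * a l); last exact: sum_delta.
apply: eq_bigr => l _; rewrite eq_sym -(g_ginv k l Vx) mulr_suml.
by apply: eq_bigr => j _; rewrite mulrA.
Qed.

(* Christoffel symbols of the first kind. *)
Definition clow i j l x : R := 2^-1 * (pd D i (fun y => g y j l) x
  + pd D j (fun y => g y i l) x - pd D l (fun y => g y i j) x).

Lemma christoffelE k i j x : Gam k i j x = \sum_l G k l x * clow i j l x.
Proof.
rewrite /christoffel mulr_sumr; apply: eq_bigr => l _.
by rewrite /clow mulrCA.
Qed.

Lemma clowE i j l x : V x -> \sum_k g x l k * Gam k i j x = clow i j l x.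
Proof.
move=> Vx; under eq_bigr do rewrite christoffelE.
exact: contract_g.
Qed.

Lemma pd_gC i j k x : V x -> pd D k (fun y => g y i j) x = pd D k (fun y => g y j i) x.
Proof. by move=> Vx; apply: eq_pdV => // y Vy; rewrite gC. Qed.

Lemma clowC i j l x : V x -> clow i j l x = clow j i l x.
Proof.
by move=> Vx; rewrite /clow (pd_gC i j l Vx) [X in _ * (X - _)]addrC.
Qed.

Lemma christoffelC k i j x : V x -> Gam k i j x = Gam k j i x.
Proof.
by move=> Vx; rewrite !christoffelE; apply: eq_bigr => l _; rewrite clowC.
Qed.

(** Metric compatibility of the connection: the parts of the two symbols that are antisymmetric in
    [i] and [j] cancel. *)
Lemma pd_g k i j x : V x -> pd D k (fun y => g y i j) x = clow k i j x + clow k j i x.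
Proof.
move=> Vx; by rewrite /clow (pd_gC j i k Vx); lra.
Qed.

Lemma pd_sumM k (I : finType) (F F' : I -> 'rV[R]_d -> R) x : V x ->
  (forall a, smoothV (F a)) -> (forall a, smoothV (F' a)) ->
  pd D k (fun y => \sum_a F a y * F' a y) x =
  \sum_a (pd D k (F a) x * F' a x + F a x * pd D k (F' a) x).
Proof.
move=> Vx sF sF'; rewrite pd_sum //; [|exact: VD|by move=> a; exact: smoothVM].
by apply: eq_bigr => a _; rewrite pdM //; [exact: VD|exact: sF|exact: sF'].
Qed.

(** The inverse metric is parallel. Differentiating [ginv g = 1] gives [H], and contracting with
    [ginv] isolates the derivative. *)
Lemma pd_ginv k i j x : V x -> pd D k (G i j) x =
  - \sum_m (Gam i k m x * G m j x + Gam j k m x * G m i x).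
Proof.
move=> Vx.
have H c : \sum_b pd D k (G i b) x * g x b c = - \sum_b G i b x * pd D k (fun y => g y b c) x.
  apply/eqP; rewrite -addr_eq0 -big_split /=.
  rewrite -(@pd_sumM k _ (fun b => G i b) (fun b y => g y b c)) //; last first.
    by move=> b; exact: smooth_ginv.
  rewrite (@eq_pdV k _ (fun=> (i == c)%:R) x) //; last by move=> y Vy; exact: ginv_g.
  by rewrite pd_cst //; exact: VD.
have E : pd D k (G i j) x = \sum_c (\sum_b pd D k (G i b) x * g x b c) * G c j x.
  rewrite -[LHS](sum_delta (fun b => pd D k (G i b) x)).
  under [RHS]eq_bigr do rewrite mulr_suml.
  rewrite exchange_big /=; apply: eq_bigr => b _.
  rewrite -(g_ginv b j Vx) mulr_suml; apply: eq_bigr => c _; ring.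
rewrite E; under eq_bigr do rewrite H mulNr mulr_suml.
rewrite sumrN; congr (- _).
under eq_bigr => c _ do under eq_bigr => b _ do rewrite pd_g // mulrDr mulrDl.
under eq_bigr do rewrite big_split /=.
rewrite big_split /= [RHS]big_split /= addrC; congr (_ + _).
- apply: eq_bigr => c _; rewrite -mulr_suml; congr (_ * _).
  by rewrite christoffelE.
- rewrite exchange_big /=; apply: eq_bigr => b _.
  transitivity (G i b x * \sum_c G j c x * clow k b c x).
    by rewrite mulr_sumr; apply: eq_bigr => c _; rewrite (ginvC c j Vx); ring.
  by rewrite -christoffelE mulrC (ginvC i b Vx).
Qed.

(* [gradc F i = (grad F)^i], [nab F l i = (nabla_l grad F)^i],
   [gam F F' = <grad F, grad F'>]. *)
Definition gradc F i x : R := \sum_l G i l x * pd D l F x.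

Definition nab F l i x : R :=
  pd D l (gradc F i) x + \sum_m Gam i l m x * gradc F m x.

Definition gam F F' x : R := \sum_l gradc F l x * pd D l F' x.

Definition hs F i j x : R := chess D g F x i j.

Lemma hsE F i j x :
  hs F i j x = pd D i (pd D j F) x - \sum_k Gam k i j x * pd D k F x.
Proof. by rewrite /hs mxE. Qed.

Lemma smooth_gradc F i : smoothV F -> smoothV (gradc F i).
Proof.
move=> sF; apply: smoothV_sum => l; apply: smoothVM; first exact: smooth_ginv.
exact: smooth_pd.
Qed.

Lemma smooth_gam F F' : smoothV F -> smoothV F' -> smoothV (gam F F').
Proof.
move=> sF sF'; apply: smoothV_sum => l; apply: smoothVM; first exact: smooth_gradc.
exact: smooth_pd.
Qed.

Lemma smooth_nab F l i : smoothV F -> smoothV (nab F l i).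
Proof.
move=> sF; apply: smoothVD; first by apply: smooth_pd; exact: smooth_gradc.
apply: smoothV_sum => m; apply: smoothVM; first exact: smooth_christoffel.
exact: smooth_gradc.
Qed.

Lemma smooth_chess F i j : smoothV F -> smoothV (hs F i j).
Proof.
move=> sF k x Vx; apply: (@germ_extV k (fun y => pd D i (pd D j F) y -
    \sum_m Gam m i j y * pd D m F y) (hs F i j) x Vx).
  by move=> y _; rewrite hsE.
apply: germB; first by do 2 apply: germ_pd => //; exact: sF.
apply: germ_sum => m; apply: germM; first exact: smooth_christoffel.
by apply: germ_pd => //; exact: sF.
Qed.

Lemma chessC F i j x : smoothV F -> V x -> hs F i j x = hs F j i x.
Proof.
move=> sF Vx; rewrite !hsE (pdC mD (VD Vx) i j (sF 2%N x Vx)).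
rewrite (eq_bigr (fun k => Gam k j i x * pd D k F x)) // => k _.
by rewrite christoffelC.
Qed.

(** Raising an index commutes with [nabla] because the inverse metric is parallel ([pd_ginv]). *)
Lemma nabE F l i x : smoothV F -> V x ->
  nab F l i x = \sum_j G i j x * hs F l j x.
Proof.
move=> sF Vx; rewrite /nab.
rewrite (@pd_sumM l _ (fun j => G i j) (fun j => pd D j F)) //; last 2 first.
- by move=> j; exact: smooth_ginv.
- by move=> j; exact: smooth_pd.
rewrite big_split /=.
have E0 : \sum_m Gam i l m x * gradc F m x =
   \sum_j \sum_m Gam i l m x * G m j x * pd D j F x.
  rewrite exchange_big /=; apply: eq_bigr => m _; rewrite mulr_sumr.
  by apply: eq_bigr => j _; rewrite mulrA.
have E1 : \sum_j pd D l (G i j) x * pd D j F x = - \sum_m Gam i l m x * gradc F m x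
   - \sum_j G i j x * \sum_k Gam k l j x * pd D k F x.
  have -> : \sum_j G i j x * (\sum_k Gam k l j x * pd D k F x) =
     \sum_j \sum_m Gam j l m x * G m i x * pd D j F x.
    rewrite exchange_big /=; apply: eq_bigr => j _; rewrite mulr_sumr.
    by apply: eq_bigr => k _; rewrite (ginvC i j Vx); ring.
  rewrite E0 -opprD -big_split /= -sumrN; apply: eq_bigr => j _.
  rewrite pd_ginv // mulNr mulr_suml -big_split /=; congr (- _).
  by apply: eq_bigr => m _; rewrite mulrDl.
have E2 : \sum_j G i j x * hs F l j x = \sum_j G i j x * pd D l (pd D j F) x -
   \sum_j G i j x * \sum_k Gam k l j x * pd D k F x.
  by rewrite -sumrB; apply: eq_bigr => j _; rewrite hsE mulrBr.
rewrite E1 E2; ring.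
Qed.

(** Product rule for [<grad F, grad F'>]: replacing partial by covariant derivatives creates the
    same double Christoffel sum in [E1] and [E2], with opposite signs. *)
Lemma pd_gam F F' k x : smoothV F -> smoothV F' -> V x ->
  pd D k (gam F F') x =
  \sum_l (hs F k l x * gradc F' l x + hs F' k l x * gradc F l x).
Proof.
move=> sF sF' Vx.
rewrite (@pd_sumM k _ (fun l => gradc F l) (fun l => pd D l F')) //; last 2 first.
- by move=> j; exact: smooth_gradc.
- by move=> j; exact: smooth_pd.
rewrite big_split /= [RHS]big_split /=.
have E1 : \sum_l pd D k (gradc F l) x * pd D l F' x =
  \sum_l hs F k l x * gradc F' l x - \sum_l \sum_m Gam l k m x * gradc F m x * pd D l F' x.
  transitivity (\sum_l (nab F k l x - \sum_m Gam l k m x * gradc F m x) * pd D l F' x).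
    by apply: eq_bigr => l _; rewrite /nab addrK.
  under eq_bigr do rewrite mulrBl mulr_suml.
  rewrite big_split /= sumrN; congr (_ - _).
  under eq_bigr do rewrite nabE // mulr_suml.
  rewrite exchange_big /=; apply: eq_bigr => l _.
  rewrite /gradc mulr_sumr; apply: eq_bigr => m _.
  by rewrite (ginvC l m Vx); ring.
have E2 : \sum_l gradc F l x * pd D k (pd D l F') x =
  \sum_l hs F' k l x * gradc F l x + \sum_l \sum_m Gam l k m x * gradc F m x * pd D l F' x.
  rewrite exchange_big /= -big_split /=; apply: eq_bigr => l _.
  have -> : \sum_i Gam i k l x * gradc F l x * pd D i F' x =
     (\sum_i Gam i k l x * pd D i F' x) * gradc F l x.
    by rewrite mulr_suml; apply: eq_bigr => i _; ring.
  by rewrite hsE; ring.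
by rewrite E1 E2; ring.
Qed.

(* Determines the covariant Hessian from first-order operations only; this is
   how its change of charts is obtained. *)
Lemma chess_gam F u v x : smoothV F -> smoothV u -> smoothV v -> V x ->
  (\sum_i \sum_j gradc u i x * hs F i j x * gradc v j x) *+ 2 =
  gam u (gam F v) x + gam v (gam F u) x - gam F (gam u v) x.
Proof.
move=> sF su sv Vx.
have E a b c : smoothV a -> smoothV b -> smoothV c ->
  gam a (gam b c) x = \sum_i \sum_j gradc a i x * hs b i j x * gradc c j x +
   \sum_i \sum_j gradc a i x * hs c i j x * gradc b j x.
  move=> sa sb sc; rewrite /gam -big_split /=; apply: eq_bigr => k _.
  rewrite (pd_gam k sb sc Vx) mulr_sumr -big_split /=; apply: eq_bigr => l _; ring.
rewrite !E //.
have S a b c : smoothV b -> \sum_i \sum_j gradc a i x * hs b i j x * gradc c j x =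
   \sum_i \sum_j gradc c i x * hs b i j x * gradc a j x.
  move=> sb; rewrite exchange_big /=; apply: eq_bigr => i _; apply: eq_bigr => j _.
  by rewrite (chessC j i sb Vx); ring.
rewrite (S v F u sF) (S F u v su) (S F v u sv); ring.
Qed.

(** Divergence as the trace of [nabla Z]; [div_weighted] turns it into the form with a density,
    which is the one that integrates. *)
Definition divv (Z : 'I_d -> 'rV[R]_d -> R) x : R :=
  \sum_i (pd D i (Z i) x + \sum_m Gam i i m x * Z m x).

(** The field [nabla_X X] for [X = grad F]. *)
Definition hessgrad F i x : R := \sum_l nab F l i x * gradc F l x.

(** Curvature enters only through [ricci_id], which exchanges two covariant derivatives of
    [X = grad F]. The Christoffel terms from the lower index of [A = nabla X] are equal on both
    sides of that identity and are left out of it. The rest is the Leibniz rule, whose quadratic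
    part is the trace of [A] squared. *)
Lemma bochner F x : smoothV F -> V x ->
  divv (hessgrad F) x = \sum_i \sum_l nab F i l x * nab F l i x
   + \sum_l gradc F l x * pd D l (fun y => \sum_i nab F i i y) x
   + \sum_l \sum_k cricci D g x l k * gradc F l x * gradc F k x.
Proof.
move=> sF Vx; have Dx := VD Vx.
pose X := gradc F; pose A := nab F.
have sX i : smoothV (X i) by exact: smooth_gradc.
have sA l i : smoothV (A l i) by exact: smooth_nab.
(* [nabla_i nabla_l X - nabla_l nabla_i X = R(e_i, e_l) X] *)
have ricci_id i l : pd D i (A l i) x + \sum_m Gam i i m x * A l m x =
   pd D l (A i i) x + \sum_m Gam i l m x * A i m x +
   \sum_k riemann D g i i l k x * X k x.
  have pdA a b c : pd D a (A b c) x = pd D a (pd D b (X c)) x +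
     \sum_m (pd D a (Gam c b m) x * X m x + Gam c b m x * pd D a (X m) x).
    rewrite /A /nab pdD //; last 2 first.
    - by apply: smooth_pd.
    - by apply: smoothV_sum => // m; apply: smoothVM => //; exact: smooth_christoffel.
    congr (_ + _); apply: (@pd_sumM a _ (fun m => Gam c b m) X) => // m.
    exact: smooth_christoffel.
  have S a b c : \sum_m Gam c a m x * A b m x = \sum_m Gam c a m x * pd D b (X m) x +
      \sum_k \sum_m Gam c a m x * (Gam m b k x * X k x).
    rewrite [X in _ = _ + X]exchange_big /= -big_split /=; apply: eq_bigr => m _.
    by rewrite /A /nab mulrDr mulr_sumr.
  clearbody A X.
  have -> : \sum_k riemann D g i i l k x * X k x =
    \sum_k pd D i (Gam i l k) x * X k x - \sum_k pd D l (Gam i i k) x * X k x +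
    (\sum_k \sum_m Gam i i m x * (Gam m l k x * X k x) -
     \sum_k \sum_m Gam i l m x * (Gam m i k x * X k x)).
    rewrite -!sumrB -big_split /=; apply: eq_bigr => k _.
    rewrite /riemann mulrDl mulrBl; congr (_ + _).
    by rewrite mulr_suml -sumrB; apply: eq_bigr => m _; ring.
  rewrite !pdA !S (pdC mD Dx i l (sX i 2%N x Vx)) !big_split /=.
  gensum; ring.
have divE : divv (hessgrad F) x =
   \sum_i \sum_l (pd D i (X l) x * A l i x +
     X l x * (pd D i (A l i) x + \sum_m Gam i i m x * A l m x)).
  apply: eq_bigr => i _.
  rewrite (@pd_sumM i _ (fun l => A l i) X) //.
  have -> : \sum_m Gam i i m x * hessgrad F m x =
     \sum_l X l x * \sum_m Gam i i m x * A l m x.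
    under [RHS]eq_bigr do rewrite mulr_sumr.
    rewrite exchange_big /=; apply: eq_bigr => m _.
    by rewrite /hessgrad mulr_sumr; apply: eq_bigr => l _; rewrite -/A -/X; ring.
  by rewrite -big_split /=; apply: eq_bigr => l _; ring.
rewrite divE; under eq_bigr => i _ do under eq_bigr => l _ do rewrite ricci_id.
have -> : \sum_i \sum_l nab F i l x * nab F l i x =
   \sum_i \sum_l pd D i (X l) x * A l i x +
   \sum_i \sum_l X l x * \sum_m Gam i l m x * A i m x.
  transitivity (\sum_i \sum_l pd D i (X l) x * A l i x +
     \sum_i \sum_l (\sum_m Gam l i m x * X m x) * A l i x).
    rewrite -big_split /=; apply: eq_bigr => i _; rewrite -big_split /=.
    by apply: eq_bigr => l _; rewrite -mulrDl.
  congr (_ + _).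
  under eq_bigr => i _ do under eq_bigr => l _ do rewrite mulr_suml.
  under [RHS]eq_bigr => i _ do under eq_bigr => l _ do rewrite mulr_sumr.
  rewrite exchange_big /=; apply: eq_bigr => l _.
  rewrite exchange_big /=; apply: eq_bigr => m _; apply: eq_bigr => i _.
  by rewrite (christoffelC l i m Vx); ring.
have -> : \sum_l gradc F l x * pd D l (fun y => \sum_i nab F i i y) x =
   \sum_i \sum_l X l x * pd D l (A i i) x.
  rewrite exchange_big /=; apply: eq_bigr => l _.
  rewrite pd_sum //; last by move=> i; exact: sA.
  by rewrite mulr_sumr.
have -> : \sum_l \sum_k cricci D g x l k * gradc F l x * gradc F k x =
   \sum_i \sum_l X l x * \sum_k riemann D g i i l k x * X k x.
  rewrite [RHS]exchange_big /=; apply: eq_bigr => l _.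
  under [RHS]eq_bigr do rewrite mulr_sumr.
  rewrite [RHS]exchange_big /=; apply: eq_bigr => k _.
  rewrite mxE mulr_suml mulr_suml; apply: eq_bigr => i _; rewrite /X; ring.
rewrite -!big_split /=; apply: eq_bigr => i _.
rewrite -!big_split /=; apply: eq_bigr => l _.
gensum; ring.
Qed.

Lemma divvM F (Z : 'I_d -> 'rV[R]_d -> R) x : V x ->
  germ 1 D F x -> (forall i, germ 1 D (Z i) x) ->
  divv (fun i y => F y * Z i y) x = F x * divv Z x + \sum_i Z i x * pd D i F x.
Proof.
move=> Vx CF CZ; rewrite /divv mulr_sumr -big_split /=; apply: eq_bigr => i _.
rewrite pdM //; last exact: VD.
rewrite mulrDr mulr_sumr.
have -> : \sum_m Gam i i m x * (F x * Z m x) = \sum_m F x * (Gam i i m x * Z m x).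
  by apply: eq_bigr => m _; ring.
ring.
Qed.

Lemma divvB (Y Z : 'I_d -> 'rV[R]_d -> R) x : V x ->
  (forall i, germ 1 D (Y i) x) -> (forall i, germ 1 D (Z i) x) ->
  divv (fun i y => Y i y - Z i y) x = divv Y x - divv Z x.
Proof.
move=> Vx CY CZ; rewrite /divv -sumrB; apply: eq_bigr => i _.
rewrite pdB //; last exact: VD.
have -> : \sum_m Gam i i m x * (Y m x - Z m x) =
   \sum_m Gam i i m x * Y m x - \sum_m Gam i i m x * Z m x.
  by rewrite -sumrB; apply: eq_bigr => m _; rewrite mulrBr.
ring.
Qed.

Variables h f : 'rV[R]_d -> R.
Hypotheses (sh : smoothV h) (sf : smoothV f).

Definition lap_h x : R := \sum_i nab f i i x - \sum_l pd D l h x * gradc f l x.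

(* The vector field whose weighted divergence is the left-hand side of
   Reilly's formula minus the curvature term. *)
Definition reilly i x : R := lap_h x * gradc f i x - hessgrad f i x.

Lemma smooth_lap_h : smoothV lap_h.
Proof.
apply: smoothVD; first by apply: smoothV_sum => i; exact: smooth_nab.
apply: smoothVN; apply: smoothV_sum => l; apply: smoothVM; first exact: smooth_pd.
exact: smooth_gradc.
Qed.

Lemma smooth_hessgrad i : smoothV (hessgrad f i).
Proof.
by apply: smoothV_sum => l; apply: smoothVM; [exact: smooth_nab|exact: smooth_gradc].
Qed.

Lemma smooth_reilly i : smoothV (reilly i).
Proof.
apply: smoothVD; last by apply: smoothVN; exact: smooth_hessgrad.
by apply: smoothVM; [exact: smooth_lap_h|exact: smooth_gradc].
Qed.

(** Two cancellations: the derivative of [div X] along [X] occurs in [div (L_h f X)] and in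
    Bochner's formula, and differentiating [<grad h, X>] along [X] gives, besides the Hessian of
    [h], the term [<grad h, nabla_X X>] that the weight produces with the other sign. *)
Lemma div_reilly x : V x ->
  divv reilly x - \sum_i pd D i h x * reilly i x =
  lap_h x ^+ 2 - \sum_i \sum_l nab f i l x * nab f l i x
  - \sum_l \sum_k (cricci D g x l k + hs h l k x) * gradc f l x * gradc f k x.
Proof.
move=> Vx; have Dx := VD Vx.
have sX i : smoothV (gradc f i) by exact: smooth_gradc.
rewrite divvB //; last 2 first.
- by move=> i; apply: smoothVM => //; exact: smooth_lap_h.
- by move=> i; exact: smooth_hessgrad.
rewrite divvM //; last 2 first.
- exact: smooth_lap_h.
- by move=> i; exact: sX.
rewrite bochner //.
have -> : divv (gradc f) x = \sum_i nab f i i x by [].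
have -> : \sum_i pd D i h x * reilly i x = lap_h x * (\sum_l pd D l h x * gradc f l x)
   - \sum_k pd D k h x * hessgrad f k x.
  rewrite mulr_sumr -sumrB; apply: eq_bigr => i _; rewrite /reilly; ring.
have -> : \sum_i gradc f i x * pd D i lap_h x =
   \sum_l gradc f l x * pd D l (fun y => \sum_i nab f i i y) x -
   (\sum_l \sum_k hs h l k x * gradc f l x * gradc f k x +
    \sum_k pd D k h x * hessgrad f k x).
  have E l : pd D l lap_h x = pd D l (fun y => \sum_i nab f i i y) x -
     \sum_k (hs h l k x * gradc f k x + pd D k h x * nab f l k x).
    rewrite /lap_h pdB //; last 2 first.
    - by apply: smoothV_sum => // i; exact: smooth_nab.
    - by apply: smoothV_sum => // i; apply: smoothVM => //; exact: smooth_pd.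
    congr (_ - _); rewrite (@pd_sumM l _ (fun k => pd D k h) (gradc f)) //; last first.
      by move=> k; exact: smooth_pd.
    rewrite big_split /= [RHS]big_split /=.
    have -> : \sum_k hs h l k x * gradc f k x = \sum_k pd D l (pd D k h) x * gradc f k x
       - \sum_k \sum_m Gam m l k x * pd D m h x * gradc f k x.
      by rewrite -sumrB; apply: eq_bigr => k _; rewrite hsE mulrBl mulr_suml.
    have -> : \sum_k pd D k h x * nab f l k x = \sum_k pd D k h x * pd D l (gradc f k) x
       + \sum_k \sum_m Gam m l k x * pd D m h x * gradc f k x.
      rewrite [X in _ = _ + X]exchange_big /= -big_split /=; apply: eq_bigr => k _.
      rewrite /nab mulrDr mulr_sumr; congr (_ + _); apply: eq_bigr => m _; ring.
    ring.
  under eq_bigr do rewrite E mulrBr.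
  rewrite sumrB; congr (_ - _).
  under eq_bigr do rewrite mulr_sumr.
  under eq_bigr => l _ do under eq_bigr => k _ do rewrite mulrDr.
  under eq_bigr do rewrite big_split /=.
  rewrite big_split /=; congr (_ + _).
    by apply: eq_bigr => l _; apply: eq_bigr => k _; ring.
  rewrite exchange_big /=; apply: eq_bigr => k _; rewrite /hessgrad mulr_sumr.
  by apply: eq_bigr => l _; ring.
have -> : \sum_l \sum_k (cricci D g x l k + hs h l k x) * gradc f l x * gradc f k x =
   \sum_l \sum_k cricci D g x l k * gradc f l x * gradc f k x +
   \sum_l \sum_k hs h l k x * gradc f l x * gradc f k x.
  rewrite -big_split /=; apply: eq_bigr => l _; rewrite -big_split /=.
  by apply: eq_bigr => k _; ring.
rewrite [in RHS]/lap_h; set P := \sum_l pd D l h x * _; rewrite /lap_h -/P; ring.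
Qed.

Lemma bilinE (T : 'M[R]_d) (u v : 'rV[R]_d) :
  bilin T u v = \sum_i \sum_j u 0 i * T i j * v 0 j.
Proof.
rewrite /bilin !mxE exchange_big /=; apply: eq_bigr => j _.
by rewrite !mxE mulr_suml.
Qed.

Lemma cgradE F x i : cgrad D g F x 0 i = gradc F i x.
Proof. by rewrite mxE. Qed.

Lemma g_gradc F i x : V x -> \sum_j g x i j * gradc F j x = pd D i F x.
Proof. exact: contract_g. Qed.

Lemma bilin_g (u v : 'rV[R]_d) x : V x ->
  bilin (g x) u v = \sum_j (\sum_i g x j i * u 0 i) * v 0 j.
Proof.
move=> Vx; rewrite bilinE exchange_big /=; apply: eq_bigr => j _.
by rewrite mulr_suml; apply: eq_bigr => i _; rewrite (gC j i Vx); ring.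
Qed.

Lemma bilin_cgrad F (v : 'rV[R]_d) x : V x ->
  bilin (g x) (cgrad D g F x) v = \sum_l pd D l F x * v 0 l.
Proof.
move=> Vx; rewrite bilin_g //; apply: eq_bigr => j _; congr (_ * _).
by under eq_bigr do rewrite cgradE; exact: g_gradc.
Qed.

Lemma gtrace_chess F x : smoothV F -> V x ->
  gtrace g x (chess D g F x) = \sum_i nab F i i x.
Proof. by move=> sF Vx; apply: eq_bigr => i _; rewrite nabE. Qed.

(** Symmetry of the Hessian turns the norm into the trace of the square of the endomorphism
    [nabla grad F], the quantity that appears in Bochner's formula. *)
Lemma gnorm2_chess F x : smoothV F -> V x ->
  gnorm2 g x (chess D g F x) = \sum_i \sum_l nab F i l x * nab F l i x.
Proof.
move=> sF Vx; rewrite /gnorm2.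
transitivity (\sum_i \sum_j \sum_k \sum_l (G k i x * hs F j i x) * (G j l x * hs F k l x)).
  apply: eq_bigr => i _; apply: eq_bigr => j _; apply: eq_bigr => k _; apply: eq_bigr => l _.
  by rewrite (chessC j i sF Vx) (ginvC k i Vx) /hs; ring.
rewrite exchange_big /=; apply: eq_bigr => j _.
rewrite exchange_big /=; apply: eq_bigr => k _.
rewrite (nabE j k sF Vx) (nabE k j sF Vx) mulr_suml; apply: eq_bigr => i _.
by rewrite mulr_sumr.
Qed.

Lemma drift_laplacianE x : V x ->
  gtrace g x (chess D g f x) - bilin (g x) (cgrad D g h x) (cgrad D g f x) = lap_h x.
Proof.
move=> Vx; rewrite gtrace_chess // bilin_cgrad //; congr (_ - _).
by apply: eq_bigr => l _; rewrite cgradE.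
Qed.

Lemma div_reillyE x : V x ->
  divv reilly x - \sum_i pd D i h x * reilly i x =
  lap_h x ^+ 2 - gnorm2 g x (chess D g f x)
  - bilin (cricci D g x + chess D g h x) (cgrad D g f x) (cgrad D g f x).
Proof.
move=> Vx; rewrite div_reilly // gnorm2_chess //; congr (_ - _).
rewrite bilinE; apply: eq_bigr => l _; apply: eq_bigr => k _.
by rewrite !cgradE [in RHS]mxE /hs; ring.
Qed.

(** Jacobi's formula, in which the cofactor is [det g] times the inverse metric; metric
    compatibility produces the trace of the Christoffel symbols twice. *)
Lemma pd_det_g k x : V x ->
  pd D k (fun y => \det (g y)) x = \det (g x) * (\sum_m Gam m k m x) *+ 2.
Proof.
move=> Vx; rewrite (pd_det mD k (VD Vx)); last by move=> i j; exact: g_smooth.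
have E i j : cofactor (g x) i j = \det (g x) * G j i x.
  rewrite /ginv /invmx (g_unit Vx) !mxE mulrA mulfV ?mul1r //.
  by rewrite gt_eqF // det_gt0.
under eq_bigr => i _ do under eq_bigr => j _ do rewrite E (pd_g k i j Vx) mulrDl.
under eq_bigr do rewrite big_split /=.
rewrite big_split /= mulr2n; congr (_ + _).
  rewrite mulr_sumr; apply: eq_bigr => m _; rewrite christoffelE mulr_sumr.
  by apply: eq_bigr => i _; rewrite (ginvC m i Vx); ring.
rewrite exchange_big mulr_sumr; apply: eq_bigr => m _.
by rewrite christoffelE mulr_sumr; apply: eq_bigr => i _ /=; ring.
Qed.

Definition voldens x : R := Num.sqrt (\det (g x)).

Lemma voldens_gt0 x : V x -> 0 < voldens x.
Proof. by move=> Vx; rewrite sqrtr_gt0 det_gt0. Qed.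

Lemma smooth_voldens : smoothV voldens.
Proof.
move=> k x Vx; apply: germ_sqrt; [exact: VD|exact: det_gt0|].
by apply: germ_det => i j; exact: g_smooth.
Qed.

Lemma pd_voldens k x : V x -> pd D k voldens x = voldens x * \sum_m Gam m k m x.
Proof.
move=> Vx; have Dx := VD Vx.
have w0 : voldens x != 0 by rewrite gt_eqF // voldens_gt0.
(* The identity [voldens ^+ 2 = det g] is differentiated instead of the square root itself. *)
have E : pd D k (fun y => voldens y * voldens y) x = pd D k (fun y => \det (g y)) x.
  by apply: eq_pdV => // y Vy; rewrite -expr2 sqr_sqrtr // ltW // det_gt0.
move: E; rewrite (pdM mD Dx k (smooth_voldens 1%N Vx) (smooth_voldens 1%N Vx)) pd_det_g //.
have -> : \det (g x) = voldens x ^+ 2 by rewrite sqr_sqrtr // ltW // det_gt0.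
move: w0; gensum; move: (pd D k voldens x) (voldens x) => p w w0 E.
by apply: (mulfI w0); lra.
Qed.

Definition wdens x : R := voldens x * expR (- h x).

Lemma smooth_wdens : smoothV wdens.
Proof.
move=> k x Vx; apply: germM; first exact: smooth_voldens.
by apply: germ_exp; apply: germN; exact: sh.
Qed.

(** The logarithmic derivative of [wdens] is the traced Christoffel symbol minus [d h], so a plain
    coordinate divergence of [wdens Z] contains exactly the weighted divergence. The factor [phi] is
    there for the cut-offs of the partition of unity. *)
Lemma div_weighted (phi : 'rV[R]_d -> R) (Z : 'I_d -> 'rV[R]_d -> R) x : V x ->
  germ 1 D phi x -> (forall i, smoothV (Z i)) ->
  \sum_i pd D i (fun y => phi y * (wdens y * Z i y)) x =
  wdens x * (phi x * (divv Z x - \sum_i pd D i h x * Z i x) +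
             \sum_i Z i x * pd D i phi x).
Proof.
move=> Vx Cphi sZ; have Dx := VD Vx.
have Cv := smooth_voldens 1%N Vx.
have Ce : germ 1 D (fun y => expR (- h y)) x.
  by apply: germ_exp; apply: germN; exact: sh.
have Cw : germ 1 D wdens x := smooth_wdens 1%N Vx.
have pw i : pd D i wdens x = wdens x * (\sum_m Gam m i m x - pd D i h x).
  rewrite (pdM mD Dx i Cv Ce) pd_voldens // (pd_exp mD Dx i (germN (sh 1%N Vx))).
  by rewrite (pdN mD Dx i (sh 1%N Vx)) /wdens; ring.
have E i : pd D i (fun y => phi y * (wdens y * Z i y)) x =
    wdens x * (phi x * (pd D i (Z i) x + \sum_m Gam m i m x * Z i x)
     - phi x * (pd D i h x * Z i x) + Z i x * pd D i phi x).
  rewrite (pdM mD Dx i Cphi (germM Cw (sZ i 1%N x Vx))).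
  rewrite (pdM mD Dx i Cw (sZ i 1%N x Vx)) pw.
  by rewrite -mulr_suml; ring.
under eq_bigr do rewrite E.
rewrite -mulr_sumr; congr (_ * _); rewrite big_split /=; congr (_ + _).
rewrite sumrB -!mulr_sumr mulrBr; congr (_ * _ - _).
rewrite /divv !big_split /=; congr (_ + _).
rewrite exchange_big /=; apply: eq_bigr => m _; apply: eq_bigr => i _.
by rewrite (christoffelC m i m).
Qed.

End ChartAlgebra.

(** * The boundary in a chart *)

Section BoundaryAlgebra.
Context {R : realType} {n : nat}.
Local Notation hs0 := (@halfspace R n).
Variables (V : set 'rV[R]_n.+1) (g : 'rV[R]_n.+1 -> 'M[R]_n.+1).
Hypothesis C : chart_metric hs0 V g.
Hypothesis ginv00_gt0 : forall x, V x -> 0 < ginv g x 0 0.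
Implicit Types (x : 'rV[R]_n.+1) (F : 'rV[R]_n.+1 -> R).
Implicit Types (a b c : 'I_n) (i j k l m : 'I_n.+1).
Local Notation G := (fun i j x => ginv g x i j).
Local Notation Gam := (christoffel hs0 g).
Local Notation up := (lift ord0).
Local Notation smoothV := (smoothV hs0 V).
Local Notation clow := (clow hs0 g).
Local Notation gradc := (gradc hs0 g).
Local Notation hs := (hs hs0 g).
Local Notation nab := (nab hs0 g).

Lemma rshift1_lift a : rshift 1 a = up a. Proof. exact: val_inj. Qed.

Lemma bemb0 (y : 'rV[R]_n) : bemb y 0 0 = 0.
Proof.
by rewrite /bemb mxE; case: split_ordP => // k _; rewrite mxE.
Qed.

Lemma bembS (y : 'rV[R]_n) a : bemb y 0 (up a) = y 0 a.
Proof. by rewrite -rshift1_lift; exact: (@row_mxEr R 1 1 n). Qed.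

Lemma sum_bemb (y : 'rV[R]_n) (P : 'I_n.+1 -> R) : \sum_i bemb y 0 i * P i = \sum_a y 0 a * P (up a).
Proof.
by rewrite big_ord_recl bemb0 mul0r add0r; apply: eq_bigr => a _; rewrite bembS.
Qed.

Lemma sum_bembr (y : 'rV[R]_n) (P : 'I_n.+1 -> R) : \sum_i P i * bemb y 0 i = \sum_a P (up a) * y 0 a.
Proof.
by rewrite big_ord_recl bemb0 mulr0 add0r; apply: eq_bigr => a _; rewrite bembS.
Qed.

Lemma halfspace_bemb (y : 'rV[R]_n) : hs0 (bemb y).
Proof. by rewrite /halfspace /= bemb0. Qed.

Lemma bembD (y : 'rV[R]_n) (t : R) a : bemb (y + t *: delta_mx 0 a) = bemb y + t *: delta_mx 0 (up a).
Proof.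
apply/rowP => i; rewrite [RHS]mxE [X in _ = _ + X]mxE [X in _ = _ + _ * X]mxE eqxx /=.
case: (unliftP ord0 i) => [c ->|->].
  by rewrite !bembS !mxE eqxx (inj_eq lift_inj).
by rewrite !bemb0 mulr0 addr0.
Qed.

Lemma continuous_bemb : continuous (@bemb R n).
Proof.
move=> y; apply/(@cvgrPdist_lt _ _ _ (nbhs y) (nbhs_filter _)) => e e0; near=> z.
apply: (@le_lt_trans _ _ `|y - z|).
  apply: norm_rV_le => // i; rewrite [X in `|X|]mxE [X in `|_ + X|]mxE.
  case: (unliftP ord0 i) => [b ->|->]; last by rewrite !bemb0 subrr normr0.
  by rewrite !bembS; have := norm_coord (y - z) b; rewrite !mxE.
by near: z; apply: cvgr_dist_lt => //; exact: cvg_id.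
Unshelve. all: by end_near. Qed.

(* Holds without regularity: tangential difference quotients at boundary points
   do not leave the boundary. *)
Lemma pd_bemb F a (y : 'rV[R]_n) : pd setT a (fun z => F (bemb z)) y = pd hs0 (up a) F (bemb y).
Proof.
rewrite /pd.
have -> : (fun t : R => (F (bemb (y + t *: delta_mx 0 a)) - F (bemb y)) / t) =
   (fun t : R => (F (bemb y + t *: delta_mx 0 (up a)) - F (bemb y)) / t).
  by apply/funext => t; rewrite bembD.
have -> : [set t : R | setT (y + t *: delta_mx 0 a)] =
          [set t : R | hs0 (bemb y + t *: delta_mx 0 (up a))] => //.
by apply/seteqP; split => t //= _; rewrite -bembD; exact: halfspace_bemb.
Qed.

Lemma induced_metricE (y : 'rV[R]_n) a b : induced_metric g y a b = g (bemb y) (up a) (up b).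
Proof. by rewrite -!rshift1_lift !mxE. Qed.

Definition nu i x : R := outward_normal g x 0 i.

Lemma nuE i x : nu i x = - (Num.sqrt (G 0 0 x))^-1 * G 0 i x.
Proof. by rewrite /nu /outward_normal !mxE. Qed.

(* [(nabla_{e_i} nu)^k] *)
Definition covnu i k x : R := pd hs0 i (nu k) x + \sum_j Gam k i j x * nu j x.

(* [II(e_a, e_b)] *)
Definition IIc a b x : R := \sum_k covnu (up a) k x * g x k (up b).

Definition fnu F x : R := \sum_k pd hs0 k F x * nu k x.

Let s x := Num.sqrt (G 0 0 x).

Lemma s_gt0 x : V x -> 0 < s x.
Proof. by move=> Vx; rewrite sqrtr_gt0 ginv00_gt0. Qed.

Lemma s_neq0 x : V x -> s x != 0.
Proof. by move=> Vx; rewrite gt_eqF // s_gt0. Qed.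

Lemma sqr_s x : V x -> s x * s x = G 0 0 x.
Proof. by move=> Vx; rewrite -expr2 sqr_sqrtr // ltW // ginv00_gt0. Qed.

Lemma smooth_s : smoothV s.
Proof.
move=> k x Vx; apply: germ_sqrt; [exact: (cm_sub C)|exact: ginv00_gt0|].
exact: (smooth_ginv C).
Qed.

Lemma smooth_nu i : smoothV (nu i).
Proof.
move=> r x Vx; apply: (germ_ext (F := fun y => - (s y)^-1 * G 0 i y)).
  by apply: near_eqW => y; rewrite nuE.
apply: germM; last exact: (smooth_ginv C).
apply: germN; apply: germ_inv; [exact: (cm_sub C)|exact: s_neq0|exact: smooth_s].
Qed.

(** [nu] is a multiple of the gradient of [x_0], so lowering its index leaves a multiple of
    [dx_0]. *)
Lemma g_nu j x : V x -> \sum_k nu k x * g x k j = - (s x)^-1 * (j == 0)%:R.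
Proof.
move=> Vx; under eq_bigr do rewrite nuE -mulrA.
by rewrite -mulr_sumr (ginv_g C) // eq_sym.
Qed.

(** The square roots disappear from the products; this keeps the normal and tangential splittings
    below rational in the inverse metric. *)
Lemma nu_nu i j x : V x -> nu i x * nu j x = G 0 i x * G 0 j x / G 0 0 x.
Proof. by move=> Vx; rewrite !nuE -/(s x) -(sqr_s Vx); field; exact: s_neq0. Qed.

Lemma nu0 x : V x -> nu 0 x = - s x.
Proof. by move=> Vx; rewrite nuE -/(s x) -(sqr_s Vx); field; exact: s_neq0. Qed.

Lemma smooth_fnu F : smoothV F -> smoothV (fnu F).
Proof.
move=> sF; apply: smoothV_sum => k; apply: smoothVM; last exact: smooth_nu.
exact: (smooth_pd C).
Qed.

(** Differentiating [<nu, e_b> = 0] along [e_a] moves the derivative from [nu] to [e_b], so that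
    [II(e_a, e_b) = - <nu, nabla_{e_a} e_b>]. *)
Lemma IIE a b x : V x -> IIc a b x = - \sum_l clow (up a) (up b) l x * nu l x.
Proof.
move=> Vx; have Dx := cm_sub C Vx.
have E : \sum_k (pd hs0 (up a) (nu k) x * g x k (up b) +
    nu k x * pd hs0 (up a) (fun y => g y k (up b)) x) = 0.
  rewrite -(@pd_sumM _ _ _ _ _ C (up a) _ nu (fun k y => g y k (up b))) //; last 2 first.
  - exact: smooth_nu.
  - by move=> k; exact: cm_smooth C _ _.
  rewrite (@eq_pdV _ _ _ _ _ C (up a) _ (fun=> 0) x) // => [|y Vy].
    by rewrite pd_cst //; exact: cm_model C.
  by rewrite g_nu // (_ : (up b == 0) = false) ?mulr0.
have E2 : \sum_k nu k x * pd hs0 (up a) (fun y => g y k (up b)) x =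
   \sum_k nu k x * clow (up a) k (up b) x + \sum_l clow (up a) (up b) l x * nu l x.
  rewrite -big_split /=; apply: eq_bigr => k _.
  by rewrite (pd_g C) // mulrDr; congr (_ + _); exact: mulrC.
have E3 : \sum_k (\sum_j Gam k (up a) j x * nu j x) * g x k (up b) =
   \sum_k nu k x * clow (up a) k (up b) x.
  under eq_bigr do rewrite mulr_suml.
  rewrite exchange_big /=; apply: eq_bigr => j _.
  rewrite -(clowE C) // mulr_sumr; apply: eq_bigr => k _.
  by rewrite (gC C k) //; ring.
rewrite /IIc /covnu; under eq_bigr do rewrite mulrDl.
rewrite big_split /= E3.
rewrite big_split /= E2 in E.
by move: E; gensum; lra.
Qed.

Lemma second_formE (X Y : 'rV[R]_n) x :
  bilin (g x) (covd hs0 g (outward_normal g) (bemb X) x) (bemb Y) =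
  \sum_a \sum_b X 0 a * IIc a b x * Y 0 b.
Proof.
rewrite bilinE exchange_big /=.
rewrite (eq_bigr (fun j => (\sum_i covd hs0 g (outward_normal g) (bemb X) x 0 i * g x i j) * bemb Y 0 j)); last first.
  by move=> j _; rewrite mulr_suml.
rewrite sum_bembr exchange_big /=; apply: eq_bigr => b _; rewrite -mulr_suml; congr (_ * _).
rewrite (eq_bigr (fun i => \sum_a X 0 a * (covnu (up a) i x * g x i (up b)))).
  by rewrite exchange_big /=; apply: eq_bigr => a _; rewrite mulr_sumr.
move=> i _; rewrite mxE (sum_bemb X (fun k => covnu k i x)) mulr_suml.
by apply: eq_bigr => a _; rewrite mulrA.
Qed.

Section AtPoint.
Variables (y : 'rV[R]_n).
Let x := bemb y.
Hypothesis Vx : V x.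

(** Schur complement: the tangential block of [g] is inverted by subtracting [nu^a nu^b] from the
    inverse metric (see [nu_nu]). *)
Definition ginvb a b : R := G (up a) (up b) x - G 0 (up a) x * G 0 (up b) x / G 0 0 x.

Lemma ginvb_g a c : \sum_b ginvb a b * g x (up b) (up c) = (a == c)%:R.
Proof.
have G00 : G 0 0 x != 0 by rewrite gt_eqF // ginv00_gt0.
under eq_bigr do rewrite mulrBl.
rewrite sumrB.
have E i : \sum_b G i (up b) x * g x (up b) (up c) =
    (i == up c)%:R - G i 0 x * g x 0 (up c).
  by rewrite -(ginv_g C i (up c) Vx) big_ord_recl /= addrAC subrr add0r.
have -> : \sum_b G 0 (up a) x * G 0 (up b) x / G 0 0 x * g x (up b) (up c) =
   G 0 (up a) x / G 0 0 x * \sum_b G 0 (up b) x * g x (up b) (up c).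
  by rewrite mulr_sumr; apply: eq_bigr => b _; ring.
rewrite !E (inj_eq lift_inj) (_ : (0 == up c) = false) // (ginvC C (up a)) //.
by rewrite sub0r mulrN opprK; field.
Qed.

Lemma ginv_inducedE a b : ginv (induced_metric g) y a b = ginvb a b.
Proof.
pose B := \matrix_(a, b) ginvb a b.
have BA : B *m induced_metric g y = 1%:M.
  apply/matrixP => i j; rewrite mxE [RHS]mxE -ginvb_g.
  by apply: eq_bigr => c _; rewrite mxE induced_metricE.
have [_ Au] := mulmx1_unit BA.
have -> : ginv (induced_metric g) y = B.
  by rewrite /ginv -[LHS]mul1mx -BA -mulmxA mulmxV // mulmx1.
by rewrite mxE.
Qed.

Definition gradb F a : R := \sum_b ginvb a b * pd hs0 (up b) F x.

Lemma boundary_gradE F a :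
  cgrad setT (induced_metric g) (fun z => F (bemb z)) y 0 a = gradb F a.
Proof. by rewrite mxE; apply: eq_bigr => b _; rewrite ginv_inducedE pd_bemb. Qed.

(* [grad F = grad_bd F + F_nu nu] *)
Lemma gradc_up F a : gradc F (up a) x = gradb F a + fnu F x * nu (up a) x.
Proof.
have G00 : G 0 0 x != 0 by rewrite gt_eqF // ginv00_gt0.
have -> : fnu F x * nu (up a) x = \sum_k G 0 k x * G 0 (up a) x / G 0 0 x * pd hs0 k F x.
  by rewrite /fnu mulr_suml; apply: eq_bigr => k _; rewrite -nu_nu //; ring.
rewrite /gradc big_ord_recl [in RHS]big_ord_recl addrCA /gradb -big_split /=.
congr (_ + _); first by rewrite (ginvC C (up a) ord0 Vx); field.
by apply: eq_bigr => b _; rewrite /ginvb; ring.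
Qed.

Lemma gradc_0 F : gradc F 0 x = fnu F x * nu 0 x.
Proof.
rewrite /fnu mulr_suml; apply: eq_bigr => k _.
by rewrite -mulrA nu_nu // mulfK 1?mulrC // gt_eqF // ginv00_gt0.
Qed.

Lemma gradcE F (P : 'I_n.+1 -> R) : \sum_k gradc F k x * P k =
  \sum_a gradb F a * P (up a) + fnu F x * \sum_k nu k x * P k.
Proof.
rewrite !big_ord_recl gradc_0 mulrDr addrCA mulr_sumr -big_split /= mulrA; congr (_ + _).
by apply: eq_bigr => a _; rewrite gradc_up; ring.
Qed.

Lemma christoffel_inducedE c a b :
  christoffel setT (induced_metric g) c a b y =
  \sum_d ginvb c d * clow (up a) (up b) (up d) x.
Proof.
rewrite /christoffel mulr_sumr; apply: eq_bigr => d _; rewrite ginv_inducedE.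
have E e a' b' : pd setT e (fun z => induced_metric g z a' b') y =
    pd hs0 (up e) (fun z => g z (up a') (up b')) x.
  rewrite -pd_bemb (_ : (fun z => _) = (fun z => g (bemb z) (up a') (up b'))) //.
  by apply/funext => z; exact: induced_metricE.
by rewrite !E /clow mulrCA.
Qed.

Lemma ginvbC a b : ginvb a b = ginvb b a.
Proof. by rewrite /ginvb (ginvC C (up a)) //; ring. Qed.

(* Gauss formula for the Hessian of a function. *)
Lemma hs_tangential F a b : smoothV F ->
  hs F (up a) (up b) x =
  chess setT (induced_metric g) (fun z => F (bemb z)) y a b + fnu F x * IIc a b x.
Proof.
move=> sF; rewrite hsE IIE // mxE.
have -> : pd setT a (pd setT b (fun z => F (bemb z))) y = pd hs0 (up a) (pd hs0 (up b) F) x.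
  rewrite -pd_bemb (_ : pd setT b _ = (fun z => pd hs0 (up b) F (bemb z))) //.
  by apply/funext => z; exact: pd_bemb.
have -> : \sum_k Gam k (up a) (up b) x * pd hs0 k F x =
   \sum_k gradc F k x * clow (up a) (up b) k x.
  under eq_bigr do rewrite (christoffelE hs0 g) mulr_suml.
  rewrite exchange_big /=; apply: eq_bigr => k _; rewrite mulr_suml.
  by apply: eq_bigr => l _; rewrite (ginvC C k l Vx); ring.
rewrite gradcE.
have -> : \sum_c christoffel setT (induced_metric g) c a b y *
    pd setT c (fun z => F (bemb z)) y =
  \sum_c gradb F c * clow (up a) (up b) (up c) x.
  under eq_bigr do rewrite christoffel_inducedE pd_bemb mulr_suml.
  rewrite exchange_big /=; apply: eq_bigr => c _; rewrite mulr_suml.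
  by apply: eq_bigr => d _; rewrite ginvbC; ring.
have -> : \sum_k nu k x * clow (up a) (up b) k x = \sum_l clow (up a) (up b) l x * nu l x.
  by apply: eq_bigr => k _; exact: mulrC.
gensum; ring.
Qed.

Definition hsnn F : R := \sum_i \sum_j nu i x * hs F i j x * nu j x.

(** The inverse metric is [nu^i nu^j] plus [ginvb], so the trace of the Hessian splits; the
    tangential part is then given by the Gauss formula [hs_tangential]. *)
Lemma laplacian_boundary F : smoothV F ->
  \sum_i nab F i i x = hsnn F +
  gtrace (induced_metric g) y (chess setT (induced_metric g) (fun z => F (bemb z)) y) +
  fnu F x * gtrace (induced_metric g) y (\matrix_(a, b) IIc a b x).
Proof.
move=> sF.
have G00 : G 0 0 x != 0 by rewrite gt_eqF // ginv00_gt0.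
have -> : \sum_i nab F i i x = hsnn F + \sum_a \sum_b ginvb a b * hs F (up a) (up b) x.
  have -> : \sum_i nab F i i x = \sum_i \sum_j G i j x * hs F i j x.
    by apply: eq_bigr => i _; rewrite (nabE C).
  have N i j : nu i x * hs F i j x * nu j x = G 0 i x * G 0 j x / G 0 0 x * hs F i j x.
    by rewrite -nu_nu //; ring.
  rewrite /hsnn; under [in RHS]eq_bigr => i _ do under eq_bigr => j _ do rewrite N.
  rewrite big_ord_recl [X in _ = X + _]big_ord_recl -addrA; congr (_ + _).
    by apply: eq_bigr => j _; field.
  rewrite -big_split /=; apply: eq_bigr => a _.
  rewrite big_ord_recl [X in _ = X + _]big_ord_recl -addrA; congr (_ + _).
    by rewrite (ginvC C (up a) ord0 Vx); field.
  rewrite -big_split /=; apply: eq_bigr => b _; rewrite /ginvb; ring.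
rewrite -addrA; congr (_ + _); rewrite /gtrace mulr_sumr -big_split /=.
apply: eq_bigr => a _; rewrite mulr_sumr -big_split /=; apply: eq_bigr => b _.
by rewrite ginv_inducedE hs_tangential // [in RHS]mxE; ring.
Qed.

(** The derivative of a unit normal is tangent: as [nu^0 = - s], this amounts to differentiating
    [s ^+ 2 = g^00]. *)
Lemma covnu_normal a : covnu (up a) 0 x = 0.
Proof.
have Dx := cm_sub C Vx; have mD := cm_model C.
have E : pd hs0 (up a) (fun z => s z * s z) x = pd hs0 (up a) (G 0 0) x.
  by apply: (eq_pdV C) => // z Vz; exact: sqr_s.
move: E; rewrite (pdM mD Dx (up a) (smooth_s 1%N Vx) (smooth_s 1%N Vx)) (pd_ginv C) // => E.
rewrite /covnu (@eq_pdV _ _ _ _ _ C (up a) _ (fun z => - s z) x) //; last exact: nu0.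
rewrite (pdN mD Dx (up a) (smooth_s 1%N Vx)).
have -> : \sum_j Gam 0 (up a) j x * nu j x = - (s x)^-1 * \sum_j Gam 0 (up a) j x * G j 0 x.
  rewrite mulr_sumr; apply: eq_bigr => j _.
  by rewrite nuE -/(s x) (ginvC C j) //; ring.
move: E; rewrite big_split /=; have := s_neq0 Vx.
gensum; move: (pd hs0 _ s x) (s x) => p q q0 E.
have {}E : q * p = - S by lra.
by apply: (mulfI q0); rewrite mulr0 mulrDr mulrN E; field.
Qed.

(* [d(F_nu)(e_a) = D^2F(e_a, nu) + II(e_a, grad_bd F)] *)
Lemma pd_fnu F a : smoothV F ->
  pd hs0 (up a) (fnu F) x = \sum_k hs F (up a) k x * nu k x +
  \sum_b gradb F b * IIc a b x.
Proof.
move=> sF.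
rewrite (@pd_sumM _ _ _ _ _ C (up a) _ (fun k => pd hs0 k F) nu) //; last 2 first.
- by move=> k; exact: (smooth_pd C).
- exact: smooth_nu.
(* The right-hand side is [<grad F, nabla_a nu>]. Since [nabla_a nu] is tangent, the normal part of
   [grad F] drops out. *)
have -> : \sum_b gradb F b * IIc a b x = \sum_k pd hs0 k F x * covnu (up a) k x.
  have -> : \sum_k pd hs0 k F x * covnu (up a) k x =
     \sum_l gradc F l x * \sum_k covnu (up a) k x * g x k l.
    under eq_bigr do rewrite -(g_gradc C) // mulr_suml.
    rewrite exchange_big /=; apply: eq_bigr => l _; rewrite mulr_sumr.
    by apply: eq_bigr => k _; ring.
  rewrite gradcE.
  have -> : \sum_k nu k x * (\sum_l covnu (up a) l x * g x l k) = 0.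
    have -> : \sum_k nu k x * (\sum_l covnu (up a) l x * g x l k) =
      \sum_l covnu (up a) l x * \sum_k nu k x * g x k l.
      under eq_bigr do rewrite mulr_sumr.
      rewrite exchange_big /=; apply: eq_bigr => l _; rewrite mulr_sumr.
      by apply: eq_bigr => k _; rewrite (gC C k l) //; ring.
    under eq_bigr do rewrite g_nu //.
    rewrite big_ord_recl covnu_normal mul0r add0r big1 // => c _.
    by rewrite (_ : (up c == 0) = false) ?mulr0.
  by rewrite mulr0 addr0.
rewrite -!big_split /=.
have -> : \sum_k (hs F (up a) k x * nu k x + pd hs0 k F x * covnu (up a) k x) =
  \sum_k (pd hs0 (up a) (pd hs0 k F) x * nu k x + pd hs0 k F x * pd hs0 (up a) (nu k) x)
  + (\sum_k pd hs0 k F x * (\sum_j Gam k (up a) j x * nu j x) -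
     \sum_k (\sum_m Gam m (up a) k x * pd hs0 m F x) * nu k x).
  rewrite -sumrB -big_split /=; apply: eq_bigr => k _; rewrite hsE /covnu.
  by gensum; ring.
have -> : \sum_k pd hs0 k F x * (\sum_j Gam k (up a) j x * nu j x) =
     \sum_k (\sum_m Gam m (up a) k x * pd hs0 m F x) * nu k x.
  under eq_bigr do rewrite mulr_sumr.
  under [RHS]eq_bigr do rewrite mulr_suml.
  rewrite exchange_big /=; apply: eq_bigr => k _; apply: eq_bigr => l _; ring.
by rewrite subrr addr0.
Qed.

Lemma boundary_innerE (X : 'rV[R]_n) F :
  bilin (induced_metric g y) (\row_a gradb F a) X = \sum_a pd hs0 (up a) F x * X 0 a.
Proof.
rewrite bilinE exchange_big /=; apply: eq_bigr => b _; rewrite -mulr_suml; congr (_ * _).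
under eq_bigr do rewrite mxE induced_metricE /gradb mulr_suml.
rewrite exchange_big /= -[RHS](sum_delta (fun b => pd hs0 (up b) F x)).
apply: eq_bigr => c _; rewrite -ginvb_g mulr_suml; apply: eq_bigr => a _.
by rewrite (ginvbC a) -/x; ring.
Qed.

Variables h f : 'rV[R]_n.+1 -> R.
Hypotheses (sh : smoothV h) (sf : smoothV f).
Let gradb_f : 'rV[R]_n := cgrad setT (induced_metric g) (fun z => f (bemb z)) y.

(** Splitting [grad f] into its normal and tangential parts, [pd_fnu] evaluates the mixed Hessian
    term; this is where [<grad_bd f, grad_bd f_nu>] and the [II] term come from. *)
Lemma hs_normal : \sum_i \sum_j gradc f i x * hs f i j x * nu j x =
  fnu f x * hsnn f + \sum_a pd hs0 (up a) (fnu f) x * gradb f a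
  - \sum_a \sum_b gradb f a * IIc a b x * gradb f b.
Proof.
have -> : \sum_i \sum_j gradc f i x * hs f i j x * nu j x =
   \sum_i gradc f i x * \sum_j hs f i j x * nu j x.
  by apply: eq_bigr => i _; rewrite mulr_sumr; apply: eq_bigr => j _; rewrite mulrA.
rewrite gradcE [LHS]addrC -addrA; congr (_ + _).
  congr (_ * _); apply: eq_bigr => i _; rewrite mulr_sumr.
  by apply: eq_bigr => j _; rewrite mulrA.
rewrite -sumrB; apply: eq_bigr => a _; rewrite pd_fnu // mulrDl mulrC.
have -> : (\sum_b gradb f b * IIc a b x) * gradb f a =
    \sum_b gradb f a * IIc a b x * gradb f b.
  by rewrite mulr_suml; apply: eq_bigr => b _; ring.
by rewrite addrK.
Qed.

(** Lowering [nu] gives [- dx_0 / sqrt g^00], so the left-hand side is [<Z, nu>]; it is in this form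
    that the divergence theorem on the half-space delivers it. *)
Lemma reilly_normal :
  - (s x)^-1 * reilly hs0 g h f 0 x =
  lap_h hs0 g h f x * fnu f x - \sum_i \sum_j gradc f i x * hs f i j x * nu j x.
Proof.
rewrite /reilly mulrBr; congr (_ - _).
  by rewrite gradc_0 nu0 //; field; exact: s_neq0.
rewrite /hessgrad mulr_sumr; apply: eq_bigr => l _.
rewrite (nabE C) // mulr_suml mulr_sumr; apply: eq_bigr => j _.
by rewrite nuE -/(s x); ring.
Qed.

(* The boundary integrand of Reilly's formula is the normal component of [reilly]. *)
Lemma boundary_reilly :
  (gtrace (induced_metric g) y (\matrix_(a, b) IIc a b x) * fnu f x
    - bilin (g x) (cgrad hs0 g h x) (cgrad hs0 g f x)
    + gtrace (induced_metric g) y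
        (chess setT (induced_metric g) (fun z => f (bemb z)) y)) * fnu f x
  + (\sum_a \sum_b gradb_f 0 a * IIc a b x * gradb_f 0 b
     - bilin (induced_metric g y) gradb_f
         (cgrad setT (induced_metric g) (fun z => fnu f (bemb z)) y))
  = - (s x)^-1 * reilly hs0 g h f 0 x.
Proof.
have gE : gradb_f = \row_a gradb f a.
  by apply/rowP => a; rewrite boundary_gradE mxE.
rewrite reilly_normal hs_normal -(drift_laplacianE C h sf Vx) (gtrace_chess C sf Vx).
rewrite (laplacian_boundary sf) gE boundary_innerE.
have -> : \sum_a pd hs0 (up a) f x *
    cgrad setT (induced_metric g) (fun z => fnu f (bemb z)) y 0 a =
    \sum_a pd hs0 (up a) (fnu f) x * gradb f a.
  under eq_bigr do rewrite boundary_gradE mulr_sumr.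
  rewrite exchange_big /=; apply: eq_bigr => a _; rewrite mulr_sumr.
  by apply: eq_bigr => b _; rewrite ginvbC; ring.
under eq_bigr => a _ do under eq_bigr => b _ do rewrite mxE [in X in _ * X]mxE.
move: (gtrace _ _ _) (gtrace _ _ _) (bilin _ _ _) (fnu f x) (hsnn f) => *.
gensum; ring.
Qed.

(** Isolates one factor of the first boundary integrand. The statement to prove has two separate
    boundary integrals, so the regularity of each integrand must be visible, not only that of their
    sum. *)
Lemma boundary_reilly1 :
  gtrace (induced_metric g) y (\matrix_(a, b) IIc a b x) * fnu f x
    - bilin (g x) (cgrad hs0 g h x) (cgrad hs0 g f x)
    + gtrace (induced_metric g) y
        (chess setT (induced_metric g) (fun z => f (bemb z)) y) =
  lap_h hs0 g h f x - hsnn f.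
Proof.
rewrite -(drift_laplacianE C h sf Vx) (gtrace_chess C sf Vx) (laplacian_boundary sf).
ring.
Qed.

End AtPoint.

End BoundaryAlgebra.

(** * Change of charts *)

Section ChangeOfCoordinates.
Context {R : realType} {d : nat}.
Variables (D V V' : set 'rV[R]_d) (g g' : 'rV[R]_d -> 'M[R]_d).
Hypotheses (C : chart_metric D V g) (C' : chart_metric D V' g').
Variable tau : 'rV[R]_d -> 'rV[R]_d.
Hypothesis tauV : forall x, V x -> V' (tau x).
Hypothesis tau_smooth : forall c, smoothV D V (fun x => tau x 0 c).

(** Rows are indexed by the source coordinates: differentials transform by [jacm], and vectors,
    written as columns, by its transpose. *)
Definition jacm x : 'M[R]_d := \matrix_(a, b) pd D a (fun y => tau y 0 b) x.

Hypothesis g_compat : forall x, V x -> g x = jacm x *m g' (tau x) *m (jacm x)^T.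

Implicit Types (F : 'rV[R]_d -> R) (x : 'rV[R]_d).

Definition dcol F x : 'cV[R]_d := \col_a pd D a F x.
Definition gcol (m : 'rV[R]_d -> 'M[R]_d) F x : 'cV[R]_d := \col_a gradc D m F a x.

Lemma gcolE m F x : gcol m F x = ginv m x *m dcol F x.
Proof.
by apply/colP => a; rewrite !mxE; apply: eq_bigr => b _; rewrite mxE.
Qed.

Lemma jacm_unit x : V x -> jacm x \in unitmx.
Proof.
move=> Vx; have := g_unit C Vx; rewrite (g_compat Vx) !unitmx_mul.
by case/andP => /andP[].
Qed.

Lemma ginv_change x : V x -> (jacm x)^T *m ginv g x *m jacm x = ginv g' (tau x).
Proof.
move=> Vx; have Ju := jacm_unit Vx; have JTu : (jacm x)^T \in unitmx by rewrite unitmx_tr.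
have g'u := g_unit C' (tauV Vx).
set A := _ *m _ *m _.
have E : A *m g' (tau x) = 1%:M.
  rewrite -[LHS](mulmxK JTu) -[RHS](mulmxV JTu); congr (_ *m _).
  rewrite /A -!mulmxA (mulmxA (jacm x)) -g_compat //.
  by rewrite /ginv (mulVmx (g_unit C Vx)) mulmx1.
by rewrite -[LHS](mulmxK g'u) E mul1mx.
Qed.

Lemma dcol_change F F' x : V x -> germ 1 D F' (tau x) ->
  (forall y, V y -> F y = F' (tau y)) ->
  dcol F x = jacm x *m dcol F' (tau x).
Proof.
move=> Vx CF' FF'; apply/colP => a; rewrite !mxE.
rewrite (@pd_chain _ _ D (cm_model C) x (cm_sub C Vx) a F F' tau) //.
- by apply: eq_bigr => b _; rewrite !mxE mulrC.
- by move=> c; exact: tau_smooth.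
- exact: (cm_sub C' (tauV Vx)).
- apply: filterS (cm_open C Vx) => y Vy /Vy{}Vy; split; last exact: FF'.
  exact: (cm_sub C' (tauV Vy)).
Qed.

Lemma gcol_change F F' x : V x -> germ 1 D F' (tau x) ->
  (forall y, V y -> F y = F' (tau y)) ->
  (jacm x)^T *m gcol g F x = gcol g' F' (tau x).
Proof.
by move=> Vx CF' FF'; rewrite !gcolE (dcol_change Vx CF' FF') !mulmxA ginv_change.
Qed.

Lemma vec_change F F' (Z Z' : 'cV[R]_d) x : V x -> germ 1 D F' (tau x) ->
  (forall y, V y -> F y = F' (tau y)) -> (jacm x)^T *m Z = Z' ->
  \sum_a Z a 0 * pd D a F x = \sum_a Z' a 0 * pd D a F' (tau x).
Proof.
move=> Vx CF' FF' <-.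
have E (T : 'cV[R]_d) K y : \sum_a T a 0 * pd D a K y = (T^T *m dcol K y) 0 0.
  by rewrite !mxE; apply: eq_bigr => a _; rewrite !mxE.
by rewrite !E (dcol_change Vx CF' FF') trmx_mul trmxK mulmxA.
Qed.

(** The two local expressions of one smooth function on the manifold. *)
Definition paired F F' := [/\ smoothV D V F, smoothV D V' F' &
  forall y, V y -> F y = F' (tau y)].

Lemma gam_change F F' K K' x : V x -> paired F F' -> paired K K' ->
  gam D g F K x = gam D g' F' K' (tau x).
Proof.
move=> Vx [_ sF' FF'] [_ sK' KK']; rewrite /gam.
have := @vec_change K K' (gcol g F x) (gcol g' F' (tau x)) x Vx (sK' 1%N _ (tauV Vx)) KK'
  (gcol_change Vx (sF' 1%N _ (tauV Vx)) FF').
by under eq_bigr do rewrite mxE; under [RHS]eq_bigr do rewrite mxE.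
Qed.

Lemma paired_gam F F' K K' : paired F F' -> paired K K' ->
  paired (gam D g F K) (gam D g' F' K').
Proof.
move=> FF' KK'; split.
- by case: FF' => sF _ _; case: KK' => sK _ _; exact: (smooth_gam C).
- by case: FF' => _ sF' _; case: KK' => _ sK' _; exact: (smooth_gam C').
- by move=> y Vy; exact: gam_change.
Qed.

Lemma paired_coord c : paired (fun y => tau y 0 c) (fun y => y 0 c).
Proof. by split=> // k y _; exact: germ_coord. Qed.

Lemma hess_quad (m : 'rV[R]_d -> 'M[R]_d) F u v x :
  \sum_i \sum_j gradc D m u i x * hs D m F i j x * gradc D m v j x =
  ((gcol m u x)^T *m chess D m F x *m gcol m v x) 0 0.
Proof.
rewrite [RHS]mxE exchange_big /=; apply: eq_bigr => j _.
rewrite [X in _ = X * _]mxE [X in _ = _ * X]mxE mulr_suml.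
by apply: eq_bigr => i _; rewrite [X in _ = X * _ * _]mxE [X in _ = X * _ * _]mxE.
Qed.

(** [chess_gam] is applied with [u] and [v] the coordinate functions of the target chart. Since
    brackets are invariant, both sides agree as bilinear forms on the gradients [P c]. *)
Lemma chess_change F F' x : V x -> paired F F' ->
  chess D g F x = jacm x *m chess D g' F' (tau x) *m (jacm x)^T.
Proof.
move=> Vx FF'; have [sF sF' FE] := FF'; have V'x := tauV Vx.
have Ju := jacm_unit Vx; have JTu : (jacm x)^T \in unitmx by rewrite unitmx_tr.
have g'u := g_unit C' V'x.
pose P c : 'cV[R]_d := gcol g (fun y => tau y 0 c) x.
have P'E c : gcol g' (fun y => y 0 c) (tau x) = (jacm x)^T *m P c.
  by apply/esym/gcol_change => //; exact: germ_coord.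
have PE c : (jacm x)^T *m P c = ginv g' (tau x) *m delta_mx c 0.
  rewrite -P'E gcolE; congr (_ *m _).
  apply/colP => a; rewrite !mxE (pd_coord (cm_model C) (cm_sub C' V'x)).
  by rewrite eqxx andbT eq_sym.
have dbl (a b : R) : a *+ 2 = b *+ 2 -> a = b by rewrite !mulr2n => E; lra.
have Q c e : ((P c)^T *m chess D g F x *m P e) 0 0 =
   ((P c)^T *m (jacm x *m chess D g' F' (tau x) *m (jacm x)^T) *m P e) 0 0.
  have Pc := paired_coord c; have Pe := paired_coord e.
  have [sc sc' _] := Pc; have [se se' _] := Pe.
  have E1 := chess_gam C sF sc se Vx; have E2 := chess_gam C' sF' sc' se' V'x.
  rewrite (gam_change Vx Pc (paired_gam FF' Pe)) (gam_change Vx Pe (paired_gam FF' Pc)) in E1.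
  rewrite (gam_change Vx FF' (paired_gam Pc Pe)) -E2 !hess_quad !P'E in E1.
  have E3 : ((jacm x)^T *m P c)^T *m chess D g' F' (tau x) *m ((jacm x)^T *m P e) =
    (P c)^T *m (jacm x *m chess D g' F' (tau x) *m (jacm x)^T) *m P e.
    by rewrite trmx_mul trmxK !mulmxA.
  by apply: dbl; rewrite E1 E3.
(* The gradients [P c] are the columns of this invertible matrix, hence form a basis, and the
   matrices of the two forms agree. *)
pose PP : 'M[R]_d := invmx (jacm x)^T *m ginv g' (tau x).
have PPE c : P c = col c PP.
  by rewrite -[P c](mulKmx JTu) PE mulmxA -colE.
have PPu : PP \in unitmx by rewrite unitmx_mul unitmx_inv JTu unitmx_inv g'u.
have S : PP^T *m chess D g F x *m PP =
  PP^T *m (jacm x *m chess D g' F' (tau x) *m (jacm x)^T) *m PP.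
  have ent (B : 'M[R]_d) c e : (PP^T *m B *m PP) c e = ((P c)^T *m B *m P e) 0 0.
    by rewrite !PPE tr_col -row_mul [LHS]mxE [RHS]mxE; apply: eq_bigr => i _; rewrite !mxE.
  by apply/matrixP => c e; rewrite !ent Q.
have PTu : PP^T \in unitmx by rewrite unitmx_tr.
by have /(can_inj (mulmxK PPu))/(can_inj (mulKmx PTu)) := S.
Qed.

(** The endomorphism [nabla grad F]. It changes by conjugation, so the traces of it and of its
    square, that is the Laplacian and the squared norm of the Hessian, are invariant. *)
Definition nabmx (m : 'rV[R]_d -> 'M[R]_d) F x : 'M[R]_d := ginv m x *m chess D m F x.

Lemma nabmx_change F F' x : V x -> paired F F' ->
  (jacm x)^T *m nabmx g F x = nabmx g' F' (tau x) *m (jacm x)^T.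
Proof.
move=> Vx FF'; rewrite /nabmx (chess_change Vx FF').
by rewrite !mulmxA ginv_change.
Qed.

Lemma tr_nabmx_change F F' x : V x -> paired F F' ->
  \tr (nabmx g F x) = \tr (nabmx g' F' (tau x)).
Proof.
move=> Vx FF'; have JTu : (jacm x)^T \in unitmx by rewrite unitmx_tr jacm_unit.
rewrite -[nabmx g F x](mulKmx JTu) (nabmx_change Vx FF') mxtrace_mulC -mulmxA.
by rewrite mulmxV // mulmx1.
Qed.

Lemma tr_nabmx2_change F F' x : V x -> paired F F' ->
  \tr (nabmx g F x *m nabmx g F x) = \tr (nabmx g' F' (tau x) *m nabmx g' F' (tau x)).
Proof.
move=> Vx FF'; have JTu : (jacm x)^T \in unitmx by rewrite unitmx_tr jacm_unit.
have E : (jacm x)^T *m (nabmx g F x *m nabmx g F x) =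
    nabmx g' F' (tau x) *m nabmx g' F' (tau x) *m (jacm x)^T.
  by rewrite mulmxA (nabmx_change Vx FF') -mulmxA (nabmx_change Vx FF') mulmxA.
by rewrite -[nabmx g F x *m _](mulKmx JTu) E mxtrace_mulC (mulmxK JTu).
Qed.

End ChangeOfCoordinates.

(** * Divergence in terms of Laplacians and brackets *)

Section Scalars.
Context {R : realType} {d : nat}.
Variables (D V : set 'rV[R]_d) (g : 'rV[R]_d -> 'M[R]_d).
Hypothesis C : chart_metric D V g.
Implicit Types (F : 'rV[R]_d -> R) (x : 'rV[R]_d).

Lemma nab_nabmx F l i x : smoothV D V F -> V x ->
  nab D g F l i x = nabmx D g F x i l.
Proof.
move=> sF Vx; rewrite (nabE C) // mxE; apply: eq_bigr => j _.
by rewrite (chessC C) // /hs.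
Qed.

Lemma tr_nabmx F x : smoothV D V F -> V x ->
  \sum_i nab D g F i i x = \tr (nabmx D g F x).
Proof. by move=> sF Vx; apply: eq_bigr => i _; rewrite nab_nabmx. Qed.

Lemma gnorm2_nabmx F x : smoothV D V F -> V x ->
  gnorm2 g x (chess D g F x) = \tr (nabmx D g F x *m nabmx D g F x).
Proof.
move=> sF Vx; rewrite (gnorm2_chess C) //; apply: eq_bigr => i _.
rewrite mxE; apply: eq_bigr => l _.
by rewrite !nab_nabmx // mulrC.
Qed.

Lemma hessgrad_nabmx F i x : smoothV D V F -> V x ->
  hessgrad D g F i x = (nabmx D g F x *m gcol D g F x) i 0.
Proof.
move=> sF Vx; rewrite mxE; apply: eq_bigr => l _.
by rewrite nab_nabmx // [gcol _ _ _ _ _ _]mxE.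
Qed.

(** Symmetry of the Hessian: both terms of [pd_gam] coincide when the two functions are equal. *)
Lemma hessgrad_gam F i x : smoothV D V F -> V x ->
  hessgrad D g F i x = 2^-1 * gradc D g (gam D g F F) i x.
Proof.
move=> sF Vx; rewrite /hessgrad /gradc mulr_sumr.
under eq_bigr do rewrite (nabE C) // mulr_suml.
rewrite exchange_big /=; apply: eq_bigr => l _.
rewrite (pd_gam C) // mulrCA mulr_sumr mulr_sumr; apply: eq_bigr => k _.
by rewrite (chessC C k l sF Vx) /gradc; gensum; field.
Qed.

Lemma div_hessgrad F x : smoothV D V F -> V x ->
  divv D g (hessgrad D g F) x = 2^-1 * \tr (nabmx D g (gam D g F F) x).
Proof.
move=> sF Vx; have sG := smooth_gam C sF sF.
have -> : divv D g (hessgrad D g F) x =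
   divv D g (fun i y => 2^-1 * gradc D g (gam D g F F) i y) x.
  apply: eq_bigr => i _; congr (_ + _).
    by apply: (eq_pdV C) => // y Vy; exact: hessgrad_gam.
  by apply: eq_bigr => m _; rewrite hessgrad_gam.
rewrite (divvM C) //; last 2 first.
- exact: germ_cst.
- by move=> i; exact: (smooth_gradc C).
rewrite [X in _ + X]big1 ?addr0.
  by rewrite -tr_nabmx.
by move=> i _; rewrite (pd_cst (cm_model C) (cm_sub C Vx)) mulr0.
Qed.

(** Every term on the right has a known change of charts, which replaces a transformation law for
    [divv]. *)
Lemma div_reilly_gam h f x : smoothV D V h -> smoothV D V f -> V x ->
  divv D g (reilly D g h f) x =
  lap_h D g h f x * \tr (nabmx D g f x) + gam D g f (lap_h D g h f) x
  - 2^-1 * \tr (nabmx D g (gam D g f f) x).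
Proof.
move=> sh sf Vx.
have sL := smooth_lap_h C sh sf.
rewrite (divvB C) //; last 2 first.
- by move=> i; apply: germM; [exact: sL|exact: (smooth_gradc C)].
- by move=> i; exact: (smooth_hessgrad C).
rewrite (divvM C) //; last 2 first.
- exact: sL.
- by move=> i; exact: (smooth_gradc C).
have <- : divv D g (gradc D g f) x = \tr (nabmx D g f x) by rewrite -tr_nabmx.
by rewrite div_hessgrad.
Qed.

Definition rcol h f x : 'cV[R]_d := \col_i reilly D g h f i x.

Lemma rcolE h f x : smoothV D V f -> V x ->
  rcol h f x = lap_h D g h f x *: gcol D g f x - nabmx D g f x *m gcol D g f x.
Proof.
move=> sf Vx; apply/colP => i; rewrite [LHS]mxE [RHS]mxE [X in _ = X + _]mxE.
by rewrite [X in _ = _ * X + _]mxE [X in _ = _ + X]mxE -hessgrad_nabmx.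
Qed.

End Scalars.

Section ScalarsChange.
Context {R : realType} {d : nat}.
Variables (D V V' : set 'rV[R]_d) (g g' : 'rV[R]_d -> 'M[R]_d).
Hypotheses (C : chart_metric D V g) (C' : chart_metric D V' g').
Variable tau : 'rV[R]_d -> 'rV[R]_d.
Hypothesis tauV : forall x, V x -> V' (tau x).
Hypothesis tau_smooth : forall c, smoothV D V (fun x => tau x 0 c).
Local Notation J := (jacm D tau).
Hypothesis g_compat : forall x, V x -> g x = J x *m g' (tau x) *m (J x)^T.
Implicit Types (x : 'rV[R]_d).
Variables (h f h' f' : 'rV[R]_d -> R).
Hypotheses (hh' : paired D V V' tau h h') (ff' : paired D V V' tau f f').

Lemma lap_h_change x : V x -> lap_h D g h f x = lap_h D g' h' f' (tau x).
Proof.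
move=> Vx; have [sf sf' _] := ff'.
have gE : \sum_l pd D l h x * gradc D g f l x = gam D g f h x.
  by apply: eq_bigr => l _; rewrite mulrC.
have gE' : \sum_l pd D l h' (tau x) * gradc D g' f' l (tau x) = gam D g' f' h' (tau x).
  by apply: eq_bigr => l _; rewrite mulrC.
rewrite /lap_h gE gE' (gam_change C C' tauV tau_smooth g_compat Vx ff' hh').
rewrite (tr_nabmx C sf Vx) (tr_nabmx C' sf' (tauV Vx)).
by rewrite (tr_nabmx_change C C' tauV tau_smooth g_compat Vx ff').
Qed.

Lemma paired_lap_h : paired D V V' tau (lap_h D g h f) (lap_h D g' h' f').
Proof.
have [sf sf' _] := ff'; have [sh sh' _] := hh'; split.
- exact: (smooth_lap_h C).
- exact: (smooth_lap_h C').
- exact: lap_h_change.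
Qed.

Lemma gnorm2_change x : V x ->
  gnorm2 g x (chess D g f x) = gnorm2 g' (tau x) (chess D g' f' (tau x)).
Proof.
move=> Vx; have [sf sf' _] := ff'.
rewrite (gnorm2_nabmx C sf Vx) (gnorm2_nabmx C' sf' (tauV Vx)).
exact: (tr_nabmx2_change C C' tauV tau_smooth g_compat Vx ff').
Qed.

Lemma rcol_change x : V x -> (J x)^T *m rcol D g h f x = rcol D g' h' f' (tau x).
Proof.
move=> Vx; have [sf sf' fE] := ff'; have V'x := tauV Vx.
rewrite (rcolE C h sf Vx) (rcolE C' h' sf' V'x) mulmxBr -scalemxAr mulmxA.
rewrite (nabmx_change C C' tauV tau_smooth g_compat Vx ff') -mulmxA.
rewrite (gcol_change C C' tauV tau_smooth g_compat Vx (sf' 1%N _ V'x) fE).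
by rewrite lap_h_change.
Qed.

Lemma reilly_apply_change K K' x : V x -> germ 1 D K' (tau x) ->
  (forall y, V y -> K y = K' (tau y)) ->
  \sum_i reilly D g h f i x * pd D i K x =
  \sum_i reilly D g' h' f' i (tau x) * pd D i K' (tau x).
Proof.
move=> Vx CK' KK'.
have := vec_change C C' tauV tau_smooth Vx CK' KK' (rcol_change Vx).
by under eq_bigr do rewrite mxE; under [X in _ = X -> _]eq_bigr do rewrite mxE.
Qed.

Lemma div_reilly_change x : V x ->
  divv D g (reilly D g h f) x - \sum_i pd D i h x * reilly D g h f i x =
  divv D g' (reilly D g' h' f') (tau x)
  - \sum_i pd D i h' (tau x) * reilly D g' h' f' i (tau x).
Proof.
move=> Vx; have [sf sf' fE] := ff'; have [sh sh' hE] := hh'; have V'x := tauV Vx.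
congr (_ - _); last first.
  have := reilly_apply_change Vx (sh' 1%N _ V'x) hE.
  by under eq_bigr do rewrite mulrC; under [X in _ = X -> _]eq_bigr do rewrite mulrC.
rewrite (div_reilly_gam C sh sf Vx) (div_reilly_gam C' sh' sf' V'x).
have E1 := lap_h_change Vx.
have E2 := tr_nabmx_change C C' tauV tau_smooth g_compat Vx ff'.
have E3 := gam_change C C' tauV tau_smooth g_compat Vx ff' paired_lap_h.
have Pg := paired_gam C C' tauV tau_smooth g_compat ff' ff'.
have E4 := tr_nabmx_change C C' tauV tau_smooth g_compat Vx Pg.
by rewrite E1 E2 E3 E4.
Qed.

End ScalarsChange.

(** * Transition maps at the boundary *)

Section BoundaryChange.
Context {R : realType} {n : nat}.
Local Notation hs0 := (@halfspace R n).
Variables (V V' : set 'rV[R]_n.+1) (g g' : 'rV[R]_n.+1 -> 'M[R]_n.+1).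
Hypotheses (C : chart_metric hs0 V g) (C' : chart_metric hs0 V' g').
Hypotheses (g00 : forall x, V x -> 0 < ginv g x 0 0)
           (g'00 : forall x, V' x -> 0 < ginv g' x 0 0).
Variable tau : 'rV[R]_n.+1 -> 'rV[R]_n.+1.
Hypothesis tauV : forall x, V x -> V' (tau x).
Hypothesis tau_smooth : forall c, smoothV hs0 V (fun x => tau x 0 c).
Local Notation J := (jacm hs0 tau).
Hypothesis g_compat : forall x, V x -> g x = J x *m g' (tau x) *m (J x)^T.
Implicit Types (x : 'rV[R]_n.+1).

Lemma bemb_bproj x : x 0 0 = 0 -> bemb (bproj x) = x.
Proof.
move=> x0; apply/rowP => i; case: (unliftP ord0 i) => [a ->|->].
  by rewrite bembS /bproj mxE rshift1_lift.
by rewrite bemb0.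
Qed.

(** Fermat's argument on one side. It serves with [eps = 1] and positive times, and with [eps = -1]
    and negative times. *)
Lemma derive_side_ge0 (G : 'rV[R]_n.+1 -> R) x v (eps : R) (S : set R) :
  ProperFilter (within S 0^') -> derivable G x v -> G x = 0 ->
  (\forall t \near 0^', S t -> 0 <= eps * t) ->
  (\forall t \near 0^', S t -> 0 <= G (x + t *: v)) ->
  0 <= eps * 'D_v G x.
Proof.
move=> PS dG Gx0 epst G0.
have /cvg_within_filter-/(_ S) cv := dG.
have ceps : (fun t : R => eps * (t^-1 *: ((G \o shift x) (t *: v) - G x))) @ within S 0^'
    --> eps * 'D_v G x by apply: cvgMr.
rewrite -(cvg_lim (@Rhausdorff R) ceps); apply: limr_ge.
  by apply/cvg_ex; exists (eps * 'D_v G x).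
rewrite near_withinE.
have tn0 : \forall t \near 0^', t != 0 :> R by exact: nbhs_dnbhs_neq.
near=> t => St.
have t0 : t != 0 by near: t.
have et : 0 <= eps * t by move: St; near: t.
have Gt : 0 <= G (x + t *: v) by move: St; near: t.
rewrite /= Gx0 subr0 addrC /GRing.scale /= mulrA mulr_ge0 //.
have -> : eps / t = eps * t * (t^-1) ^+ 2 by field.
by rewrite mulr_ge0 // sqr_ge0.
Unshelve. all: by end_near. Qed.

Lemma within_pos_proper : ProperFilter (within [set t : R | 0 < t] 0^').
Proof.
apply: Build_ProperFilter_ex => A /nbhs_ballP[r /= r0 rA].
exists (r / 2); apply: rA => /=.
- by rewrite -ball_normE /ball_ /= sub0r normrN gtr0_norm ?divr_gt0//; lra.
- by rewrite gt_eqF// divr_gt0.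
- by rewrite divr_gt0.
Qed.

Lemma within_neg_proper : ProperFilter (within [set t : R | t < 0] 0^').
Proof.
apply: Build_ProperFilter_ex => A /nbhs_ballP[r /= r0 rA].
exists (- (r / 2)); apply: rA => /=.
- by rewrite -ball_normE /ball_ /= sub0r opprK gtr0_norm ?divr_gt0//; lra.
- by rewrite lt_eqF// oppr_lt0 divr_gt0.
- by rewrite oppr_lt0 divr_gt0.
Qed.

Lemma near_line (P : set 'rV[R]_n.+1) x v : (\forall y \near x, P y) ->
  \forall t \near (0 : R)^', P (x + t *: v).
Proof.
move=> Px; apply: cvg_within.
have := @continuous_line R n.+1 x v 0; rewrite /continuous_at scale0r addr0.
by apply.
Qed.

Section MinimumOnHalfspace.
Variables (F : 'rV[R]_n.+1 -> R) (x : 'rV[R]_n.+1).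
Hypotheses (Dx : hs0 x) (CF : germ 1 hs0 F x) (Fx0 : F x = 0).
Hypothesis F0 : \forall y \near x, hs0 y -> 0 <= F y.

Lemma pd_ge0 k : 0 <= pd hs0 k F x.
Proof.
have [G [dG <-] FG] := germ1_is_derive (@model_halfspace R n) Dx k CF.
rewrite -[leRHS]mul1r.
apply: (@derive_side_ge0 G x _ 1 _ within_pos_proper) => //.
- by rewrite -(nbhs_singleton FG).
- by near=> t => /= t0; rewrite mul1r ltW.
- have := near_line (delta_mx 0 k) FG; have := near_line (delta_mx 0 k) F0.
  apply: filterS2 => t F0t FGt /= t0.
  have Dt : hs0 (x + t *: delta_mx 0 k) by apply: model_halfspace => //; exact: ltW.
  by rewrite -FGt // F0t.
Unshelve. all: by end_near. Qed.

Lemma pd_interior_min k : 0 < x 0 0 -> pd hs0 k F x = 0.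
Proof.
move=> x0; apply/eqP; rewrite eq_le pd_ge0 andbT.
have [G [dG <-] FG] := germ1_is_derive (@model_halfspace R n) Dx k CF.
rewrite -oppr_ge0 -mulN1r.
have nD : \forall y \near x, hs0 y.
  have /cvgr_gt/(_ 0 x0) H := @coord_continuous R 1 n.+1 0 0 x.
  by apply: filterS H => y; exact: ltW.
apply: (@derive_side_ge0 G x _ (-1) _ within_neg_proper) => //.
- by rewrite -(nbhs_singleton FG).
- by near=> t => /= t0; rewrite mulN1r oppr_ge0 ltW.
- have := near_line (delta_mx 0 k) nD; have := near_line (delta_mx 0 k) FG.
  have := near_line (delta_mx 0 k) F0.
  by apply: filterS3 => t F0t FGt Dt /= t0; rewrite -FGt // F0t.
Unshelve. all: by end_near. Qed.

End MinimumOnHalfspace.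

Let Vhs x : V x -> hs0 x := cm_sub C (t := x).

Lemma tau0_ge0 x : V x -> \forall y \near x, hs0 y -> 0 <= tau y 0 0.
Proof.
move=> Vx; apply: filterS (cm_open C Vx) => y Vy /Vy/tauV V't.
exact: (cm_sub C' V't).
Qed.

(* If an interior point went to the boundary, tau_0 would have a minimum there
   and its Jacobian would be singular. *)
Lemma interior_to_interior x : V x -> tau x 0 0 = 0 -> x 0 0 = 0.
Proof.
move=> Vx t0; have Dx := Vhs Vx.
apply/eqP; move: (Dx); rewrite /halfspace /= le_eqVlt eq_sym => /orP[//|x0].
have Ju := jacm_unit C g_compat Vx.
have J0 : J x *m delta_mx 0 0 = 0 :> 'cV[R]_n.+1.
  apply/colP => a; rewrite -colE !mxE.
  by apply: pd_interior_min => //; [exact: tau_smooth|exact: tau0_ge0].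
have : delta_mx 0 0 = 0 :> 'cV[R]_n.+1 by rewrite -[LHS](mulKmx Ju) J0 mulmx0.
by move/colP/(_ 0); rewrite !mxE eqxx => /eqP; rewrite oner_eq0.
Qed.

Hypothesis tau_bd : forall x, V x -> x 0 0 = 0 -> tau x 0 0 = 0.

(** [tau_0] vanishes on the boundary near [x], and a tangential derivative sees boundary points only
    ([pd_bemb]). *)
Lemma J_tangential x a : V x -> x 0 0 = 0 -> J x (lift ord0 a) 0 = 0.
Proof.
move=> Vx x0; rewrite mxE -{1}(bemb_bproj x0) -pd_bemb.
rewrite -[RHS](pd_cst (@model_setT R n) (x := bproj x) I a 0).
apply: eq_pd => //.
have cb := @continuous_bemb R n (bproj x).
have H : \forall y \near bproj x, hs0 (bemb y) -> V (bemb y).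
  have Hx : nbhs (bemb (bproj x)) [set z | hs0 z -> V z].
    by rewrite bemb_bproj //; exact: (cm_open C Vx).
  exact: (cb _ Hx).
apply: filterS H => y Hy _; apply: tau_bd; last exact: bemb0.
by apply: Hy; exact: halfspace_bemb.
Unshelve. all: by end_near. Qed.

Lemma J_delta0 x : V x -> x 0 0 = 0 ->
  J x *m delta_mx 0 0 = J x 0 0 *: delta_mx 0 0 :> 'cV[R]_n.+1.
Proof.
move=> Vx x0; rewrite -colE; apply/colP => i; rewrite [LHS]mxE [RHS]mxE [X in _ = _ * X]mxE.
case: (unliftP ord0 i) => [a ->|->]; last by rewrite eqxx mulr1.
by rewrite J_tangential // mulr0.
Qed.

(** Nonnegative because [tau_0] vanishes at [x] and is nonnegative near it; nonzero because
    otherwise the whole column 0 of the invertible Jacobian would vanish. *)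
Lemma J00_gt0 x : V x -> x 0 0 = 0 -> 0 < J x 0 0.
Proof.
move=> Vx x0; rewrite lt_neqAle; apply/andP; split; last first.
  rewrite mxE; apply: pd_ge0; first exact: Vhs.
  - exact: tau_smooth.
  - exact: tau_bd.
  - exact: tau0_ge0.
apply/eqP => J0.
have Ju := jacm_unit C g_compat Vx.
have : delta_mx 0 0 = 0 :> 'cV[R]_n.+1.
  by rewrite -[LHS](mulKmx Ju) J_delta0 // -J0 scale0r mulmx0.
by move/colP/(_ 0); rewrite !mxE eqxx => /eqP; rewrite oner_eq0.
Qed.

Definition ncol (m : 'rV[R]_n.+1 -> 'M[R]_n.+1) x : 'cV[R]_n.+1 := \col_k nu m k x.

Lemma ncolE m x (sym : forall i, ginv m x 0 i = ginv m x i 0) :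
  ncol m x = - (Num.sqrt (ginv m x 0 0))^-1 *: (ginv m x *m delta_mx 0 0).
Proof. by rewrite -colE; apply/colP => k; rewrite [LHS]mxE nuE (sym k) [RHS]mxE [in RHS]mxE. Qed.

(** At the boundary [dx_0] is only rescaled, by [J00]. This factor cancels against the one in
    [sqrt g^00], and its positivity keeps the normal outward. *)
Lemma ncol_change x : V x -> x 0 0 = 0 -> (J x)^T *m ncol g x = ncol g' (tau x).
Proof.
move=> Vx x0; have V'x := tauV Vx; have j0 := J00_gt0 Vx x0.
have E : (J x)^T *m ginv g x *m delta_mx 0 0 =
    (J x 0 0)^-1 *: (ginv g' (tau x) *m delta_mx 0 0) :> 'cV[R]_n.+1.
  rewrite -(ginv_change C C' tauV g_compat Vx) -[in RHS]mulmxA J_delta0 // -scalemxAr.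
  by rewrite scalerA mulVf ?scale1r // gt_eqF.
have E00 : ginv g' (tau x) 0 0 = J x 0 0 ^+ 2 * ginv g x 0 0.
  have := congr1 (fun A : 'cV[R]_n.+1 => A 0 0) E.
  rewrite -mulmxA -!colE [LHS]mxE [RHS]mxE [col _ _ _ _ in RHS]mxE.
  rewrite big_ord_recl big1 ?addr0 => [|k _]; last by rewrite mxE J_tangential // mul0r.
  rewrite [_^T _ _]mxE [col _ _ _ _]mxE => E00.
  by rewrite expr2 -mulrA E00 mulrA mulfV ?mul1r // gt_eqF.
rewrite (ncolE (fun i => ginvC C 0 i Vx)) (ncolE (fun i => ginvC C' 0 i V'x)).
rewrite -scalemxAr mulmxA E scalerA E00 sqrtrM ?sqr_ge0 // sqrtr_sqr gtr0_norm //.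
by rewrite invfM mulNr mulrC.
Qed.

Variables (h f h' f' : 'rV[R]_n.+1 -> R).
Hypotheses (hh' : paired hs0 V V' tau h h') (ff' : paired hs0 V V' tau f f').

Lemma fnu_col m F x : fnu m F x = ((ncol m x)^T *m dcol hs0 F x) 0 0.
Proof. by rewrite !mxE; apply: eq_bigr => a _; rewrite !mxE mulrC. Qed.

Lemma fnu_change x : V x -> x 0 0 = 0 -> fnu g f x = fnu g' f' (tau x).
Proof.
move=> Vx x0; have [_ sf' fE] := ff'.
rewrite !fnu_col (dcol_change C C' tauV tau_smooth Vx (sf' 1%N _ (tauV Vx)) fE).
by rewrite -ncol_change // trmx_mul trmxK mulmxA.
Qed.

Lemma quad_col (H : 'M[R]_n.+1) (u v : 'I_n.+1 -> R) :
  \sum_i \sum_j u i * H i j * v j = ((\col_i u i)^T *m H *m \col_j v j) 0 0.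
Proof.
rewrite [RHS]mxE exchange_big /=; apply: eq_bigr => j _.
rewrite [X in _ = X * _]mxE [X in _ = _ * X]mxE mulr_suml.
by apply: eq_bigr => i _; rewrite [X in _ = X * _ * _]mxE [X in _ = X * _ * _]mxE.
Qed.

Lemma hsnn_bd_change x : V x -> x 0 0 = 0 ->
  \sum_i \sum_j nu g i x * hs hs0 g f i j x * nu g j x =
  \sum_i \sum_j nu g' i (tau x) * hs hs0 g' f' i j (tau x) * nu g' j (tau x).
Proof.
move=> Vx x0.
rewrite (quad_col (chess hs0 g f x) (fun i => nu g i x) (fun i => nu g i x)).
rewrite (quad_col (chess hs0 g' f' (tau x)) (fun i => nu g' i (tau x)) (fun i => nu g' i (tau x))).
rewrite -/(ncol g x) -/(ncol g' (tau x)) -ncol_change //.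
rewrite (chess_change C C' tauV tau_smooth g_compat Vx ff').
by rewrite trmx_mul trmxK !mulmxA.
Qed.

(* Both sides are [<Z, nu>], as the left-hand side is [- Z^0 / sqrt g^00]. *)
Lemma reilly_normal_change x : V x -> x 0 0 = 0 ->
  - (Num.sqrt (ginv g x 0 0))^-1 * reilly hs0 g h f 0 x =
  - (Num.sqrt (ginv g' (tau x) 0 0))^-1 * reilly hs0 g' h' f' 0 (tau x).
Proof.
move=> Vx x0; have V'x := tauV Vx.
have t0 := tau_bd Vx x0.
have [sf sf' fE] := ff'; have [sh sh' hE] := hh'.
have Vb : V (bemb (bproj x)) by rewrite bemb_bproj.
have V'b : V' (bemb (bproj (tau x))) by rewrite bemb_bproj.
have := reilly_normal C g00 Vb h sf; rewrite bemb_bproj // => -> //.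
have := reilly_normal C' g'00 V'b h' sf'; rewrite bemb_bproj // => -> //.
have E1 := lap_h_change C C' tauV tau_smooth g_compat hh' ff' Vx.
rewrite E1 fnu_change //; congr (_ - _).
rewrite (quad_col (chess hs0 g f x) (fun i => gradc hs0 g f i x) (fun i => nu g i x)).
rewrite (quad_col (chess hs0 g' f' (tau x)) (fun i => gradc hs0 g' f' i (tau x)) (fun i => nu g' i (tau x))).
rewrite -/(ncol g x) -/(ncol g' (tau x)) -/(gcol hs0 g f x) -/(gcol hs0 g' f' (tau x)).
rewrite -ncol_change // -(gcol_change C C' tauV tau_smooth g_compat Vx (sf' 1%N _ V'x) fE).
rewrite (chess_change C C' tauV tau_smooth g_compat Vx ff').
by rewrite trmx_mul trmxK !mulmxA.
Qed.

End BoundaryChange.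

(** * Charts of a manifold *)

Section PosDef.
Context {R : realType} {n : nat}.
Implicit Type A : 'M[R]_n.+1.

(* The segment from the identity to A stays in the invertible matrices. *)
Lemma posdef_det_gt0 A : posdef A -> 0 < \det A.
Proof.
move=> Apos; have Au := posdef_unit Apos.
rewrite lt_neqAle eq_sym -unitfE -unitmxE Au /= leNgt; apply/negP => dA.
(* The segment [(1 - t) I + t A] as a polynomial matrix: its determinant is 1 at 0 and negative at
   1, so it has a root, where a positive definite matrix would be singular. *)
pose P : 'M[{poly R}]_n.+1 := map_mx polyC 1%:M + 'X *: map_mx polyC (A - 1%:M).
have PE t : (\det P).[t] = \det (1%:M + t *: (A - 1%:M)).
  rewrite -horner_evalE -det_map_mx; congr (\det _); apply/matrixP => i j.
  by rewrite /P !mxE /= /horner_eval !hornerE.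
have [||t t01 /rootP] := @poly_ivt R (- \det P) 0 1; rewrite ?ler01 //.
  by rewrite !hornerN !PE scale0r addr0 det1 scale1r addrCA subrr addr0 oppr_le0 ler01 oppr_ge0 ltW.
rewrite hornerN PE => /eqP; rewrite oppr_eq0 => dt.
have [t0 t1] : 0 <= t /\ t <= 1 by case/andP: t01.
suff /posdef_unit : posdef (1%:M + t *: (A - 1%:M)).
  by rewrite unitmxE unitfE => /negP; apply.
have [As Ap] := Apos.
split; first by rewrite linearD linearZ /= linearB /= trmx1 As.
move=> v v0.
have -> : bilin (1%:M + t *: (A - 1%:M)) v v =
    (1 - t) * bilin 1%:M v v + t * bilin A v v.
  rewrite /bilin mulmxDr mulmxDl -scalemxAr -scalemxAl mulmxBr mulmxBl.
  by rewrite [LHS]mxE [X in _ + X]mxE [X in _ + _ * X]mxE [X in _ + _ * (_ + X)]mxE; ring.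
have b1 : 0 < bilin 1%:M v v.
  rewrite /bilin mulmx1 mxE lt_neqAle eq_sym; apply/andP; split.
    apply: contra v0 => /eqP E; apply/eqP/rowP => i; rewrite mxE.
    have Q (k : 'I_n.+1) : true -> 0 <= v 0 k * v^T k 0 by rewrite mxE -expr2 sqr_ge0.
    have : v 0 i * v^T i 0 = 0 by apply: (psumr_eq0P Q E).
    by rewrite mxE => /eqP; rewrite mulf_eq0 orbb => /eqP.
  by apply: sumr_ge0 => k _; rewrite mxE -expr2 sqr_ge0.
have bA := Ap v v0.
case: (ltrP t 1) => t1'.
  by rewrite ltr_pwDl // ?mulr_gt0 ?subr_gt0 // mulr_ge0 // ltW.
have -> : t = 1 by apply/eqP; rewrite eq_le t1 t1'.
by rewrite subrr mul0r add0r mul1r.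
Qed.

(** If [g^00] were not positive, its square root would be 0, with inverse 0, and the normal would
    vanish, against the sign given by [outward_normal_spec]. *)
Lemma posdef_ginv00 (g : 'rV[R]_n.+1 -> 'M[R]_n.+1) x : posdef (g x) ->
  0 < ginv g x 0 0.
Proof.
move=> gpos; have [n1 _ n0] := outward_normal_spec gpos.
rewrite lt_neqAle eq_sym; apply/andP; split.
  apply: contraTN n0 => /eqP E.
  by rewrite /outward_normal !mxE E sqrtr0 invr0 oppr0 mul0r ltxx.
rewrite leNgt; apply/negP => g00; move: n0.
by rewrite /outward_normal !mxE ler0_sqrtr ?ltW // invr0 oppr0 mul0r ltxx.
Qed.

End PosDef.

Section Charts.
Context {R : realType} {n : nat} (M : manifold R n) (g : riemannian_metric M).
Local Notation hs0 := (@halfspace R n).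
Implicit Types (i j : chart_index M) (p q : M) (x y : 'rV[R]_n.+1) (f h : M -> R).

Definition chart_image i : set 'rV[R]_n.+1 := chart i @` chart_dom i.
Local Notation V i := (chart_image i).

Lemma chart_imageP i p : chart_dom i p -> V i (chart i p).
Proof. by move=> ip; exists p. Qed.

Lemma chart_inv_dom i x : V i x -> chart_dom i (chart_inv i x).
Proof. by move=> [p ip <-]; rewrite chartK. Qed.

Lemma chart_invK i x : V i x -> chart i (chart_inv i x) = x.
Proof. by move=> [p ip <-]; rewrite chartK. Qed.

Lemma chart_image_sub i : V i `<=` hs0.
Proof. by move=> x; have [W _ WE] := chart_image_open i; rewrite /chart_image WE => -[]. Qed.

Lemma chart_image_near i x : V i x -> \forall y \near x, hs0 y -> V i y.
Proof.
have [W Wo WE] := chart_image_open i; rewrite /chart_image WE => -[Wx _].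
by apply: filterS (near_open Wo Wx).
Qed.

Lemma chart_inv_cvg i x : V i x ->
  chart_inv i y @[y --> within (V i) (nbhs x)] --> chart_inv i x.
Proof. by move=> Vx; have /subspace_continuousP := @chart_inv_continuous _ _ M i; apply. Qed.

Lemma chart_inv_near i x (A : set M) : V i x -> nbhs (chart_inv i x) A ->
  \forall y \near x, hs0 y -> V i y /\ A (chart_inv i y).
Proof.
move=> Vx nA; have V' := chart_image_near Vx.
have H : \forall y \near x, V i y -> A (chart_inv i y) := chart_inv_cvg Vx nA.
near=> y => Dy; have Vy : V i y by move: Dy; near: y.
by split=> //; move: Vy; near: y.
Unshelve. all: by end_near. Qed.

Lemma chart_cvg i p : chart_dom i p -> chart i q @[q --> p] --> chart i p.
Proof.
move=> ip; have /subspace_continuousP/(_ p ip) H := @chart_continuous _ _ M i.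
have io : nbhs p (chart_dom i) by apply: open_nbhs_nbhs; split=> //; exact: chart_dom_open.
move=> A /H HA.
have HA' : \forall q \near p, chart_dom i q -> A (chart i q) := HA.
have HB : \forall q \near p, A (chart i q).
  near=> q; have iq : chart_dom i q by near: q; exact: io.
  by move: iq; near: q.
exact: HB.
Unshelve. all: by end_near. Qed.

Lemma smooth_within_germ k (V' : set 'rV[R]_n.+1) F x :
  (\forall y \near x, hs0 y -> V' y) -> V' x -> smooth_within V' F -> germ k hs0 F x.
Proof.
move=> nV Vx sF; have [W [G [Wo Wx sG FG]]] := sF x Vx.
apply: (@germ_ext _ _ _ k G); first last.
  by exists W, G; split=> //; exact: sG.
by apply: filterS2 nV (near_open Wo Wx) => y Vy Wy Dy; rewrite FG //; exact: Vy.
Qed.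

Lemma chart_posdef i x : V i x -> posdef (g i x).
Proof. by move=> [p ip <-]; exact: metric_posdef. Qed.

Lemma chart_ginv00 i x : V i x -> 0 < ginv (g i) x 0 0.
Proof. by move=> /chart_posdef; exact: posdef_ginv00. Qed.

Lemma chart_metric_sub (V1 V2 : set 'rV[R]_n.+1) m : V1 `<=` V2 ->
  (forall x, V1 x -> \forall y \near x, hs0 y -> V1 y) ->
  chart_metric hs0 V2 m -> chart_metric hs0 V1 m.
Proof.
move=> V12 oV1 [mD VD Vo sm sy de]; split=> //.
- by move=> x /V12/VD.
- by move=> a b k x /V12; exact: sm.
- by move=> x /V12/sy.
- by move=> x /V12/de.
Qed.

Lemma chart_metricP i : chart_metric hs0 (V i) (g i).
Proof.
split.
- exact: model_halfspace.
- exact: chart_image_sub.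
- exact: chart_image_near.
- move=> a b k x Vx; apply: smooth_within_germ (chart_image_near Vx) Vx _.
  exact: metric_smooth.
- by move=> x /chart_posdef[].
- by move=> x /chart_posdef; exact: posdef_det_gt0.
Qed.

Lemma smooth_funP f i : smooth_fun f -> smoothV hs0 (V i) (f \o chart_inv i).
Proof. by move=> sf k x Vx; apply: smooth_within_germ (chart_image_near Vx) Vx (sf i). Qed.

Definition overlap i j : set 'rV[R]_n.+1 := chart i @` (chart_dom i `&` chart_dom j).
Definition transition i j x : 'rV[R]_n.+1 := chart j (chart_inv i x).

Lemma overlap_sub i j : overlap i j `<=` V i.
Proof. by move=> x [p [ip _] <-]; exists p. Qed.

Lemma overlapP i j x : V i x -> chart_dom j (chart_inv i x) -> overlap i j x.
Proof. by move=> [p ip <-]; rewrite chartK // => jp; exists p. Qed.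

Lemma overlap_near i j x : overlap i j x -> \forall y \near x, hs0 y -> overlap i j y.
Proof.
move=> [p [ip jp] <-].
have nj : nbhs (chart_inv i (chart i p)) (chart_dom j).
  by rewrite chartK //; apply: open_nbhs_nbhs; split=> //; exact: chart_dom_open.
have := chart_inv_near (chart_imageP ip) nj.
by apply: filterS => y H /H[]; exact: overlapP.
Qed.

Lemma overlap_metric i j : chart_metric hs0 (overlap i j) (g i).
Proof.
apply: chart_metric_sub (chart_metricP i); first exact: overlap_sub.
by move=> x; exact: overlap_near.
Qed.

Lemma transition_overlap i j x : overlap i j x -> overlap j i (transition i j x).
Proof. by move=> [p [ip jp] <-]; rewrite /transition chartK //; exists p. Qed.

Lemma transitionK i j x : overlap i j x -> transition j i (transition i j x) = x.
Proof. by move=> [p [ip jp] <-]; rewrite /transition !chartK. Qed.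

Lemma transition_smoothV i j c :
  smoothV hs0 (overlap i j) (fun x => transition i j x 0 c).
Proof.
move=> k x ox; apply: smooth_within_germ (overlap_near ox) ox _.
exact: transition_smooth.
Qed.

Lemma metric_transition i j x : overlap i j x ->
  g i x = jacm hs0 (transition i j) x *m g j (transition i j x)
    *m (jacm hs0 (transition i j) x)^T.
Proof.
by move=> [p [ip jp] <-]; rewrite {2}/transition chartK // (metric_compat g ip jp).
Qed.

(** This is [interior_to_interior] for the inverse transition. *)
Lemma transition_boundary i j x : overlap i j x -> x 0 0 = 0 -> transition i j x 0 0 = 0.
Proof.
move=> ox x0.
apply: (interior_to_interior (overlap_metric j i) (overlap_metric i j)
  (@transition_overlap j i) (@transition_smoothV j i) (@metric_transition j i)).
  exact: transition_overlap.
by rewrite transitionK.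
Qed.

Lemma paired_funP f i j : smooth_fun f ->
  paired hs0 (overlap i j) (overlap j i) (transition i j) (f \o chart_inv i) (f \o chart_inv j).
Proof.
move=> sf; split.
- by move=> k x /overlap_sub; exact: smooth_funP.
- by move=> k x /overlap_sub; exact: smooth_funP.
- by move=> y [p [ip jp] <-]; rewrite /transition /= !chartK.
Qed.

(** Lets a quantity defined at each point through its preferred chart be computed in one fixed chart
    around that point. *)
Lemma chart_independent (T : chart_index M -> 'rV[R]_n.+1 -> R) i p :
  (forall i j x, overlap i j x -> T i x = T j (transition i j x)) ->
  chart_dom i p -> T (chart_at p) (Defs.coord p) = T i (chart i p).
Proof.
move=> TT ip; rewrite (TT _ i); last by exists p => //; split=> //; exact: chart_at_dom.
by rewrite /transition /Defs.coord chartK //; exact: chart_at_dom.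
Qed.

Lemma chart_independent_bd (T : chart_index M -> 'rV[R]_n.+1 -> R) i p :
  (forall i j x, overlap i j x -> x 0 0 = 0 -> T i x = T j (transition i j x)) ->
  chart_dom i p -> Defs.coord p 0 0 = 0 -> T (chart_at p) (Defs.coord p) = T i (chart i p).
Proof.
move=> TT ip p0; rewrite (TT _ i) //; last by exists p => //; split=> //; exact: chart_at_dom.
by rewrite /transition /Defs.coord chartK //; exact: chart_at_dom.
Qed.

Lemma boundary_chart i p : chart_dom i p -> boundary M p -> chart i p 0 0 = 0.
Proof.
move=> ip [j jp j0]; have := @transition_boundary j i (chart j p).
by rewrite /transition chartK // => -> //; exists p.
Qed.

Lemma boundary_coord0 p : boundary M p -> Defs.coord p 0 0 = 0.
Proof. by apply: boundary_chart; exact: chart_at_dom. Qed.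

End Charts.

(** * The integrands in an arbitrary chart *)

Section Pointwise.
Context {R : realType} {n : nat} (M : manifold R n) (g : riemannian_metric M).
Local Notation hs0 := (@halfspace R n).
Local Notation V i := (chart_image i).
Variables (h f : M -> R) (sh : smooth_fun h) (sf : smooth_fun f).
Implicit Types (i j : chart_index M) (p q : M) (x y : 'rV[R]_n.+1).

Let hc i := h \o chart_inv i.
Let fc i := f \o chart_inv i.

Definition lap_c i x : R := lap_h hs0 (g i) (hc i) (fc i) x.
Definition hess2_c i x : R := gnorm2 (g i) x (chess hs0 (g i) (fc i) x).
Definition reilly_c i k x : R := reilly hs0 (g i) (hc i) (fc i) k x.
Definition div_c i x : R :=
  divv hs0 (g i) (reilly_c i) x - \sum_k pd hs0 k (hc i) x * reilly_c i k x.
Definition nz_c i x : R := - (Num.sqrt (ginv (g i) x 0 0))^-1 * reilly_c i 0 x.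
Definition hnn_c i x : R :=
  \sum_k \sum_l nu (g i) k x * hs hs0 (g i) (fc i) k l x * nu (g i) l x.
Definition fnu_c i x : R := fnu (g i) (fc i) x.

Let C i := chart_metricP g i.
Let Co i j := overlap_metric g i j.
Let shc i : smoothV hs0 (V i) (hc i) := @smooth_funP R n M _ i sh.
Let sfc i : smoothV hs0 (V i) (fc i) := @smooth_funP R n M _ i sf.
Let hp i j := paired_funP i j sh.
Let fp i j := paired_funP i j sf.
Let tV i j := @transition_overlap R n M i j.
Let ts i j := @transition_smoothV R n M i j.
Let gt i j := @metric_transition R n M g i j.
Let o00 i j x (o : overlap i j x) := chart_ginv00 g (overlap_sub o).
Let tb i j x (o : overlap i j x) := @transition_boundary R n M g i j x o.

Lemma Vcoord p : V (chart_at p) (Defs.coord p).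
Proof. by apply: chart_imageP; exact: chart_at_dom. Qed.

Lemma drift_laplacian_chart i p : chart_dom i p ->
  drift_laplacian g h f p = lap_c i (chart i p).
Proof.
move=> ip; rewrite -(@chart_independent _ _ _ lap_c i p _ ip).
  exact: (drift_laplacianE (C _) (hc (chart_at p)) (@sfc _) (Vcoord p)).
by move=> a b x o; exact: (lap_h_change (Co a b) (Co b a) (@tV a b) (@ts a b) (@gt a b) (hp a b) (fp a b) o).
Qed.

Lemma hess_norm2_chart i p : chart_dom i p ->
  hess_norm2 g f p = hess2_c i (chart i p).
Proof.
move=> ip; rewrite -(@chart_independent _ _ _ hess2_c i p _ ip) //.
by move=> a b x o; exact: (gnorm2_change (Co a b) (Co b a) (@tV a b) (@ts a b) (@gt a b) (fp a b) o).
Qed.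

Lemma div_c_change i j x : overlap i j x -> div_c i x = div_c j (transition i j x).
Proof.
by move=> o; exact: (div_reilly_change (Co i j) (Co j i) (@tV i j) (@ts i j) (@gt i j) (hp i j) (fp i j) o).
Qed.

(** Bochner's formula in the preferred chart, solved for the curvature term; the three quantities
    that remain are chart independent. *)
Lemma ricci_term_chart i p : chart_dom i p ->
  bilin (bakry_emery_ricci g h p) (grad g f p) (grad g f p) =
  lap_c i (chart i p) ^+ 2 - hess2_c i (chart i p) - div_c i (chart i p).
Proof.
move=> ip; rewrite -(drift_laplacian_chart ip) -(hess_norm2_chart ip).
rewrite -(@chart_independent _ _ _ div_c i p div_c_change ip).
rewrite (drift_laplacian_chart (chart_at_dom p)) (hess_norm2_chart (chart_at_dom p)).
have E : div_c (chart_at p) (Defs.coord p) =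
   lap_c (chart_at p) (Defs.coord p) ^+ 2 - hess2_c (chart_at p) (Defs.coord p) -
   bilin (bakry_emery_ricci g h p) (grad g f p) (grad g f p).
  exact: (div_reillyE (C _) (@shc _) (@sfc _) (Vcoord p)).
by rewrite E opprB addrC subrK.
Qed.

Section BoundaryPoint.
Variables (p : M) (pb : boundary M p).
Let c := chart_at p.
Let y := boundary_coord p.

Let yE : bemb y = Defs.coord p.
Proof. by rewrite /y bemb_bproj //; exact: boundary_coord0. Qed.

Let Vy : V c (bemb y). Proof. by rewrite yE; exact: Vcoord. Qed.

Lemma fnu_at q : boundary M q ->
  normal_derivative g f q = fnu_c (chart_at q) (Defs.coord q).
Proof.
move=> qb; rewrite /normal_derivative /inner.
by rewrite (bilin_cgrad (C _) (fc (chart_at q)) _ (Vcoord q)).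
Qed.

Lemma fnu_chart i q : boundary M q -> chart_dom i q ->
  normal_derivative g f q = fnu_c i (chart i q).
Proof.
move=> qb iq; rewrite fnu_at //.
apply: (@chart_independent_bd _ _ _ fnu_c) => //; last exact: boundary_coord0.
move=> a b x o x0.
exact: (fnu_change (Co a b) (Co b a) (@tV a b) (@ts a b) (@gt a b) (@tb a b) (fp a b) o x0).
Qed.

Lemma bemb_near : \forall z \near y, boundary M (chart_inv c (bemb z)) /\
  V c (bemb z).
Proof.
have cb := @continuous_bemb R n y.
have H : \forall z \near y, hs0 (bemb z) -> V c (bemb z).
  exact: (cb _ (chart_image_near Vy)).
apply: filterS H => z Hz; have Vz := Hz (halfspace_bemb z); split=> //.
exists c; first exact: chart_inv_dom.
by rewrite chart_invK // bemb0.
Unshelve. all: by end_near. Qed.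

(** At nearby points [normal_derivative] is computed in their own preferred charts. It has to be
    brought to the chart of [p] before it can be differentiated there. *)
Lemma boundary_grad_fnu :
  boundary_grad g (normal_derivative g f) p =
  cgrad setT (induced_metric (g c)) (fun z => fnu (g c) (fc c) (bemb z)) y.
Proof.
apply/rowP => a; rewrite !mxE; apply: eq_bigr => b _; congr (_ * _).
apply: eq_pd => //; apply: filterS bemb_near => z [zb Vz] _.
rewrite /boundary_rep /rep /= (fnu_chart zb (chart_inv_dom Vz)).
by rewrite chart_invK.
Qed.

Lemma second_form_at (X Y : 'rV[R]_n) :
  second_form g p X Y = \sum_a \sum_b X 0 a * IIc (g c) a b (bemb y) * Y 0 b.
Proof. by rewrite /second_form /inner -yE (second_formE (g c)). Qed.

Lemma mean_curvature_at : mean_curvature g p =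
  gtrace (induced_metric (g c)) y (\matrix_(a, b) IIc (g c) a b (bemb y)).
Proof.
rewrite /mean_curvature; congr (gtrace _ _ _); apply/matrixP => a b.
rewrite [LHS]mxE [RHS]mxE second_form_at (bigD1 a) //= (bigD1 b) //= !mxE !eqxx /=.
rewrite mul1r mulr1 big1 ?addr0 => [|k /negbTE kb]; last by rewrite !mxE kb andbF mulr0.
rewrite big1 ?addr0 // => k /negbTE ka.
by rewrite big1 // => l _; rewrite !mxE ka andbF !mul0r.
Qed.

Lemma boundary_terms_at :
  (mean_curvature g p * normal_derivative g f p - inner g p (grad g h p) (grad g f p)
    + boundary_laplacian g f p) * normal_derivative g f p
  + (second_form g p (boundary_grad g f p) (boundary_grad g f p)
     - boundary_inner g p (boundary_grad g f p)
         (boundary_grad g (normal_derivative g f) p)) = nz_c c (Defs.coord p).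
Proof.
have E : normal_derivative g f p = fnu (g c) (fc c) (Defs.coord p) := fnu_at pb.
have := boundary_reilly (C c) (chart_ginv00 g (i := c)) Vy (hc c) (@sfc c).
by rewrite -mean_curvature_at -boundary_grad_fnu -second_form_at yE -E.
Qed.

Lemma boundary_term1_at :
  mean_curvature g p * normal_derivative g f p - inner g p (grad g h p) (grad g f p)
    + boundary_laplacian g f p = lap_c c (Defs.coord p) - hnn_c c (Defs.coord p).
Proof.
have E : normal_derivative g f p = fnu (g c) (fc c) (Defs.coord p) := fnu_at pb.
have := boundary_reilly1 (C c) (chart_ginv00 g (i := c)) Vy (hc c) (@sfc c).
by rewrite -mean_curvature_at /hsnn yE -E.
Qed.

End BoundaryPoint.

Lemma boundary_terms_chart i p : boundary M p -> chart_dom i p ->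
  (mean_curvature g p * normal_derivative g f p - inner g p (grad g h p) (grad g f p)
    + boundary_laplacian g f p) * normal_derivative g f p
  + (second_form g p (boundary_grad g f p) (boundary_grad g f p)
     - boundary_inner g p (boundary_grad g f p)
         (boundary_grad g (normal_derivative g f) p)) = nz_c i (chart i p).
Proof.
move=> pb ip; rewrite boundary_terms_at //.
apply: (@chart_independent_bd _ _ _ nz_c) => //; last exact: boundary_coord0.
move=> a b x o x0.
exact: (reilly_normal_change (Co a b) (Co b a) (@o00 a b) (@o00 b a) (@tV a b)
  (@ts a b) (@gt a b) (@tb a b) (hp a b) (fp a b) o x0).
Qed.

Lemma boundary_term1_chart i p : boundary M p -> chart_dom i p ->
  mean_curvature g p * normal_derivative g f p - inner g p (grad g h p) (grad g f p)
    + boundary_laplacian g f p = lap_c i (chart i p) - hnn_c i (chart i p).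
Proof.
move=> pb ip; rewrite boundary_term1_at //.
apply: (@chart_independent_bd _ _ _ (fun i x => lap_c i x - hnn_c i x)) => //;
  last exact: boundary_coord0.
move=> a b x o x0; congr (_ - _).
  exact: (lap_h_change (Co a b) (Co b a) (@tV a b) (@ts a b) (@gt a b) (hp a b) (fp a b) o).
exact: (hsnn_bd_change (Co a b) (Co b a) (@tV a b) (@ts a b) (@gt a b) (@tb a b) (fp a b) o x0).
Qed.

Lemma smooth_lap_c i : smoothV hs0 (V i) (lap_c i).
Proof. exact: (smooth_lap_h (C i)). Qed.

Lemma smooth_reilly_c i k : smoothV hs0 (V i) (reilly_c i k).
Proof. exact: (smooth_reilly (C i)). Qed.

Lemma smooth_hess2_c i : smoothV hs0 (V i) (hess2_c i).
Proof.
move=> r x Vx; apply: (germ_extV (C i) (F := fun y => \sum_k \sum_l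
   nab hs0 (g i) (fc i) k l y * nab hs0 (g i) (fc i) l k y) Vx).
  by move=> z Vz; rewrite /hess2_c (gnorm2_chess (C i)).
apply: germ_sum => k; apply: germ_sum => l.
by apply: germM; exact: (smooth_nab (C i)).
Qed.

Lemma smooth_div_c i : smoothV hs0 (V i) (div_c i).
Proof.
move=> r x Vx; apply: germB.
  apply: germ_sum => k; apply: germD; first by apply: germ_pd => //; [exact: model_halfspace|exact: smooth_reilly_c].
  by apply: germ_sum => m; apply: germM; [exact: (smooth_christoffel (C i))|exact: smooth_reilly_c].
apply: germ_sum => k; apply: germM; last exact: smooth_reilly_c.
by apply: germ_pd => //; [exact: model_halfspace|exact: shc].
Qed.

Lemma smooth_nz_c i : smoothV hs0 (V i) (nz_c i).
Proof.
move=> r x Vx; apply: germM; last exact: smooth_reilly_c.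
apply: germN; apply: germ_inv.
- exact: chart_image_sub Vx.
- by rewrite gt_eqF // sqrtr_gt0; exact: chart_ginv00.
- exact: (smooth_s (C i) (chart_ginv00 g (i := i))).
Qed.

Lemma smooth_hnn_c i : smoothV hs0 (V i) (hnn_c i).
Proof.
move=> r x Vx; have sn k := smooth_nu (C i) (chart_ginv00 g (i := i)) k.
apply: germ_sum => k; apply: germ_sum => l; apply: germM; last exact: sn.
by apply: germM; [exact: sn|exact: (smooth_chess (C i))].
Qed.

Lemma smooth_fnu_c i : smoothV hs0 (V i) (fnu_c i).
Proof. exact: (smooth_fnu (C i) (chart_ginv00 g (i := i))). Qed.

End Pointwise.

Section ChartContinuity.
Context {R : realType} {n : nat} (M : manifold R n).
Local Notation hs0 := (@halfspace R n).
Local Notation V i := (chart_image i).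

Lemma chart_cvg_fun (u : M -> R) (A : set M) i (T : 'rV[R]_n.+1 -> R) p :
  chart_dom i p -> A p -> germ 0 hs0 T (chart i p) ->
  (forall q, A q -> chart_dom i q -> u q = T (chart i q)) ->
  u @ within A (nbhs p) --> u p.
Proof.
move=> ip Ap CT uT; rewrite (uT p Ap ip) => B nB.
have Dp : hs0 (chart i p) by apply: chart_image_sub; exact: chart_imageP.
have H1 : \forall z \near chart i p, hs0 z -> B (T z) := germ_cvg Dp CT nB.
have H2 : \forall q \near p, hs0 (chart i q) -> B (T (chart i q)) := chart_cvg ip H1.
have io : \forall q \near p, chart_dom i q.
  by apply: open_nbhs_nbhs; split=> //; exact: chart_dom_open.
have H : \forall q \near p, A q -> B (u q).
  near=> q => Aq; have iq : chart_dom i q by near: q.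
  rewrite uT //; have : hs0 (chart i q) by apply: chart_image_sub; exact: chart_imageP.
  by near: q.
exact: H.
Unshelve. all: by end_near. Qed.

Lemma chart_continuous_fun (u : M -> R) :
  (forall p, exists i T, [/\ chart_dom i p, germ 0 hs0 T (chart i p) &
     forall q, chart_dom i q -> u q = T (chart i q)]) -> continuous u.
Proof.
move=> H p; have [i [T [ip CT uT]]] := H p.
have := @chart_cvg_fun u setT i T p ip I CT (fun q _ => uT q).
by rewrite withinET.
Qed.

End ChartContinuity.

(** * Lebesgue measure and the divergence theorem on the half-space *)

Local Notation bor T := (g_sigma_algebraType (@open T)).

Section Borel.
Context {R : realType}.

Lemma borel_open (T : ptopologicalType) (A : set T) : open A ->
  measurable (A : set (bor T)).
Proof. exact: sub_sigma_algebra. Qed.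

Lemma within_open_preimage (T U : ptopologicalType) (D : set T) (f : T -> U) (A : set U) :
  {within D, continuous f} -> open A -> exists2 O, open O & D `&` f @^-1` A = D `&` O.
Proof.
move=> /continuousP cf oA; have /open_subspaceP[Q oQ QD] := cf A oA.
by exists Q => //; rewrite setIC -QD setIC.
Qed.

Lemma borel_cts (T U : ptopologicalType) (D : set T) (f : T -> U) :
  {within D, continuous f} ->
  measurable_fun (D : set (bor T)) (f : bor T -> bor U).
Proof.
move=> cf mD; suff: measurable_fun (D : set (bor T)) (f : bor T -> bor U) by apply.
apply: (@measurability _ _ (bor T) (bor U) D f (@open U)); first by [].
move=> _ [A oA <-]; have [Q oQ ->] := within_open_preimage cf oA.
by apply: measurableI => //; exact: borel_open.
Qed.

Lemma borel_ctsR (T : ptopologicalType) (D : set T) (f : T -> R) :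
  {within D, continuous f} ->
  measurable_fun (D : set (bor T)) (f : bor T -> measurableTypeR R).
Proof.
move=> cf mD; suff: measurable_fun (D : set (bor T)) (f : bor T -> measurableTypeR R) by apply.
apply: (measurability _ (RGenOInfty.measurableE R)).
move=> _ [_ [a ->] <-].
have [Q oQ ->] := within_open_preimage cf (interval_open (b := +oo%O) (a := BRight a) isT isT).
by apply: measurableI => //; exact: borel_open.
Qed.

Lemma ratr_near (x e : R) : 0 < e -> exists q : rat, `|ratr q - x| < e.
Proof.
move=> e0; have /rat_in_itvoo[q] : x - e < x + e by lra.
by rewrite in_itv /= => /andP[h1 h2]; exists q; rewrite ltr_norml; apply/andP; split; lra.
Qed.

Section RV.
Variable d : nat.

Let box (q : 'rV[rat]_d * nat) : set 'rV[R]_d :=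
  [set x | forall k, `|ratr (q.1 0 k) - x 0 k| < q.2.+1%:R^-1].

(** Rational boxes form a countable base; this reduces Borel measurability of a vector-valued map to
    that of its coordinates. *)
Let open_boxes (U : set 'rV[R]_d) : open U ->
  U = \bigcup_(q : 'rV[rat]_d * nat) (if `[< box q `<=` U >] then box q else set0).
Proof.
move=> oU; apply/seteqP; split => [x Ux|x [q _]]; last first.
  by case: asboolP => // bU bx; exact: bU.
have /nbhs_ballP[e /= e0 eU] : nbhs x U by exact: open_nbhs_nbhs.
have e2 : 0 < e / 2 by rewrite divr_gt0.
(* Factor 2, since two points of a box are compared through its centre. *)
have [m me] : exists m : nat, 2 * m.+1%:R^-1 < e.
  have /cid2[m _ /(_ m (leqnn m)) H] := near_infty_natSinv_lt (PosNum e2).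
  by exists m; move: H => /=; set t := _^-1; lra.
have m0 : (0 : R) < m.+1%:R^-1 by rewrite invr_gt0.
have /choice[q qP] k : exists q : rat, `|ratr q - x 0 k| < m.+1%:R^-1 by exact: ratr_near.
exists (\row_k q k, m) => //.
have bx : box (\row_k q k, m) x by move=> k; rewrite mxE; exact: qP.
case: asboolP => // H; exfalso; apply: H => z bz; apply: eU.
rewrite -ball_normE /ball_ /=; apply: le_lt_trans me.
apply: norm_rV_le => [|k]; first by rewrite mulr_ge0 // ltW.
have := bz k; have := bx k; rewrite !mxE /= => h1 h2.
rewrite -(subrKA (ratr (q k))) (le_trans (ler_normD _ _)) //.
by rewrite (distrC (x 0 k)) mulr_natl mulr2n lerD // ltW.
Qed.

Lemma measurable_rV (dX : measure_display) (X : measurableType dX) (D : set X)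
    (f : X -> 'rV[R]_d) :
  (forall k, measurable_fun D (fun x => f x 0 k : measurableTypeR R)) ->
  measurable_fun D (f : X -> bor 'rV[R]_d).
Proof.
move=> mf mD; suff: measurable_fun D (f : X -> bor 'rV[R]_d) by apply.
apply: (@measurability _ _ X (bor 'rV[R]_d) D f (@open 'rV[R]_d)); first by [].
move=> _ [U /open_boxes -> <-]; rewrite preimage_bigcup setI_bigcupr.
apply: countable_bigcupT_measurable => // q.
case: asboolP => _; last by rewrite preimage_set0 setI0.
have -> : D `&` f @^-1` box q = D `&` \bigcap_(k in [set: 'I_d])
   (D `&` (fun x => f x 0 k) @^-1` (ball (ratr (q.1 0 k) : R^o) q.2.+1%:R^-1)).
  apply/seteqP; split => [x [Dx fx]|x [Dx fx]]; split => // k; last by have [_] := fx k I.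
  by move=> _; split => //; exact: fx.
apply: measurableI => //; apply: fin_bigcap_measurable => // k _.
by apply: mf => //; exact: measurable_ball.
Qed.

Lemma measurable_coord_rV k : measurable_fun setT
  (fun x : bor 'rV[R]_d => x 0 k : measurableTypeR R).
Proof.
apply: borel_ctsR; apply: continuous_subspaceT => x; exact: coord_continuous.
Qed.

End RV.

Lemma measurable_ball_rV d (x : 'rV[R]_d) e : measurable (ball x e : set (bor 'rV[R]_d)).
Proof. by apply: borel_open; exact: ball_open. Qed.

Definition glue d (z : measurableTypeR R * bor 'rV[R]_d) : bor 'rV[R]_d.+1 :=
  @row_mx R 1 1 d (z.1%:M) z.2.

Lemma glue0 d z : @glue d z 0 0 = z.1.
Proof.
rewrite /glue [LHS](_ : _ = @row_mx R 1 1 d (z.1%:M) z.2 0 (lshift d (0 : 'I_1))).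
  by rewrite row_mxEl mxE.
by congr (_ _ _); exact: val_inj.
Qed.

Lemma glueS d z k : @glue d z 0 (lift ord0 k) = z.2 0 k.
Proof. by rewrite -rshift1_lift; exact: (@row_mxEr R 1 1 d). Qed.

Lemma measurable_glue d : measurable_fun setT (@glue d).
Proof.
apply: measurable_rV => i; case: (unliftP ord0 i) => [k ->|->].
  rewrite (_ : (fun z => _) =
      (fun z : measurableTypeR R * bor 'rV[R]_d => z.2 0 k : measurableTypeR R)).
    exact: measurableT_comp (measurable_coord_rV k) measurable_snd.
  by apply/funext => z; rewrite glueS.
rewrite (_ : (fun z => _) = (fun z : measurableTypeR R * bor 'rV[R]_d => z.1)).
  exact: measurable_fst.
by apply/funext => z; rewrite glue0.
Qed.

(** Local finiteness is easily followed through the recursion on the dimension. It gives both the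
    sigma-finiteness required by product measures and finiteness on bounded sets. *)
Definition ball_finite d (mu : set (bor 'rV[R]_d) -> \bar R) :=
  forall r, (mu (ball (0%R : 'rV[R]_d) r) < +oo)%E.

Lemma ball_finite_sigma d (mu : {measure set (bor 'rV[R]_d) -> \bar R}) :
  ball_finite mu -> sigma_finite setT mu.
Proof.
move=> muB; exists (fun k : nat => ball (0 : 'rV[R]_d) k.+1%:R).
  apply/seteqP; split => // x _; have [N xN] : exists N : nat, `|x| < N.+1%:R.
    exists (Num.truncn `|x|); exact: truncnS_gt.
  by exists N => //; rewrite -ball_normE /ball_ /= sub0r normrN.
by move=> k; split; [exact: measurable_ball_rV|exact: muB].
Qed.

Section LebesgueStep.
Variables (d : nat) (mu : {sigma_finite_measure set (bor 'rV[R]_d) -> \bar R}).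
Hypothesis muB : ball_finite mu.

(** The proof of [ball_finite mu] is an argument, so that the sigma-finite structure declared below
    for [lamS muB] can depend on it. *)
Definition lamS of ball_finite mu : set (bor 'rV[R]_d.+1) -> \bar R :=
  pushforward (lebesgue_measure \x mu)%E (@glue d).

Let lamS0 : lamS muB set0 = 0%E.
Proof. by rewrite /lamS /pushforward preimage_set0 measure0. Qed.

Let lamS_ge0 A : (0 <= lamS muB A)%E.
Proof. by rewrite /lamS /pushforward; apply: measure_ge0. Qed.

Let lamS_sigma_additive : semi_sigma_additive (lamS muB).
Proof.
move=> F mF tF mUF; rewrite /lamS /pushforward preimage_bigcup.
apply: measure_semi_sigma_additive.
- by move=> k; rewrite -[X in measurable X]setTI; exact: measurable_glue.
- apply/trivIsetP => /= i j _ _ ij; rewrite -preimage_setI.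
  by move/trivIsetP : tF => /(_ _ _ _ _ ij) ->//; rewrite preimage_set0.
- by rewrite -preimage_bigcup -[X in measurable X]setTI; exact: measurable_glue.
Qed.

HB.instance Definition _ := isMeasure.Build _ _ _ (lamS muB) lamS0 lamS_ge0 lamS_sigma_additive.

Lemma lamS_ball : ball_finite (lamS muB).
Proof.
move=> r; rewrite /lamS /pushforward.
have mB : measurable (ball (0%R : 'rV[R]_d) (r + 1) : set (bor 'rV[R]_d)) by exact: measurable_ball_rV.
(* Coordinatewise estimates give the weak bound [|y| <= r], hence the open ball of radius
   [r + 1]. *)
apply: (@le_lt_trans _ _ ((lebesgue_measure \x mu)%E (`[- r, r]%classic `*` (ball (0%R : 'rV[R]_d) (r + 1) : set (bor 'rV[R]_d))))).
  apply: le_measure; rewrite ?inE.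
  - by rewrite -[X in measurable X]setTI; apply: measurable_glue => //; exact: measurable_ball_rV.
  - exact: measurableX.
  - move=> [t y]; rewrite /preimage /= -!ball_normE /ball_ /= !sub0r !normrN => H; split.
      have := le_lt_trans (norm_coord (glue (t, y)) 0) H; rewrite glue0 /= => /ltW.
      by rewrite ler_norml in_itv.
    have r0 : 0 < r by apply: le_lt_trans H.
    apply: (@le_lt_trans _ _ r); last by rewrite ltrDl.
    apply: norm_rV_le => [|k]; first exact: ltW.
    by rewrite -(glueS (t, y) k); apply: le_trans (norm_coord _ _) (ltW H).
rewrite product_measure1E //= lte_mul_pinfty //.
  by rewrite lebesgue_measure_itv /=; case: ifP => _ //; rewrite -EFinD.
Qed.

HB.instance Definition _ := @Measure_isSigmaFinite.Build _ _ _ (lamS muB)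
  (ball_finite_sigma lamS_ball).

Lemma integral_lamS (F : bor 'rV[R]_d.+1 -> \bar R) :
  measurable_fun setT F -> (forall x, (0 <= F x)%E) ->
  (\int[lamS muB]_x F x =
   \int[lebesgue_measure]_(t in [set: R]) \int[mu]_y F (glue (t, y)))%E.
Proof.
move=> mF F0; rewrite ge0_integral_pushforward //; last exact: measurable_glue.
have mFg : measurable_fun setT (F \o @glue d) by apply: measurableT_comp; [exact: mF|exact: measurable_glue].
by rewrite preimage_setT fubini_tonelli1 // => z /=; exact: F0.
Qed.

End LebesgueStep.

Definition lam0 : {sigma_finite_measure set (bor 'rV[R]_0) -> \bar R} :=
  @dirac _ (bor 'rV[R]_0) (0 : 'rV[R]_0) R.

Lemma lam0_ball : ball_finite lam0.
Proof. by move=> r; rewrite /= diracE ltry. Qed.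

Fixpoint lam_sig d :
    {mu : {sigma_finite_measure set (bor 'rV[R]_d) -> \bar R} | ball_finite mu} :=
  if d is d'.+1 then
    exist _ (lamS (svalP (lam_sig d')) : {sigma_finite_measure set _ -> \bar R}) (lamS_ball (svalP (lam_sig d')))
  else exist _ lam0 lam0_ball.

Definition lam d := sval (lam_sig d).

Lemma lam_ball d : ball_finite (lam d).
Proof. exact: svalP (lam_sig d). Qed.

Lemma lam_compact d (K : set 'rV[R]_d) : bounded_set K -> measurable (K : set (bor 'rV[R]_d)) ->
  (lam d K < +oo)%E.
Proof.
move=> [r [_ Kr]] mK; apply: le_lt_trans (lam_ball d (r + 2)).
apply: le_measure; rewrite ?inE //; first exact: measurable_ball_rV.
move=> x Kx; rewrite -ball_normE /ball_ /= sub0r normrN.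
by apply: le_lt_trans (Kr (r + 1) _ _ Kx) _; rewrite ?ltrDl // ltrD2l; lra.
Qed.

Lemma iintE d (F : bor 'rV[R]_d -> \bar R) :
  measurable_fun setT F -> (forall x, (0 <= F x)%E) ->
  iint F = (\int[lam d]_x F x)%E.
Proof.
elim: d F => [|d IH] F mF F0 /=.
  by rewrite integral_dirac // diracT mul1e.
rewrite /lam /= integral_lamS //; apply: eq_integral => t _; apply: IH => //.
exact: measurableT_comp mF (measurableT_comp (@measurable_glue d) (measurable_pair1 _)).
Qed.

End Borel.

Local Notation leb := lebesgue_measure.

(** * The fundamental theorem of calculus and Fubini's theorem on slabs *)

Section FTC.
Context {R : realType}.
Variable half : bool.

(** One definition for the half-line and the full line, so that the half-space and the whole space
    share the same argument. *)
Definition ray : set R := [set t | half ==> (0 <= t)].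

Lemma within_comp (S T U : topologicalType) (A : set S) (B : set T) (f : T -> U) (p : S -> T) :
  {within B, continuous f} -> continuous p -> (forall x, A x -> B (p x)) ->
  {within A, continuous (f \o p)}.
Proof.
move=> /subspace_continuousP cf cp AB; apply/subspace_continuousP => x Ax.
have H : p @ within A (nbhs x) --> within B (nbhs (p x)).
  move=> P HP; have H : nbhs x (p @^-1` [set y | B y -> P y]) by exact: cp.
  by apply: (filterS _ H) => y Hy Ay; apply: Hy; exact: AB.
exact: cvg_comp H (cf _ (AB _ Ax)).
Qed.

Lemma within_setT (S T : topologicalType) (f : S -> T) :
  {within setT, continuous f} -> continuous f.
Proof.
move=> /subspace_continuousP cf x P /(cf x I) H.
by apply: (filterS _ (H : nbhs x [set y | setT y -> P (f y)])) => y; apply.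
Qed.

Lemma ftc_ray (u v : R -> R) r :
  {within ray, continuous u} -> {within ray, continuous v} ->
  (forall t, ray t -> (u (t + s) - u t) / s @[s --> within [set s | ray (t + s)] 0^'] --> v t) ->
  (forall t, ray t -> r < `|t| -> u t = 0 /\ v t = 0) ->
  (\int[leb]_(t in ray) (v t)%:E = (if half then - u 0 else 0)%:E)%E.
Proof.
move=> cu cv duv uv0.
(* [b] is positive and exceeds [r] whatever the sign of [r], so [u] vanishes at [b] and, on the full
   line, at [- b]; only the endpoint 0 of the half-line contributes. *)
pose b := `|r| + 1; pose a : R := if half then 0 else - b.
have b0 : 0 < b by rewrite ltr_wpDl.
have rb : r < b by apply: le_lt_trans (ler_norm r) _; rewrite ltrDl.
have ab : a < b by rewrite /a; case: half => //; lra.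
have aray t : a <= t -> ray t by rewrite /ray /a /=; case: half.
have vab t : ray t -> ~~ (a <= t <= b) -> v t = 0.
  move=> Tt; rewrite negb_and -!ltNge => H; apply: (uv0 t Tt _).2.
  apply: lt_le_trans rb _; rewrite ler_normr; case/orP: H => [|/ltW ->//].
  by move: Tt; rewrite /ray /a /=; case: half => /= [|_]; lra.
have subab : `[a, b]%classic `<=` ray by move=> t /=; rewrite in_itv /= => /andP[/aray].
have -> : (\int[leb]_(t in ray) (v t)%:E = \int[leb]_(t in `[a, b]) (v t)%:E)%E.
  rewrite integral_mkcond [RHS]integral_mkcond; apply: eq_integral => t _.
  rewrite /patch; case: ifPn => [|tT]; case: ifPn => //.
    rewrite !inE /= => tab Tt; congr EFin; apply: vab => //.
    by apply/negP => H; move/negP: tab; apply; rewrite inE /= in_itv.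
  by rewrite inE => /subab Tt; move/negP: tT; rewrite inE.
have cab (w : R -> R) : {within ray, continuous w} -> {within `[a, b], continuous w}.
  by move=> cw; exact: continuous_subspaceW subab cw.
have udv t : t \in `]a, b[ -> is_derive t 1 u (v t).
  move=> tab; have /andP[at_ tb] : a < t < b by move: tab; rewrite in_itv.
  suff H : (fun s : R => s^-1 *: ((u \o shift t) (s *: 1) - u t)) @ 0^' --> v t.
    by split; [apply/cvg_ex; exists (v t)|apply: cvg_lim].
  have rS : \forall s \near (0 : R)^', ray (t + s).
    near=> s; apply: aray.
    suff : `|s| < t - a by rewrite ltr_norml => /andP[]; lra.
    by near: s; apply: dnbhs0_lt; rewrite subr_gt0.
  move=> P /(duv t (aray _ (ltW at_))) HP.
  have HP' : \forall s \near (0 : R)^', ray (t + s) -> P ((u (t + s) - u t) / s) by exact: HP.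
  suff : \forall s \near (0 : R)^', P (s^-1 *: ((u \o shift t) (s *: 1) - u t)) by [].
  near=> s; rewrite /= [s *: 1]mulr1 [s + t]addrC [_ *: _]mulrC.
  have rs : ray (t + s) by near: s.
  by move: rs; near: s.
rewrite (@continuous_FTC2 R v u a b ab (cab _ cv)).
- rewrite -EFinB; congr EFin.
  have -> : u b = 0 by apply: (uv0 b _ _).1; [exact/aray/ltW|rewrite gtr0_norm].
  rewrite sub0r /a; case E : half => //.
  have -> : u (- b) = 0; last by rewrite oppr0.
  by apply: (uv0 (- b) _ _).1; [rewrite /ray E|rewrite normrN gtr0_norm].
- have [cu1 cu2 cu3] := (continuous_within_itvP u ab).1 (cab _ cu).
  by split => // t tab; have [] := udv t tab.
- by move=> t tab; rewrite derive1E; have [_ ->] := udv t tab.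
Unshelve. all: by end_near. Qed.

End FTC.

Section Slab.
Context {R : realType}.

Lemma cts_bounded (T : topologicalType) (K : set T) (F : T -> R) :
  compact K -> {within K, continuous F} -> [bounded F x | x in K].
Proof.
move=> cK cF.
have /compact_bounded[B [Br BF]] : compact (F @` K : set R^o) by exact: continuous_compact.
by exists B; split => // x Bx y Ky; apply: BF => //; exists y.
Qed.

Lemma closed_measurable_bor (T : ptopologicalType) (D : set T) : closed D ->
  measurable (D : set (bor T)).
Proof.
move=> cD; rewrite -(setCK D); apply: (@measurableC _ (bor T)).
by apply: borel_open; exact: closed_openC.
Qed.

Lemma integrable_cts_supp d (D : set 'rV[R]_d) (F : 'rV[R]_d -> R) r :
  closed D -> {within D, continuous F} -> (forall x, D x -> r < `|x| -> F x = 0) ->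
  (lam d).-integrable (D : set (bor 'rV[R]_d)) (EFin \o F).
Proof.
(* The radius is positive for every [r], and [K] contains all points of [D] where [F] can be
   nonzero. *)
move=> cD cF F0; pose K := D `&` closed_ball (0 : 'rV[R]_d) (`|r| + 1).
have r1 : 0 < `|r| + 1 by rewrite ltr_wpDl.
have cK : closed K by apply: closedI => //; exact: closed_ball_closed.
have KE x : closed_ball (0 : 'rV[R]_d) (`|r| + 1) x = (`|x| <= `|r| + 1) :> Prop.
  by rewrite closed_ballE //= /closed_ball_ /= sub0r normrN.
have bK : bounded_set K.
  exists (`|r| + 1); split; first exact: num_real.
  by move=> s rs x [_]; rewrite KE => /le_trans; apply; exact: ltW.
have KD : K `<=` D by move=> x [].
have cFK := continuous_subspaceW KD cF.
have mD := closed_measurable_bor cD; have mK := closed_measurable_bor cK.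
have H : (lam d).-integrable (K : set (bor 'rV[R]_d)) (EFin \o F).
  apply: measurable_bounded_integrable => //; first exact: lam_compact.
    exact: borel_ctsR.
  by apply: cts_bounded => //; exact: bounded_closed_compact.
apply/(integrable_mkcond _ mD); move/(integrable_mkcond _ mK) : H.
congr (integrable _ _ _); apply/funext => x; rewrite /patch; case: ifPn => [|xK].
  by rewrite !inE => /KD Dx; rewrite mem_set.
case: ifPn => //; rewrite inE => Dx /=; rewrite F0 //.
apply: contraNT xK; rewrite -leNgt => xr; rewrite inE; split=> //; rewrite KE.
by apply: le_trans xr _; apply: le_trans (ler_norm r) _; rewrite lerDl.
Qed.

Variables (half : bool) (d : nat).
Local Notation T := (ray half : set R).

Definition slab : set 'rV[R]_d.+1 := [set x | T (x 0 0)].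

Lemma closed_slab : closed slab.
Proof.
rewrite /slab /ray; case: half => /=; last by rewrite [X in closed X](_ : _ = setT); [exact: closedT|apply/seteqP].
apply: (@preimage_closed _ _ (fun x : 'rV[R]_d.+1 => x 0 0) [set t | 0 <= t]).
  by move=> x _; exact: coord_continuous.
exact: closed_ge.
Qed.

Lemma continuous_glue1 (y : 'rV[R]_d) : continuous (fun t : R => @glue R d (t, y) : 'rV[R]_d.+1).
Proof.
move=> t; apply/(@cvgrPdist_lt _ _ _ (nbhs t) (nbhs_filter _)) => e e0; near=> s.
apply: (@le_lt_trans _ _ `|t - s|); last first.
  by near: s; have := @nbhsx_ballx _ _ t e e0; rewrite -ball_normE.
apply: norm_rV_le => // i; rewrite [X in `|X|]mxE [X in _ + X]mxE.
case: (unliftP ord0 i) => [k ->|->]; last by rewrite !glue0.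
by rewrite !glueS /= subrr normr0.
Unshelve. all: by end_near. Qed.

Lemma continuous_glue2 (t : R) : continuous (fun y : 'rV[R]_d => @glue R d (t, y) : 'rV[R]_d.+1).
Proof.
move=> y; apply/(@cvgrPdist_lt _ _ _ (nbhs y) (nbhs_filter _)) => e e0; near=> s.
apply: (@le_lt_trans _ _ `|y - s|); last first.
  by near: s; have := @nbhsx_ballx _ _ y e e0; rewrite -ball_normE.
apply: norm_rV_le => // i; rewrite [X in `|X|]mxE [X in _ + X]mxE.
case: (unliftP ord0 i) => [k ->|->]; last by rewrite !glue0 /= subrr normr0.
rewrite !glueS /=; apply: le_trans _ (norm_coord _ k).
by rewrite !mxE.
Unshelve. all: by end_near. Qed.

Variables (F : 'rV[R]_d.+1 -> R) (r : R).
Hypothesis cF : {within slab, continuous F}.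
Hypothesis F0 : forall x, slab x -> r < `|x| -> F x = 0.

(** Both orders are needed: the innermost integral has to run along the direction of
    differentiation, or along the slices that contain it. *)
Lemma slab_fubini :
  (\int[lam d.+1]_(x in slab) (F x)%:E =
   \int[leb]_(t in T) \int[lam d]_y (F (@glue R d (t, y)))%:E /\
   \int[lam d.+1]_(x in slab) (F x)%:E =
   \int[lam d]_y \int[leb]_(t in T) (F (@glue R d (t, y)))%:E)%E.
Proof.
pose f := (EFin \o F) \_ slab.
have mS := closed_measurable_bor closed_slab.
have iF : (lam d.+1).-integrable setT f.
  apply/(integrable_mkcond _ mS).
  exact: integrable_cts_supp closed_slab cF F0.
have mf := measurable_int _ iF.
have mfg : measurable_fun setT (f \o @glue R d).
  by apply: measurableT_comp; [exact: mf|exact: measurable_glue].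
have ifg : (leb \x lam d)%E.-integrable setT (f \o @glue R d).
  apply/integrable12ltyP => //; move/integrableP: iF => [_].
  by rewrite /lam /= integral_lamS //; apply: measurableT_comp.
have fE t y : f (@glue R d (t, y)) = if t \in T then (F (@glue R d (t, y)))%:E else 0%E.
  by rewrite /f /patch; congr (if _ then _ else _); apply/idP/idP; rewrite !inE /slab /= glue0.
have E : (\int[lam d.+1]_(x in slab) (F x)%:E = \int[leb \x lam d]_z f (glue z))%E.
  rewrite integral_mkcond -/f /lam /= integral_pushforward //; last exact: measurable_glue.
split; rewrite E.
  rewrite -(integral12_prod_meas1 ifg) [RHS]integral_mkcond; apply: eq_integral => t _.
  rewrite /patch /fubini_F; case: ifPn => tT.
    by apply: eq_integral => y _; rewrite /= fE tT.
  by apply: integral0_eq => y _; rewrite /= fE (negbTE tT).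
rewrite -(integral21_prod_meas1 ifg); apply: eq_integral => y _.
by rewrite [RHS]integral_mkcond; apply: eq_integral => t _; rewrite /= fE.
Qed.

End Slab.

Section Divergence.
Context {R : realType}.

(** A relation between [u] and its derivative [v], as it passes to slices by mere rewriting of the
    difference quotient. *)
Definition dquot d (D : set 'rV[R]_d) (k : 'I_d) (u v : 'rV[R]_d -> R) :=
  forall x, D x -> (u (x + t *: delta_mx 0 k) - u x) / t
    @[t --> within [set t | D (x + t *: delta_mx 0 k)] 0^'] --> v x.

Definition supp_in d (D : set 'rV[R]_d) r (u : 'rV[R]_d -> R) :=
  forall x, D x -> r < `|x| -> u x = 0.

Lemma glueD0 d t (y : 'rV[R]_d) (s : R) :
  @glue R d (t, y) + s *: delta_mx 0 ord0 = @glue R d (t + s, y).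
Proof.
apply/rowP => i; rewrite [LHS]mxE [X in _ + X = _]mxE [X in _ + _ * X = _]mxE eqxx /=.
case: (unliftP ord0 i) => [c ->|->]; last by rewrite !glue0 /= mulr1.
by rewrite !glueS /= mulr0 addr0.
Qed.

Lemma glueDS d t (y : 'rV[R]_d) (s : R) k :
  @glue R d (t, y) + s *: delta_mx 0 (lift ord0 k) = @glue R d (t, y + s *: delta_mx 0 k).
Proof.
apply/rowP => i; rewrite [LHS]mxE [X in _ + X = _]mxE [X in _ + _ * X = _]mxE eqxx /=.
case: (unliftP ord0 i) => [c ->|->]; last by rewrite !glue0 /= mulr0 addr0.
by rewrite !glueS /= !mxE eqxx (inj_eq lift_inj).
Qed.

Section Step.
Variables (half : bool) (d : nat) (u v : 'rV[R]_d.+1 -> R) (r : R).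
Local Notation D := (@slab R half d).
Hypotheses (cu : {within D, continuous u}) (cv : {within D, continuous v}).
Hypotheses (su : supp_in D r u) (sv : supp_in D r v).

Lemma norm_glue1 t (y : 'rV[R]_d) : `|t| <= `|@glue R d (t, y) : 'rV[R]_d.+1|.
Proof. by have := norm_coord (@glue R d (t, y)) 0; rewrite glue0. Qed.

Lemma norm_glue2 t (y : 'rV[R]_d) : `|y| <= `|@glue R d (t, y) : 'rV[R]_d.+1|.
Proof.
by apply: norm_rV_le => // k; have := norm_coord (@glue R d (t, y)) (lift ord0 k); rewrite glueS.
Qed.

Lemma integral_d0 : dquot D ord0 u v ->
  (\int[lam d.+1]_(x in D) (v x)%:E =
   \int[lam d]_y (if half then - u (@glue R d (0%R, y)) else 0)%:E)%E.
Proof.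
move=> duv; rewrite (slab_fubini cv sv).2; apply: eq_integral => y _.
have cg := @continuous_glue1 R d y.
have DT (t : R) : ray half t -> D (@glue R d (t, y)) by rewrite /slab /= glue0.
rewrite (@ftc_ray _ half (fun t => u (@glue R d (t, y))) _ r) //.
- by apply: (within_comp (B := D) (f := u)).
- by apply: (within_comp (B := D) (f := v)).
- move=> t Tt; have := duv _ (DT _ Tt).
  have -> : (fun s => (u (@glue R d (t, y) + s *: delta_mx 0 ord0) - u (@glue R d (t, y))) / s) =
      (fun s => (u (@glue R d (t + s, y)) - u (@glue R d (t, y))) / s).
    by apply/funext => s; rewrite glueD0.
  have -> // : [set s : R | D (@glue R d (t, y) + s *: delta_mx 0 ord0)] = [set s | ray half (t + s)].
  by apply/funext => s /=; rewrite glueD0 /slab /= glue0.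
- move=> t Tt rt; have rg := lt_le_trans rt (norm_glue1 t y).
  by split; [exact: su (DT _ Tt) rg|exact: sv (DT _ Tt) rg].
Qed.

(** On each slice [x_0 = t], the function is a derivative in one dimension less, over the whole
    space and with bounded support; the premise is the induction hypothesis of [integral_deriv0]. *)
Lemma integral_dS k : dquot D (lift ord0 k) u v ->
  (forall u' v' : 'rV[R]_d -> R, continuous u' -> continuous v' ->
     supp_in setT r u' -> supp_in setT r v' -> dquot setT k u' v' ->
     \int[lam d]_y (v' y)%:E = 0)%E ->
  (\int[lam d.+1]_(x in D) (v x)%:E = 0)%E.
Proof.
move=> duv IH; rewrite (slab_fubini cv sv).1; apply: integral0_eq => t Tt.
have DT y : D (@glue R d (t, y)) by rewrite /slab /= glue0.
have cg := @continuous_glue2 R d t.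
apply: (IH (fun y => u (@glue R d (t, y)))).
- by apply: within_setT; apply: (within_comp (B := D) (f := u)) cg _ => // y _; exact: DT.
- by apply: within_setT; apply: (within_comp (B := D) (f := v)) cg _ => // y _; exact: DT.
- by move=> y _ ry; apply: su (DT y) (lt_le_trans ry (norm_glue2 t y)).
- by move=> y _ ry; apply: sv (DT y) (lt_le_trans ry (norm_glue2 t y)).
move=> y _; have := duv _ (DT y).
have -> : (fun s => (u (@glue R d (t, y) + s *: delta_mx 0 (lift ord0 k)) - u (@glue R d (t, y))) / s) =
    (fun s => (u (@glue R d (t, y + s *: delta_mx 0 k)) - u (@glue R d (t, y))) / s).
  by apply/funext => s; rewrite glueDS.
have -> // : [set s : R | D (@glue R d (t, y) + s *: delta_mx 0 (lift ord0 k))] =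
    [set s | setT (y + s *: delta_mx 0 k)].
by apply/seteqP; split => s //= _; rewrite glueDS.
Qed.

End Step.

Lemma integral_deriv0 d (k : 'I_d) (u v : 'rV[R]_d -> R) r :
  continuous u -> continuous v -> supp_in setT r u -> supp_in setT r v ->
  dquot setT k u v -> (\int[lam d]_y (v y)%:E = 0)%E.
Proof.
elim: d k u v => [[]//|d IH] k u v cu cv su sv duv.
have DT : @slab R false d = setT by apply/seteqP.
have cT (w : 'rV[R]_d.+1 -> R) : continuous w -> {within @slab R false d, continuous w}.
  by move=> cw; exact: continuous_subspaceT.
rewrite -DT in su sv duv *.
case: (unliftP ord0 k) duv => [c ->|->] duv.
  by apply: (integral_dS (cT _ cu) (cT _ cv) su sv duv) => u' v'; exact: IH.
by rewrite (integral_d0 (cT _ cu) (cT _ cv) su sv duv) integral0.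
Qed.

End Divergence.

Section HalfspaceDivergence.
Context {R : realType} {n : nat}.
Local Notation hs0 := (@halfspace R n).

Lemma germ_dquot d (D : set 'rV[R]_d) k (F : 'rV[R]_d -> R) x :
  model_space D -> D x -> germ 1 D F x ->
  (F (x + t *: delta_mx 0 k) - F x) / t
    @[t --> within [set t | D (x + t *: delta_mx 0 k)] 0^'] --> pd D k F x.
Proof.
move=> mD Dx /(germ1_is_derive mD Dx k)[G [dG <-] FG].
have Fx : F x = G x by exact: (nbhs_singleton FG).
have /cvg_within_filter-/(_ [set t | D (x + t *: delta_mx 0 k)]) H := dG.
apply: cvg_trans H; apply: near_eq_cvg; rewrite near_withinE.
have H : \forall t \near (0 : R)^', D (x + t *: delta_mx 0 k) ->
    F (x + t *: delta_mx 0 k) = G (x + t *: delta_mx 0 k).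
  by have := near_dir D k FG; rewrite near_withinE; apply: filterS => t /[swap] Dt; apply.
near=> t => Dt; rewrite /= Fx (addrC _ x) mulrC; congr (_ * (_ - _)); apply/esym.
by move: Dt; near: t.
Unshelve. all: by end_near. Qed.

Lemma bemb_glue (y : 'rV[R]_n) : @glue R n (0%R, y) = bemb y.
Proof.
apply/rowP => i; case: (unliftP ord0 i) => [c ->|->]; first by rewrite glueS bembS.
by rewrite glue0 bemb0.
Qed.

Lemma slab_halfspace : @slab R true n = hs0.
Proof. by []. Qed.

Lemma closed_halfspace : closed hs0.
Proof. by rewrite -slab_halfspace; exact: closed_slab. Qed.

Lemma germ_within_cts d k (D : set 'rV[R]_d) (F : 'rV[R]_d -> R) :
  (forall x, D x -> germ k D F x) -> {within D, continuous F}.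
Proof.
move=> gF; apply/subspace_continuousP => x Dx; apply: germ_cvg => //.
exact: germ_le (gF x Dx).
Qed.

Lemma supp_in_pd d (D : set 'rV[R]_d) k (F : 'rV[R]_d -> R) r :
  model_space D -> supp_in D r F -> supp_in D r (pd D k F).
Proof.
move=> mD sF x Dx rx; rewrite -(pd_cst mD Dx k 0); apply: eq_pd => //.
have : \forall y \near x, r < `|y| by apply: (cvgr_gt _ (@norm_continuous _ _ x)).
by apply: filterS => y ry Dy; exact: sF.
Qed.

(** Tangential derivatives integrate to zero. The transverse one leaves the value at the lower
    endpoint, hence the minus sign. *)
Lemma halfspace_divergence (P : 'I_n.+1 -> 'rV[R]_n.+1 -> R) r :
  (forall k x, hs0 x -> germ 1 hs0 (P k) x) ->
  (forall k, supp_in hs0 r (P k)) ->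
  (\int[lam n.+1]_(x in hs0) (\sum_k pd hs0 k (P k) x)%:E =
   \int[lam n]_y (- P 0%R (bemb y))%:E)%E.
Proof.
move=> gP sP; have mD := @model_halfspace R n.
have gpd k x : hs0 x -> germ 0 hs0 (pd hs0 k (P k)) x by move=> Dx; exact: (germ_pd mD k (gP k x Dx)).
have cP k : {within hs0, continuous (P k)} by exact: germ_within_cts (gP k).
have cpd k : {within hs0, continuous (pd hs0 k (P k))} by exact: germ_within_cts (gpd k).
have spd k : supp_in hs0 r (pd hs0 k (P k)) by exact: supp_in_pd.
have dq k : dquot hs0 k (P k) (pd hs0 k (P k)) by move=> x Dx; apply: germ_dquot => //; exact: gP.
have mH := closed_measurable_bor closed_halfspace.
under eq_integral do rewrite -sumEFin.
rewrite integral_sum //; last by move=> k; exact: integrable_cts_supp closed_halfspace (cpd k) (spd k).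
rewrite big_ord_recl big1 ?adde0 => [|k _].
  rewrite (integral_d0 (half := true) (cP 0) (cpd 0) (sP 0) (spd 0) (dq 0)).
  by apply: eq_integral => y _; rewrite bemb_glue.
apply: (integral_dS (half := true) (cP _) (cpd _) (sP _) (spd _) (dq _)) => u v cu cv su sv duv.
exact: integral_deriv0 cu cv su sv duv.
Qed.

End HalfspaceDivergence.

(** * Integration on the manifold *)

Section Transfer.
Import HBNNSimple.
Context {R : realType} {dX dY : measure_display}.
Context {X : measurableType dX} {Y : measurableType dY}.
Variables (mu : {measure set X -> \bar R}) (nu : {measure set Y -> \bar R}).
Variables (V : set X) (D : set Y) (e : X -> Y) (s : X -> R).
Hypotheses (mV : measurable V) (mD : measurable D) (me : measurable_fun V e).
Hypothesis eVD : forall x, V x -> D (e x).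
Hypotheses (ms : measurable_fun V s) (s_ge0 : forall x, V x -> 0 <= s x).
Hypothesis nuE : forall A, measurable A -> A `<=` D ->
  (nu A = \int[mu]_(x in V) (\1_A (e x) * s x)%:E)%E.

Let mind A : measurable A -> measurable_fun V (fun x => \1_A (e x) : R).
Proof.
by move=> mA; apply: (measurable_comp measurableT (@subsetT _ _)) => //; exact: measurable_indic.
Qed.

Let transfer_nnsfun (h : {nnsfun Y >-> R}) :
  (\int[nu]_(y in D) (h y)%:E = \int[mu]_(x in V) (h (e x) * s x)%:E)%E.
Proof.
transitivity (\int[nu]_(y in D) (\sum_(r \in range h) (r * \1_(h @^-1` [set r]) y)%:E))%E.
  by apply: eq_integral => y yD; rewrite /= fimfunE -fsumEFin.
have mr r : measurable (h @^-1` [set r]) by [].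
rewrite ge0_integral_fsum //; last 2 first.
- by move=> r; apply/measurable_EFinP/measurable_funTS/measurable_funM.
- by move=> r y _; exact: nnfun_muleindic_ge0.
transitivity (\int[mu]_(x in V) (\sum_(r \in range h) (r * (\1_(h @^-1` [set r]) (e x) * s x))%:E))%E; last first.
  apply: eq_integral => x xV; rewrite fsumEFin // fimfunE; congr EFin.
  rewrite [RHS]mulrC mulr_fsumr //; apply: eq_fsbigr => r _; by rewrite [RHS]mulrC mulrA.
rewrite ge0_integral_fsum //; last 2 first.
- move=> r; apply/measurable_EFinP/measurable_funM => //; apply: measurable_funM => //; exact: mind.
- move=> r x Vx; rewrite mulrA lee_fin mulr_ge0 ?s_ge0 //.
  by have := nnfun_muleindic_ge0 h r (e x); rewrite -EFinM lee_fin.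
apply: eq_fsbigr => r; rewrite inE => -[y0 _ hr].
have r0 : 0 <= r by rewrite -hr.
under [RHS]eq_integral do rewrite EFinM.
rewrite [RHS]ge0_integralZl //; last 2 first.
- by apply/measurable_EFinP/measurable_funM => //; exact: mind.
- by move=> x Vx; rewrite lee_fin mulr_ge0 ?s_ge0 // indicE.
under eq_integral do rewrite EFinM.
rewrite ge0_integralZl //; last by apply/measurable_EFinP/measurable_funTS.
rewrite integral_indic //; congr (_ * _)%E.
rewrite nuE; [|exact: measurableI|by move=> y []].
apply: eq_integral => x; rewrite inE => Vx; congr (_ * _)%:E.
rewrite !indicE; congr (_%:R); congr (nat_of_bool _).
by apply/idP/idP; rewrite !inE; [case|split => //; exact: eVD].
Qed.

(** [nuE] is the case of indicators; simple functions follow by linearity, and the general case by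
    monotone convergence. *)
Lemma ge0_integral_transfer (f : Y -> \bar R) : measurable_fun D f ->
  (forall y, D y -> 0 <= f y)%E ->
  (\int[nu]_(y in D) f y = \int[mu]_(x in V) (f (e x) * (s x)%:E))%E.
Proof.
move=> mf f0; pose h := nnsfun_approx mD mf.
transitivity (limn (fun n => \int[nu]_(y in D) (h n y)%:E)%E).
  rewrite -monotone_convergence //=.
  - by apply: eq_integral => y /[!inE] yD; apply/esym/cvg_lim => //; exact: cvg_nnsfun_approx.
  - by move=> n; exact/measurable_EFinP/measurable_funTS.
  - by move=> n y _; rewrite lee_fin.
  - by move=> y _ a b ab; rewrite lee_fin; exact/lefP/nd_nnsfun_approx.
under eq_fun do rewrite transfer_nnsfun.
rewrite -monotone_convergence //=.
- apply: eq_integral => x /[!inE] xV; apply/cvg_lim => //=.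
  under eq_fun do rewrite EFinM.
  by apply: cvgeZr => //; apply: cvg_nnsfun_approx => //; exact: eVD.
- move=> n; apply/measurable_EFinP/measurable_funM => //.
  by apply: (measurable_comp measurableT (@subsetT _ _)).
- by move=> n x Vx; rewrite lee_fin mulr_ge0 ?s_ge0.
- move=> x Vx a b ab; rewrite lee_fin ler_wpM2r ?s_ge0 //.
  exact/lefP/nd_nnsfun_approx.
Qed.

Lemma integral_transfer (f : Y -> R) : measurable_fun D f ->
  (\int[nu]_(y in D) (f y)%:E = \int[mu]_(x in V) (f (e x) * s x)%:E)%E.
Proof.
move=> mf; have mfE : measurable_fun D (EFin \o f) by exact/measurable_EFinP.
rewrite integralE [RHS]integralE; congr (_ - _)%E.
  rewrite ge0_integral_transfer //; last exact: measurable_funepos.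
  apply: eq_integral => x; rewrite inE => Vx.
  by rewrite !funeposE /= -!EFin_max -EFinM maxr_pMl ?s_ge0 // mul0r.
rewrite ge0_integral_transfer //; last exact: measurable_funeneg.
apply: eq_integral => x; rewrite inE => Vx.
by rewrite !funenegE /= -!EFin_max -EFinM maxr_pMl ?s_ge0 // mul0r mulNr.
Qed.

End Transfer.

Section VolumeTransfer.
Context {R : realType}.

(** Brings the iterated integrals that characterise the volume measures to the form of the
    hypothesis [nuE]. *)
Lemma iint_indic d (V : set 'rV[R]_d) (Y : ptopologicalType) (e : 'rV[R]_d -> Y)
    (s : 'rV[R]_d -> R) (A : set Y) (B : set 'rV[R]_d) :
  measurable (V : set (bor 'rV[R]_d)) -> {within V, continuous e} ->
  {within V, continuous s} -> (forall x, V x -> 0 <= s x) ->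
  measurable (A : set (bor Y)) -> (forall x, B x <-> V x /\ A (e x)) ->
  (iint (fun x => (\1_B x * s x)%:E) =
   \int[lam d]_(x in (V : set (bor 'rV[R]_d))) (\1_A (e x) * s x)%:E)%E.
Proof.
move=> mV ce cs s0 mA BE.
have E : (fun x => (\1_B x * s x)%:E) = (fun x => (\1_A (e x) * s x)%:E) \_ V.
  apply/funext => x; rewrite /patch; case: ifPn => [|xV].
    rewrite inE => Vx; congr (_ * _)%:E; rewrite !indicE; congr (nat_of_bool _)%:R.
    by apply/idP/idP; rewrite !inE; [case/BE|move=> Ax; apply/BE].
  rewrite indicE (_ : x \in B = false) ?mul0r //; apply/negP.
  by rewrite inE => /BE[Vx _]; move/negP: xV; apply; rewrite inE.
rewrite E [RHS]integral_mkcond iintE // => [|x]; last first.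
  rewrite /patch; case: ifPn => //; rewrite inE => Vx.
  by rewrite lee_fin mulr_ge0 ?s0 // indicE.
apply/(measurable_restrictT _ mV)/measurable_EFinP/measurable_funM; last exact: borel_ctsR.
have mi : measurable_fun setT (\1_(A : set (bor Y)) : bor Y -> R) by exact: measurable_indic.
exact: (measurable_comp measurableT (@subsetT _ _) mi (borel_cts ce)).
Qed.

Context {n : nat} (M : manifold R n) (g : riemannian_metric M).
Local Notation hs0 := (@halfspace R n).
Local Notation V i := (chart_image i).
Implicit Types (i : chart_index M) (u : M -> R).

Lemma measurable_chart_image i : measurable (V i : set (bor 'rV[R]_n.+1)).
Proof.
have [W oW VE] := chart_image_open i; rewrite /chart_image VE.
by apply: measurableI; [exact: borel_open|exact: closed_measurable_bor (@closed_halfspace R n)].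
Qed.

Lemma chart_image_image i (A : set M) x : A `<=` chart_dom i ->
  (chart i @` A) x <-> V i x /\ A (chart_inv i x).
Proof.
move=> AD; split => [[p Ap <-]|[Vx Ax]].
  by split; [exact: chart_imageP (AD _ Ap)|rewrite chartK //; exact: AD].
by exists (chart_inv i x) => //; rewrite chart_invK.
Qed.

Lemma measurable_chart_dom i : measurable (chart_dom i : set (bor M)).
Proof. by apply: borel_open; exact: chart_dom_open. Qed.

Definition chart_bd i : set 'rV[R]_n := [set y | V i (bemb y)].

Lemma measurable_chart_bd i : measurable (chart_bd i : set (bor 'rV[R]_n)).
Proof.
have H := @borel_cts _ _ setT _ (continuous_subspaceT (@continuous_bemb R n)).
by have := H measurableT _ (measurable_chart_image i); rewrite setTI.
Qed.

Lemma germ0_cts i F : (forall x, V i x -> germ 0 hs0 F x) -> {within V i, continuous F}.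
Proof.
move=> sF; apply/subspace_continuousP => x Vx P HP.
have H := germ_cvg (chart_image_sub Vx) (sF x Vx) HP.
by apply: filterS (H : nbhs x [set y | hs0 y -> P (F y)]) => y Hy Vy; apply: Hy; exact: chart_image_sub Vy.
Qed.

Lemma smoothV_cts i F : smoothV hs0 (V i) F -> {within V i, continuous F}.
Proof. by move=> sF; apply: germ0_cts; exact: sF. Qed.

Lemma integral_dv_chart (dv : {measure set (borel M) -> \bar R}) i u :
  is_volume g dv -> measurable_fun (chart_dom i : set (bor M)) (u : bor M -> measurableTypeR R) ->
  (\int[dv]_(p in chart_dom i) (u p)%:E =
   \int[lam n.+1]_(x in V i) (u (chart_inv i x) * voldens (g i) x)%:E)%E.
Proof.
move=> dvV mu.
have cs : {within V i, continuous (voldens (g i))}.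
  by apply: smoothV_cts; exact: (smooth_voldens (chart_metricP g i)).
have s0 x : V i x -> 0 <= voldens (g i) x by move=> _; exact: sqrtr_ge0.
have me : measurable_fun (V i : set (bor 'rV[R]_n.+1)) (chart_inv i : bor _ -> bor M).
  exact: borel_cts (@chart_inv_continuous _ _ M i).
apply: (integral_transfer (e := chart_inv i : bor _ -> bor M)) => //.
- exact: measurable_chart_image.
- exact: measurable_chart_dom.
- by move=> x; exact: chart_inv_dom.
- exact: borel_ctsR cs.
move=> A mA AD; rewrite (dvV i) //; apply: iint_indic => //.
- exact: measurable_chart_image.
- exact: chart_inv_continuous.
- by move=> x; exact: chart_image_image.
Qed.

Definition bdens i (y : 'rV[R]_n) : R := Num.sqrt (\det (induced_metric (g i) y)).

(* By Cramer's rule, [g^00 = det (induced metric) / det g]. *)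
Lemma bdensE i (y : 'rV[R]_n) : chart_bd i y ->
  bdens i y = Num.sqrt (ginv (g i) (bemb y) 0 0) * voldens (g i) (bemb y).
Proof.
move=> Vy; have d0 := posdef_det_gt0 (chart_posdef g Vy).
have u0 : g i (bemb y) \in unitmx by rewrite unitmxE unitfE gt_eqF.
rewrite -sqrtrM ?ltW // ?(chart_ginv00 g Vy) //; congr (Num.sqrt _).
rewrite /ginv /invmx u0 !mxE mulrC mulrA divff ?gt_eqF // mul1r.
rewrite /cofactor /= expr0 mul1r; congr (\det _); apply/matrixP => a b.
by rewrite induced_metricE !mxE.
Qed.

Lemma bdens_cts i : {within chart_bd i, continuous (bdens i)}.
Proof.
have H : smoothV hs0 (V i) (fun x => Num.sqrt (ginv (g i) x 0 0) * voldens (g i) x).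
  move=> k x Vx; apply: germM; last exact: (smooth_voldens (chart_metricP g i)).
  exact: (smooth_s (chart_metricP g i) (chart_ginv00 g (i := i))).
have cH := within_comp (smoothV_cts H) continuous_bemb (fun y (Vy : chart_bd i y) => Vy).
apply: (subspace_eq_continuous _ cH) => y; rewrite inE => Vy.
by rewrite [RHS]bdensE.
Qed.

Lemma integral_ds_chart (ds : {measure set (borel M) -> \bar R}) i u :
  is_boundary_volume g ds ->
  measurable_fun (chart_dom i : set (bor M)) (u : bor M -> measurableTypeR R) ->
  (\int[ds]_(p in chart_dom i) (u p)%:E =
   \int[lam n]_(y in chart_bd i) (u (chart_inv i (bemb y)) * bdens i y)%:E)%E.
Proof.
move=> dsV mu.
have ce : {within chart_bd i, continuous (chart_inv i \o @bemb R n)}.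
  by apply: within_comp (@chart_inv_continuous _ _ M i) continuous_bemb _.
have cs := @bdens_cts i.
have s0 y : chart_bd i y -> 0 <= bdens i y by move=> _; exact: sqrtr_ge0.
have mV := measurable_chart_bd i.
have me : measurable_fun (chart_bd i : set (bor 'rV[R]_n))
  (chart_inv i \o @bemb R n : bor _ -> bor M) by exact: borel_cts ce.
apply: (integral_transfer (e := chart_inv i \o @bemb R n : bor _ -> bor M)) => //.
- exact: measurable_chart_dom.
- by move=> y Vy; exact: chart_inv_dom.
- exact: borel_ctsR cs.
move=> A mA AD; rewrite (dsV i) //.
by apply: (iint_indic (B := [set y | (chart i @` A) (bemb y)])) => // y; exact: chart_image_image.
Qed.

End VolumeTransfer.

(** * The divergence theorem for a field supported in one chart *)

Section LocalDivergence.
Context {R : realType} {n : nat} (M : manifold R n) (g : riemannian_metric M).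
Local Notation hs0 := (@halfspace R n).
Local Notation V i := (chart_image i).
Implicit Types (i j : chart_index M) (p q : M) (phi : M -> R).

Definition C1_fun phi := forall i x, V i x -> germ 1 hs0 (phi \o chart_inv i) x.

Lemma chart_cont i F : {within V i, continuous F} -> {within chart_dom i, continuous (F \o chart i : M -> R)}.
Proof.
move=> /subspace_continuousP cF; apply/subspace_continuousP => p ip.
have Vp : V i (chart i p) := chart_imageP ip.
have H : chart i @ within (chart_dom i) (nbhs p) --> within (V i) (nbhs (chart i p)).
  move=> P HP; have H : nbhs p (chart i @^-1` [set y | V i y -> P y]) := chart_cvg ip HP.
  by apply: (filterS _ H) => q Hq iq; apply: Hq; exact: chart_imageP.
exact: cvg_comp H (cF _ Vp).
Qed.

Lemma measurable_chart i F : {within V i, continuous F} ->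
  measurable_fun (chart_dom i : set (bor M)) (F \o chart i : bor M -> measurableTypeR R).
Proof. by move=> /chart_cont; exact: borel_ctsR. Qed.

Lemma closed_boundary : closed (boundary M).
Proof.
rewrite -[boundary M]setCK; apply: open_closedC; rewrite openE => p pb.
have ip := chart_at_dom p; set i := chart_at p in ip.
have p0 : chart i p 0 0 != 0 by apply/eqP => E; apply: pb; exists i.
have io : \forall q \near p, chart_dom i q.
  by apply: open_nbhs_nbhs; split=> //; exact: chart_dom_open.
have cc : (fun q => chart i q 0 0) @ p --> chart i p 0 0.
  exact: cvg_comp (chart_cvg ip) (@coord_continuous _ _ _ 0 0 (chart i p)).
have c0 : \forall q \near p, chart i q 0 0 != 0.
  have H : nbhs (chart i p 0 0) [set t | t != 0].
    by apply: open_nbhs_nbhs; split=> //; exact: open_neq.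
  exact: cc H.
rewrite /interior; near=> q => qb; have iq : chart_dom i q by near: q.
have : chart i q 0 0 != 0 by near: q.
by rewrite (boundary_chart g iq qb) eqxx.
Unshelve. all: by end_near. Qed.

Section Chart.
Variables (h f : M -> R) (sh : smooth_fun h) (sf : smooth_fun f).
Local Notation div_c := (div_c g h f).
Local Notation nz_c := (nz_c g h f).
Local Notation reilly_c := (reilly_c g h f).

Definition div_at p := div_c (chart_at p) (Defs.coord p).
(** The derivative of [phi] along [Z]: the error made when [Z] is cut off by [phi]. *)
Definition reilly_at phi p := \sum_k reilly_c (chart_at p) k (Defs.coord p) *
  pd hs0 k (phi \o chart_inv (chart_at p)) (Defs.coord p).

Lemma div_at_chart i p : chart_dom i p -> div_at p = div_c i (chart i p).
Proof. by move=> ip; rewrite -(chart_independent (div_c_change g sh sf) ip). Qed.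

Lemma reilly_at_chart phi i p : C1_fun phi -> chart_dom i p ->
  reilly_at phi p = \sum_k reilly_c i k (chart i p) * pd hs0 k (phi \o chart_inv i) (chart i p).
Proof.
move=> Cphi ip.
rewrite -(@chart_independent _ _ _ (fun i x => \sum_k reilly_c i k x * pd hs0 k (phi \o chart_inv i) x) i p _ ip) //.
move=> a b x o; have [q [aq bq] E] := o.
apply: (reilly_apply_change (overlap_metric g a b) (overlap_metric g b a)
   (@transition_overlap R n M a b) (@transition_smoothV R n M a b) (@metric_transition R n M g a b)
   (paired_funP a b sh) (paired_funP a b sf) o).
- by apply: Cphi; exact: overlap_sub (transition_overlap o).
- by move=> y [s [sa sb] <-]; rewrite /transition /= !chartK.
Qed.

Variables (i : chart_index M) (phi : M -> R) (K : set M).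
Hypotheses (Cphi : C1_fun phi) (cK : compact K) (Ki : K `<=` chart_dom i).
Hypothesis phi0 : forall p, ~ K p -> phi p = 0.

Let K' := chart i @` K.
Let w := wdens (g i) (h \o chart_inv i).
(** The cut-off field times the density, extended by zero. It is of class [C^1] on the whole
    half-space, because [phi] vanishes off a compact subset of the chart domain. *)
Let P k x := if x \in V i then phi (chart_inv i x) * (w x * reilly_c i k x) else 0.

Let cK' : compact K'.
Proof.
apply: continuous_compact cK; apply: continuous_subspaceW Ki _.
exact: chart_continuous.
Qed.

Let P0 k x : ~ K' x -> P k x = 0.
Proof.
move=> xK; rewrite /P; case: ifPn => //; rewrite inE => Vx.
rewrite phi0 ?mul0r // => Kx; apply: xK; exists (chart_inv i x) => //.
exact: chart_invK.
Qed.

Let near_notK x : ~ K' x -> \forall y \near x, ~ K' y.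
Proof.
move=> xK; apply: open_nbhs_nbhs; split => //; apply: closed_openC.
by apply: compact_closed cK'; exact: norm_hausdorff.
Qed.

Let PV k x : V i x -> \forall y \near x, hs0 y ->
  phi (chart_inv i y) * (w y * reilly_c i k y) = P k y.
Proof.
move=> Vx; apply: filterS (chart_image_near Vx) => y H /H Vy.
by rewrite /P mem_set.
Qed.

Let gP k x : hs0 x -> germ 1 hs0 (P k) x.
Proof.
move=> Dx; have [Vx|Vx] := pselect (V i x).
  apply: germ_ext (PV k Vx) _; apply: germM; first exact: Cphi.
  apply: germM; last exact: (@smooth_reilly_c _ _ _ g h f sh sf i k).
  exact: (smooth_wdens (chart_metricP g i) (smooth_funP (i := i) sh)).
have xK : ~ K' x by move=> [p /Ki ip E]; apply: Vx; rewrite -E; exact: chart_imageP.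
apply: germ_ext (germ_cst hs0 1 0 x).
by apply: filterS (near_notK xK) => y yK _; rewrite P0.
Qed.

Let divP x : hs0 x -> \sum_k pd hs0 k (P k) x =
  if x \in V i then w x * (phi (chart_inv i x) * div_c i x +
     \sum_k reilly_c i k x * pd hs0 k (phi \o chart_inv i) x) else 0.
Proof.
move=> Dx; have mD := @model_halfspace R n; case: ifPn => [|Vx].
  rewrite inE => Vx.
  have <- := div_weighted (chart_metricP g i) (smooth_funP (i := i) sh) Vx (Cphi Vx)
    (@smooth_reilly_c _ _ _ g h f sh sf i).
  by apply: eq_bigr => k _; apply/esym; apply: eq_pd => //; exact: PV.
have xK : ~ K' x.
  by move=> [p /Ki ip E]; move/negP: Vx; apply; rewrite inE -E; exact: chart_imageP.
rewrite big1 // => k _; rewrite -(pd_cst mD Dx k 0); apply: eq_pd => //.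
by apply: filterS (near_notK xK) => y yK _; rewrite P0.
Qed.

Let reilly0 p : ~ K p -> reilly_at phi p = 0.
Proof.
move=> pK; apply: big1 => k _; rewrite -[RHS](mulr0 (reilly_c (chart_at p) k (Defs.coord p))).
have mD := @model_halfspace R n; have Vp := Vcoord p.
have Dp := chart_image_sub Vp.
congr (_ * _); rewrite -(pd_cst mD Dp k 0); apply: eq_pd => //.
have nK : nbhs (chart_inv (chart_at p) (Defs.coord p)) (~` K).
  rewrite chartK; last exact: chart_at_dom.
  apply: open_nbhs_nbhs; split => //; apply: closed_openC.
  by apply: compact_closed cK; exact: manifold_hausdorff.
by apply: filterS (chart_inv_near Vp nK) => y H Dy /=; rewrite phi0 //; exact: (H Dy).2.
Qed.

Lemma nz_at_chart p : boundary M p -> chart_dom i p ->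
  nz_c (chart_at p) (Defs.coord p) = nz_c i (chart i p).
Proof.
by move=> pb ip; rewrite -(boundary_terms_chart g sh sf pb ip) -boundary_terms_at.
Qed.

(** In the chart this is [halfspace_divergence] for [P]. The boundary densities match because
    [bdens = sqrt g^00 * voldens], which absorbs the factor [1 / sqrt g^00] in the normal component
    of [Z]. *)
Lemma local_divergence (dv ds : {measure set (borel M) -> \bar R}) :
  is_volume g dv -> is_boundary_volume g ds ->
  (\int[dv]_(p in [set: borel M]) ((phi p * div_at p + reilly_at phi p) * expR (- h p))%:E =
   \int[ds]_(p in boundary M) (phi p * nz_c (chart_at p) (Defs.coord p) * expR (- h p))%:E)%E.
Proof.
move=> dvV dsV.
pose E x := expR (- h (chart_inv i x)).
have gphi x : V i x -> germ 0 hs0 (phi \o chart_inv i) x by move=> Vx; apply: germ_le (Cphi Vx).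
have gE x : V i x -> germ 0 hs0 E x.
  by move=> Vx; apply: germ_exp; apply: germN; exact: (smooth_funP (i := i) sh).
pose U x := (phi (chart_inv i x) * div_c i x +
  \sum_k reilly_c i k x * pd hs0 k (phi \o chart_inv i) x) * E x.
pose B x := phi (chart_inv i x) * nz_c i x * E x.
have cU : {within V i, continuous U}.
  apply: germ0_cts => x Vx; apply: germM; last exact: gE.
  apply: germD; first by apply: germM; [exact: gphi|exact: (@smooth_div_c _ _ _ g h f sh sf i)].
  apply: germ_sum => k; apply: germM; first exact: (@smooth_reilly_c _ _ _ g h f sh sf i k).
  by apply: germ_pd; [exact: model_halfspace|exact: Cphi].
have cB : {within V i, continuous B}.
  apply: germ0_cts => x Vx; apply: germM; last exact: gE.
  by apply: germM; [exact: gphi|exact: (@smooth_nz_c _ _ _ g h f sh sf i)].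
have Ni p : p \notin chart_dom i -> ~ K p.
  by move=> /negP ip /Ki Kp; apply: ip; rewrite inE.
transitivity (\int[dv]_(p in chart_dom i) ((U \o chart i) p)%:E)%E.
  rewrite [RHS]integral_mkcond; apply: eq_integral => p _; rewrite /patch; case: ifPn => [|/Ni pK].
    by rewrite inE => ip; rewrite /= /U /E chartK // (div_at_chart ip) (reilly_at_chart Cphi ip).
  by rewrite phi0 // reilly0 // mul0r add0r mul0r.
rewrite (integral_dv_chart dvV (measurable_chart cU)).
transitivity (\int[lam n.+1]_(x in hs0) (\sum_k pd hs0 k (P k) x)%:E)%E.
  rewrite integral_mkcond [RHS]integral_mkcond; apply: eq_integral => x _; rewrite /patch.
  case: ifPn => [|xV]; first rewrite inE => Vx.
    have Dx := chart_image_sub Vx.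
    rewrite mem_set // divP // mem_set //= chart_invK // /U /w /wdens /E; congr EFin.
    by move: (_ + \sum_k _) => A; ring.
  by case: ifPn => //; rewrite inE => Dx; rewrite divP // (negbTE xV).
have [r rK] : exists r, forall x, r < `|x| -> ~ K' x.
  have [b [_ bK]] := compact_bounded cK'; exists (b + 1) => x bx Kx.
  have xb : `|x| <= b + 1 by apply: bK => //; rewrite ltrDl.
  by move: xb; rewrite leNgt bx.
rewrite (halfspace_divergence (r := r) gP); last by move=> k x Dx rx; apply: P0; exact: rK.
(* Transport to the chart works over the whole chart domain, so the restriction to the boundary
   becomes an indicator, equal to 1 at every point that [bemb] parametrises. *)
transitivity (\int[ds]_(p in chart_dom i) ((B \o chart i) p * \1_(boundary M) p)%:E)%E; last first.
  rewrite integral_mkcond [RHS]integral_mkcond; apply: eq_integral => p _; rewrite /patch.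
  case: ifPn => [|/Ni pK].
    rewrite inE => ip; rewrite indicE; case: ifPn => [|pb]; last by rewrite mulr0.
    by rewrite inE => pb; rewrite (nz_at_chart pb ip) mulr1 /comp /B /E (chartK ip).
  by case: ifPn => // _; rewrite phi0 // !mul0r.
rewrite (integral_ds_chart dsV (u := fun p => (B \o chart i) p * \1_(boundary M) p)); last first.
  apply: measurable_funM; first exact: measurable_chart.
  by apply: measurable_funTS; apply: measurable_indic; exact: closed_measurable_bor closed_boundary.
rewrite [RHS]integral_mkcond; apply: eq_integral => y _; rewrite /patch; case: ifPn => [|yV].
  rewrite inE => Vy; rewrite (bdensE g Vy) /= chart_invK // indicE mem_set; last first.
    by exists i; [exact: chart_inv_dom|rewrite chart_invK // bemb0].
  rewrite /P mem_set // /B /E /w /wdens /nz_c; congr EFin.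
  have : Num.sqrt (ginv (g i) (bemb y) 0 0) != 0.
    by rewrite gt_eqF // sqrtr_gt0; exact: chart_ginv00.
  by move=> s0; rewrite /=; field.
by rewrite /P ifN ?oppr0.
Qed.

End Chart.
End LocalDivergence.

(** * Partitions of unity of class [C^1] *)

Section SquarePos.
Context {R : realType}.

(* A cut-off of class C^1 only, which is all the divergence theorem needs. *)
Definition possq (t : R) : R := Num.max t 0 ^+ 2.

Lemma is_derive_possq (t : R) : is_derive t 1 possq (2 * Num.max t 0).
Proof.
(* A uniform bound on the first-order remainder, valid for all signs of [t] and [t + s]; it covers
   the kink at 0 as well. *)
have B (s : R) : `|possq (t + s) - possq t - s * (2 * Num.max t 0)| <= s ^+ 2.
  by rewrite /possq ler_norml; case: (lerP t 0); case: (lerP (t + s) 0) => *;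
    apply/andP; split; rewrite ?expr0n /= ?mulr0; nra.
suff H : (fun s : R => s^-1 *: ((possq \o shift t) (s *: 1) - possq t)) @ 0^' --> 2 * Num.max t 0.
  by split; [apply/cvg_ex; exists (2 * Num.max t 0)|apply: cvg_lim].
apply/cvgrPdist_lt => /= e e0; near=> s.
have s0 : s != 0 by near: s; exact: nbhs_dnbhs_neq.
rewrite [s *: 1]mulr1 [s + t]addrC distrC.
have -> : s^-1 *: (possq (t + s) - possq t) - 2 * Num.max t 0 =
    s^-1 * (possq (t + s) - possq t - s * (2 * Num.max t 0)).
  by rewrite [in RHS]mulrBr mulrA mulVf // mul1r.
rewrite normrM normfV; apply: (@le_lt_trans _ _ `|s|); last first.
  by near: s; apply: dnbhs0_lt.
by rewrite ler_pdivrMl ?normr_gt0 // -expr2 real_normK ?num_real // B.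
Unshelve. all: by end_near. Qed.

Lemma germ_possq d (D : set 'rV[R]_d) F x : germ 1 D F x -> germ 1 D (possq \o F) x.
Proof.
move=> [W [G [Wo Wx CG FG]]]; exists W, (possq \o G).
split; [exact: Wo|exact: Wx| |by move=> y Wy Dy /=; rewrite FG].
apply: (Ck_on_comp1 Wo (a := fun y => 2 * Num.max (G y) 0)) => //.
  by move=> y _; exact: is_derive_possq.
split=> // y Wy; have cG := Ck_on_cts CG Wy.
apply: continuousM; first exact: cst_continuous.
by apply: (@continuous_max _ _ G (fun=> 0)) => //; exact: cst_continuous.
Qed.

End SquarePos.

Section Partition.
Context {R : realType} {n : nat} (M : manifold R n).
Local Notation hs0 := (@halfspace R n).
Local Notation V i := (chart_image i).
Implicit Types (i j : chart_index M) (p q : M).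

Lemma C1_fun_cts (u : M -> R) : C1_fun u -> continuous u.
Proof.
move=> Cu; apply: chart_continuous_fun => p; exists (chart_at p), (u \o chart_inv (chart_at p)).
split; first exact: chart_at_dom.
  by apply: germ_le (Cu _ _ (chart_imageP (chart_at_dom p))).
by move=> q iq; rewrite /= chartK.
Qed.

Lemma bump p : exists (b : M -> R) (K : set M),
  [/\ C1_fun b, (forall q, 0 <= b q) /\ 0 < b p, compact K, K `<=` chart_dom (chart_at p) &
      forall q, ~ K q -> b q = 0].
Proof.
set i := chart_at p; have ip : chart_dom i p := chart_at_dom p.
set c := chart i p; have Vc : V i c := chart_imageP ip.
have /nbhs_ballP[r /= r0 rV] := chart_image_near Vc.
have r2 : 0 < r / 2 by rewrite divr_gt0.
(* Half the radius puts the closed ball inside the open ball whose trace on the half-space lies in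
   the chart image. *)
pose L := closed_ball c (r / 2) `&` hs0.
have LV : L `<=` V i.
  move=> x [cx Dx]; apply: rV => //; move: cx; rewrite closed_ballE //= /closed_ball_ /=.
  by rewrite -ball_normE /ball_ /= => /le_lt_trans; apply; lra.
have cL : compact L.
  apply: bounded_closed_compact; last first.
    by apply: closedI; [exact: closed_ball_closed|exact: closed_halfspace].
  exists (`|c| + r / 2); split; first exact: num_real.
  move=> s rs x [cx _]; move: cx; rewrite closed_ballE //= /closed_ball_ /= => cx.
  rewrite -[x](subKr c); apply: le_trans (ler_normB _ _) _.
  by apply: le_trans (ltW rs); rewrite lerD2l.
pose K := chart_inv i @` L.
have cK : compact K.
  apply: continuous_compact cL; apply: continuous_subspaceW LV _.
  exact: chart_inv_continuous.
have Ki : K `<=` chart_dom i by move=> _ [x Lx <-]; apply: chart_inv_dom; exact: LV.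
(* Euclidean squares are smooth while the norm is the sup norm; still, [Q x > 0] bounds every
   coordinate of [x - c] by [r / 2], which puts the points of the half-space in [L]. *)
pose Q (x : 'rV[R]_n.+1) : R := (r / 2) ^+ 2 - \sum_k (x 0 k - c 0 k) * (x 0 k - c 0 k).
pose b q := if q \in chart_dom i then possq (Q (chart i q)) else 0.
have b0 q : ~ K q -> b q = 0.
  move=> qK; rewrite /b; case: ifPn => //; rewrite inE => iq.
  rewrite /possq; suff -> : Num.max (Q (chart i q)) 0 = 0 by rewrite expr0n.
  apply/max_idPr; rewrite leNgt; apply/negP => Q0; apply: qK.
  exists (chart i q); last by rewrite chartK.
  split; last by apply: chart_image_sub; exact: chart_imageP.
  rewrite closed_ballE //= /closed_ball_ /=.
  apply: norm_rV_le => [|k]; first exact: ltW.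
  rewrite [X in `|X|]mxE [X in _ + X]mxE distrC -(@ler_pXn2r _ 2) ?nnegrE ?normr_ge0 ?(ltW r2) //.
  rewrite real_normK ?num_real //.
  have S0 : \sum_(l | l != k) (chart i q 0 l - c 0 l) * (chart i q 0 l - c 0 l) >= 0.
    by apply: sumr_ge0 => l _; rewrite -expr2 sqr_ge0.
  move: Q0; rewrite /Q (bigD1 k) //= expr2 => Q0.
  by rewrite expr2; move: S0 Q0; set S := \sum_(l | _) _; lra.
exists b, K; split=> //; last first.
  split=> [q|]; first by rewrite /b; case: ifP => // _; rewrite sqr_ge0.
  rewrite /b mem_set // /possq exprn_gt0 // lt_max; apply/orP; left.
  rewrite /Q big1 ?subr0 ?exprn_gt0 // => k _.
  by rewrite subrr mul0r.
(* At points of [K] the bump is read through the transition from [j] to [i]. Off [K], which is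
   closed because [M] is Hausdorff, it vanishes nearby. *)
move=> j x Vx; have [qK|qK] := pselect (K (chart_inv j x)).
  have o := overlapP Vx (Ki _ qK).
  apply: (@germ_ext _ _ _ _ (possq \o (fun y => Q (transition j i y)))).
    apply: filterS (overlap_near o) => y H /H oy /=; rewrite /b mem_set //.
    by have [s [sj si] <-] := oy; rewrite chartK.
  apply: germ_possq; apply: germB; first exact: germ_cst.
  apply: germ_sum => k; apply: germM; apply: germB; try exact: germ_cst.
    exact: (transition_smoothV k 1%N o).
  exact: (transition_smoothV k 1%N o).
apply: germ_ext (germ_cst hs0 1 0 x).
have nK : nbhs (chart_inv j x) (~` K).
  apply: open_nbhs_nbhs; split => //; apply: closed_openC.
  by apply: compact_closed cK; exact: manifold_hausdorff.
by apply: filterS (chart_inv_near Vx nK) => y H Dy /=; rewrite b0 //; exact: (H Dy).2.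
Qed.

(** Compactness extracts finitely many bumps whose positivity sets cover [M]; dividing by their sum
    normalises them and keeps the sets [K]. *)
Lemma partition_of_unity : compact [set: M] ->
  exists (I : seq M) (phi : M -> M -> R) (K : M -> set M),
    (forall a, [/\ C1_fun (phi a), compact (K a), K a `<=` chart_dom (chart_at a) &
       forall q, ~ K a q -> phi a q = 0]) /\
    forall q, \sum_(a <- I) phi a q = 1.
Proof.
move=> cM; have /choice[b /choice[K bK]] := bump.
have ob a : open [set q | 0 < b a q].
  have [/C1_fun_cts cb _ _ _ _] := bK a.
  by apply: (open_comp (f := b a) (D := [set t | 0 < t])) => [q _|]; [exact: cb|exact: open_gt].
have : cover_compact [set: M] by rewrite -compact_cover.
move=> /(_ _ setT (fun a => [set q | 0 < b a q])) [].
- by move=> a _; exact: ob.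
- by move=> q _; exists q => //; have [_ [_ bq] _ _ _] := bK q.
move=> I _ cI; pose S q := \sum_(a <- finmap.enum_fset I) b a q.
have S0 q : 0 < S q.
  have [a aI /= ba] := cI q Logic.I.
  rewrite /S (bigD1_seq a aI (finmap.fset_uniq I)) /=.
  apply: ltr_wpDr => //; apply: sumr_ge0 => c _; by have [_ [bq _] _ _ _] := bK c.
exists (finmap.enum_fset I), (fun a q => b a q / S q), K; split; last first.
  by move=> q; rewrite -mulr_suml divff // gt_eqF //; exact: S0.
move=> a; have [Cb [bq _] cK Ki b0] := bK a; split=> //; last by move=> q /b0 ->; rewrite mul0r.
move=> i x Vx; apply: germM; first exact: Cb.
apply: germ_inv; [exact: chart_image_sub Vx|by rewrite gt_eqF // S0|].
by apply: germ_sum => c; have [Cc _ _ _ _] := bK c; exact: Cc.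
Qed.

End Partition.

(** * Finiteness of the volumes and integrability *)

Section FiniteVolume.
Context {R : realType} {n : nat} (M : manifold R n) (g : riemannian_metric M).
Local Notation hs0 := (@halfspace R n).
Local Notation V i := (chart_image i).
Implicit Types (i : chart_index M) (p q : M).

Lemma iint_compact_lty d (B : set 'rV[R]_d) (s : 'rV[R]_d -> R) :
  compact B -> {within B, continuous s} -> (forall x, B x -> 0 <= s x) ->
  (iint (fun x => (\1_B x * s x)%:E) < +oo)%E.
Proof.
move=> cB cs s0; have clB : closed B by apply: compact_closed cB; exact: norm_hausdorff.
have mB := closed_measurable_bor clB.
rewrite (@iint_indic _ _ B _ (fun x => x) s setT B) //; last 2 first.
- by apply: continuous_subspaceT => x; exact: cvg_id.
- by move=> x; split => [|[]].
have H : (lam d).-integrable (B : set (bor 'rV[R]_d)) (EFin \o s).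
  apply: measurable_bounded_integrable => //.
  - by apply: lam_compact => //; exact: compact_bounded.
  - exact: borel_ctsR.
  - exact: cts_bounded.
have -> : (\int[lam d]_(x in (B : set (bor 'rV[R]_d))) (\1_[set: 'rV[R]_d] x * s x)%:E =
    \int[lam d]_(x in (B : set (bor 'rV[R]_d))) (EFin \o s) x)%E.
  by apply: eq_integral => x _; rewrite /= indicT mul1r.
exact: integrable_lty.
Qed.

Lemma chart_compact i (K : set M) : compact K -> K `<=` chart_dom i -> compact (chart i @` K).
Proof.
move=> cK Ki; apply: continuous_compact cK; apply: continuous_subspaceW Ki _.
exact: chart_continuous.
Qed.

Lemma compact_bor (K : set M) : compact K -> measurable (K : set (bor M)).
Proof.
by move=> cK; apply: closed_measurable_bor; apply: compact_closed cK; exact: manifold_hausdorff.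
Qed.

Lemma chart_image_K i (K : set M) : K `<=` chart_dom i -> chart i @` K `<=` V i.
Proof. by move=> Ki x [p /Ki ip <-]; exact: chart_imageP. Qed.

Lemma dv_compact (dv : {measure set (borel M) -> \bar R}) i (K : set M) :
  is_volume g dv -> compact K -> K `<=` chart_dom i -> (dv K < +oo)%E.
Proof.
move=> dvV cK Ki; rewrite (dvV i) //; last exact: compact_bor.
apply: (@iint_compact_lty _ _ (voldens (g i))).
- exact: chart_compact.
- apply: continuous_subspaceW (chart_image_K Ki) _.
  by apply: smoothV_cts; exact: (smooth_voldens (chart_metricP g i)).
- by move=> x _; exact: sqrtr_ge0.
Qed.

Lemma ds_compact (ds : {measure set (borel M) -> \bar R}) i (K : set M) :
  is_boundary_volume g ds -> compact K -> K `<=` chart_dom i -> (ds K < +oo)%E.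
Proof.
move=> dsV cK Ki; rewrite (dsV i) //; last exact: compact_bor.
have cC := chart_compact cK Ki.
apply: (@iint_compact_lty _ [set y | (chart i @` K) (bemb y)] (bdens g i)).
- apply: bounded_closed_compact; last first.
    apply: (preimage_closed (f := @bemb R n)); first by move=> y _; exact: continuous_bemb.
    by apply: compact_closed cC; exact: norm_hausdorff.
  have [b [br bK]] := compact_bounded cC; exists b; split=> // s bs y /= Ky.
  apply: le_trans (bK s bs _ Ky); apply: norm_rV_le => // k.
  by rewrite -bembS; exact: norm_coord.
- apply: continuous_subspaceW (@bdens_cts _ _ _ g i) => y /=; exact: chart_image_K.
- by move=> x _; exact: sqrtr_ge0.
Qed.

(** The volume measures are prescribed on subsets of a single chart domain, so finiteness of the
    total mass is assembled from finitely many compact pieces. *)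
Lemma measure_cover_lty (mu : {measure set (bor M) -> \bar R}) (I : seq M) (K : M -> set M) :
  (forall a, compact (K a)) -> (forall a, mu (K a) < +oo)%E ->
  (forall q, exists2 a, a \in I & K a q) -> (mu setT < +oo)%E.
Proof.
move=> cK mK cov; pose U (s : seq M) := [set q | exists2 a, a \in s & K a q].
have -> : setT = U I by apply/seteqP; split => // q _; exact: cov.
suff H s : measurable (U s : set (bor M)) /\ (mu (U s) < +oo)%E by have [] := H I.
elim: s => [|a s [mU IH]].
  have -> : U [::] = set0 by apply/seteqP; split => // q [].
  by split; [exact: measurable0|rewrite measure0].
have E : U (a :: s) = K a `|` U s.
  apply/seteqP; split => [q [c]|q [Kq|[c cs Kc]]].
  - by rewrite inE => /orP[/eqP->|cs] Kc; [left|right; exists c].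
  - by exists a => //; rewrite mem_head.
  - by exists c => //; rewrite inE cs orbT.
have mKa := compact_bor (cK a).
rewrite E; split; first exact: measurableU.
by apply: (@le_lt_trans _ _ (mu (K a) + mu (U s))%E); [exact: measureU2|exact: lte_add_pinfty].
Qed.

Lemma integrable_compact (mu : {measure set (bor M) -> \bar R}) (A : set M) (u : M -> R) :
  compact A -> (mu setT < +oo)%E -> {within A, continuous u} ->
  mu.-integrable (A : set (bor M)) (EFin \o u).
Proof.
move=> cA muT cu; have mA := compact_bor cA.
apply: measurable_bounded_integrable => //.
- by apply: le_lt_trans muT; apply: le_measure; rewrite ?inE.
- exact: borel_ctsR.
- exact: cts_bounded.
Qed.

End FiniteVolume.

(** * The global divergence theorem and Reilly's formula *)

Section Reilly.
Context {R : realType} {n : nat} (M : manifold R n) (g : riemannian_metric M).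
Local Notation hs0 := (@halfspace R n).
Local Notation V i := (chart_image i).
Variables (h f : M -> R) (sh : smooth_fun h) (sf : smooth_fun f).
Implicit Types (i : chart_index M) (p q : M) (phi : M -> R).
Hypothesis cM : compact [set: M].
Variables (dv ds : {measure set (borel M) -> \bar R}).
Hypotheses (dvV : is_volume g dv) (dsV : is_boundary_volume g ds).
Local Notation div_at := (div_at g h f).
Local Notation reilly_at := (reilly_at g h f).
Let nz_at p := nz_c g h f (chart_at p) (Defs.coord p).

Let Vp p := chart_imageP (chart_at_dom p).

Let gE i x : V i x -> germ 0 hs0 (fun y => expR (- h (chart_inv i y))) x.
Proof. by move=> Vx; apply: germ_exp; apply: germN; exact: (smooth_funP (i := i) sh). Qed.

(** One regular expression [T i] per chart makes a function defined through varying preferred charts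
    continuous. *)
Lemma weighted_cts (A : set M) (u : M -> R) (T : chart_index M -> 'rV[R]_n.+1 -> R) :
  (forall i x, V i x -> germ 0 hs0 (T i) x) ->
  (forall i p, A p -> chart_dom i p -> u p = T i (chart i p)) ->
  {within A, continuous (fun p => u p * expR (- h p))}.
Proof.
move=> gT uT; apply/subspace_continuousP => p Ap; have ip := chart_at_dom p.
apply: (@chart_cvg_fun _ _ _ (fun p => u p * expR (- h p)) A (chart_at p)
  (fun x => T (chart_at p) x * expR (- h (chart_inv (chart_at p) x)))) => //.
- by apply: germM; [apply: gT; exact: Vp|apply: gE; exact: Vp].
- by move=> q Aq iq /=; rewrite (uT _ _ Aq iq) chartK.
Qed.

Let dv_lty (I : seq M) (K : M -> set M) :
  (forall a, compact (K a) /\ K a `<=` chart_dom (chart_at a)) ->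
  (forall q, exists2 a, a \in I & K a q) -> (dv setT < +oo)%E /\ (ds setT < +oo)%E.
Proof.
move=> KP cov; split; apply: (measure_cover_lty _ _ cov) => a; have [cK Ki] := KP a => //.
- exact: dv_compact dvV cK Ki.
- exact: ds_compact dsV cK Ki.
Qed.

(** The cut-off errors add up to the derivative of the constant 1. *)
Lemma reilly_at_sum (I : seq M) (phi : M -> M -> R) p : (forall a, C1_fun (phi a)) ->
  (forall q, \sum_(a <- I) phi a q = 1) -> \sum_(a <- I) reilly_at (phi a) p = 0.
Proof.
move=> Cphi phi1; have mD := @model_halfspace R n.
have Dp := chart_image_sub (Vp p).
rewrite /reilly_at exchange_big big1 //= => k _; rewrite -mulr_sumr.
have <- : pd hs0 k (fun y => \sum_(a <- I) (phi a \o chart_inv (chart_at p)) y) (Defs.coord p) =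
    \sum_(a <- I) pd hs0 k (phi a \o chart_inv (chart_at p)) (Defs.coord p).
  by apply: pd_sum => // a; apply: Cphi; exact: Vp.
rewrite (_ : (fun y => _) = fun=> 1); last by apply/funext => y; rewrite /= phi1.
by rewrite (pd_cst mD Dp) mulr0.
Qed.

Lemma divergence_theorem : (dv setT < +oo)%E /\ (ds setT < +oo)%E /\
  (\int[dv]_(p in [set: borel M]) (div_at p * expR (- h p))%:E =
   \int[ds]_(p in boundary M) (nz_at p * expR (- h p))%:E)%E.
Proof.
have [I [phi [K [phiK phi1]]]] := partition_of_unity cM.
have [dvT dsT] : (dv setT < +oo)%E /\ (ds setT < +oo)%E.
  apply: (@dv_lty I K) => [a|q]; first by have [_ ? ?] := phiK a.
  (* A point outside all the [K a] would have all [phi a q = 0], against their sum being 1. *)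
  have [/hasP[a aI /= Kq]|noK] := boolP (has (fun a => `[< K a q >]) I).
    by exists a => //; exact/asboolP.
  have := phi1 q; rewrite big_seq big1 => [/eqP|a aI]; first by rewrite eq_sym oner_eq0.
  have [_ _ _ ->] := phiK a => //.
  by move/hasPn: noK => /(_ a aI) /asboolP.
split=> //; split=> //.
have Cphi a : C1_fun (phi a) by have [] := phiK a.
have gphi a i x : V i x -> germ 0 hs0 (phi a \o chart_inv i) x.
  by move=> Vx; apply: germ_le (Cphi a i x Vx).
have cB : closed (boundary M) by exact: (closed_boundary g).
have cpB : compact (boundary M) by exact: subclosed_compact cB cM _.
(* Integrability of each summand is what allows the finite sum to leave the integral. *)
have iv a : dv.-integrable setT
    (EFin \o (fun p => (phi a p * div_at p + reilly_at (phi a) p) * expR (- h p))).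
  apply: integrable_compact => //.
  apply: (weighted_cts (T := fun i x => phi a (chart_inv i x) * div_c g h f i x +
     \sum_k reilly_c g h f i k x * pd hs0 k (phi a \o chart_inv i) x)) => [i x Vx|i p _ ip].
    apply: germD; first by apply: germM; [exact: gphi|exact: (@smooth_div_c _ _ _ g h f sh sf i)].
    apply: germ_sum => k; apply: germM; first exact: (@smooth_reilly_c _ _ _ g h f sh sf i k).
    by apply: germ_pd; [exact: model_halfspace|exact: Cphi].
  by rewrite (chartK ip) (div_at_chart g sh sf ip) (reilly_at_chart g sh sf (Cphi a) ip).
have ib a : ds.-integrable (boundary M : set (borel M))
    (EFin \o (fun p => (phi a p * nz_at p) * expR (- h p))).
  apply: integrable_compact => //.
  apply: (weighted_cts (T := fun i x => phi a (chart_inv i x) * nz_c g h f i x)) => [i x Vx|i p bp ip].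
    by apply: germM; [exact: gphi|exact: (@smooth_nz_c _ _ _ g h f sh sf i)].
  by rewrite (chartK ip) /nz_at (nz_at_chart g sh sf bp ip).
transitivity (\int[dv]_(p in [set: borel M]) \sum_(a <- I)
    ((phi a p * div_at p + reilly_at (phi a) p) * expR (- h p))%:E)%E.
  apply: eq_integral => p _; rewrite sumEFin; congr EFin.
  by rewrite -mulr_suml big_split /= -mulr_suml phi1 mul1r reilly_at_sum // addr0.
rewrite (integral_sum _ iv) //.
transitivity (\int[ds]_(p in boundary M) \sum_(a <- I)
    ((phi a p * nz_at p) * expR (- h p))%:E)%E; last first.
  apply: eq_integral => p _; rewrite sumEFin; congr EFin.
  by rewrite -mulr_suml -mulr_suml phi1 mul1r.
rewrite (integral_sum _ ib) //; last exact: closed_measurable_bor cB.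
apply: eq_bigr => a _; have [Ca cK Ki phi0] := phiK a.
exact: (local_divergence sh sf Ca cK Ki phi0 dvV dsV).
Qed.

End Reilly.

Theorem theorem1 (R : realType) (n : nat) (M : manifold R n)
    (compactM : compact [set: M]) (g : riemannian_metric M)
    (dv : {measure set (borel M) -> \bar R}) (dv_volume : is_volume g dv)
    (ds : {measure set (borel M) -> \bar R})
    (ds_volume : is_boundary_volume g ds)
    (h f : M -> R) (smooth_h : smooth_fun h) (smooth_f : smooth_fun f) :
  let fnu := normal_derivative g f in
  (\int[dv]_(p in [set: borel M])
     ((`|drift_laplacian g h f p| ^+ 2 - hess_norm2 g f p)
      * expR (- h p))%R%:E =
   \int[dv]_(p in [set: borel M])
     (bilin (bakry_emery_ricci g h p) (grad g f p) (grad g f p)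
      * expR (- h p))%R%:E
   + \int[ds]_(p in boundary M)
     ((mean_curvature g p * fnu p - inner g p (grad g h p) (grad g f p)
       + boundary_laplacian g f p) * fnu p * expR (- h p))%R%:E
   + \int[ds]_(p in boundary M)
     ((second_form g p (boundary_grad g f p) (boundary_grad g f p)
       - boundary_inner g p (boundary_grad g f p) (boundary_grad g fnu p))
      * expR (- h p))%R%:E)%E.
Proof.
move=> fnu.
have [dvT [dsT divE]] := divergence_theorem smooth_h smooth_f compactM dv_volume ds_volume.
pose Ric p := bilin (bakry_emery_ricci g h p) (grad g f p) (grad g f p).
have RicE i p : chart_dom i p -> Ric p =
    lap_c g h f i (chart i p) ^+ 2 - hess2_c g f i (chart i p) - div_c g h f i (chart i p).
  by move=> ip; exact: ricci_term_chart.
pose A p := (mean_curvature g p * fnu p - inner g p (grad g h p) (grad g f p)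
       + boundary_laplacian g f p) * fnu p.
pose B p := second_form g p (boundary_grad g f p) (boundary_grad g f p)
       - boundary_inner g p (boundary_grad g f p) (boundary_grad g fnu p).
have AE i p : boundary M p -> chart_dom i p -> A p =
    (lap_c g h f i (chart i p) - hnn_c g f i (chart i p)) * fnu_c g f i (chart i p).
  by move=> bp ip; rewrite /A (boundary_term1_chart g smooth_h smooth_f bp ip) /fnu
       (fnu_chart g smooth_f bp ip).
have ABE i p : boundary M p -> chart_dom i p -> A p + B p = nz_c g h f i (chart i p).
  by move=> bp ip; exact: boundary_terms_chart.
have cB : closed (boundary M) by exact: (closed_boundary g).
have mB := closed_measurable_bor cB.
have cpB : compact (boundary M) by exact: subclosed_compact cB compactM _.
have gl i x (Vx : chart_image i x) := @smooth_lap_c _ _ _ g h f smooth_h smooth_f i 0%N x Vx.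
have gh2 i x (Vx : chart_image i x) := @smooth_hess2_c _ _ _ g f smooth_f i 0%N x Vx.
have gd i x (Vx : chart_image i x) := @smooth_div_c _ _ _ g h f smooth_h smooth_f i 0%N x Vx.
have gn i x (Vx : chart_image i x) := @smooth_hnn_c _ _ _ g f smooth_f i 0%N x Vx.
have gf i x (Vx : chart_image i x) := @smooth_fnu_c _ _ _ g f smooth_f i 0%N x Vx.
have gz i x (Vx : chart_image i x) := @smooth_nz_c _ _ _ g h f smooth_h smooth_f i 0%N x Vx.
(* Finite measures on compact sets: integrability follows from continuity, which is read off the
   chart expressions. *)
have iRic : dv.-integrable [set: borel M] (EFin \o (fun p => Ric p * expR (- h p))).
  apply: integrable_compact => //; apply: (weighted_cts smooth_h (T := fun i x =>
    lap_c g h f i x ^+ 2 - hess2_c g f i x - div_c g h f i x)) => [i x Vx|i p _ ip].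
    apply: germB; last exact: gd.
    by apply: germB; [apply: germM; exact: gl|exact: gh2].
  by rewrite (RicE i).
have idiv : dv.-integrable [set: borel M] (EFin \o (fun p => div_at g h f p * expR (- h p))).
  apply: integrable_compact => //.
  apply: (weighted_cts smooth_h (T := div_c g h f)) => [i x Vx|i p _ ip]; first exact: gd.
  exact: div_at_chart.
have iA : ds.-integrable (boundary M : set (borel M)) (EFin \o (fun p => A p * expR (- h p))).
  apply: integrable_compact => //; apply: (weighted_cts smooth_h (T := fun i x =>
    (lap_c g h f i x - hnn_c g f i x) * fnu_c g f i x)) => [i x Vx|i p bp ip].
    by apply: germM; [apply: germB; [exact: gl|exact: gn]|exact: gf].
  exact: AE.
(* [B] is obtained by difference: the normal component of [Z] minus [A], both known in every
   chart. *)
have iB : ds.-integrable (boundary M : set (borel M)) (EFin \o (fun p => B p * expR (- h p))).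
  apply: integrable_compact => //; apply: (weighted_cts smooth_h (T := fun i x =>
    nz_c g h f i x - (lap_c g h f i x - hnn_c g f i x) * fnu_c g f i x)) => [i x Vx|i p bp ip].
    apply: germB; first exact: gz.
    by apply: germM; [apply: germB; [exact: gl|exact: gn]|exact: gf].
  by rewrite -(ABE i p bp ip) -(AE i p bp ip) addrC addKr.
(* Pointwise, the left integrand is the curvature term plus the weighted divergence of [Z]; [divE]
   moves the latter to the boundary, where [ABE] splits it into the two integrands. *)
transitivity (\int[dv]_(p in [set: borel M])
    ((Ric p * expR (- h p))%:E + (div_at g h f p * expR (- h p))%:E))%E.
  apply: eq_integral => p _; have ip := chart_at_dom p.
  rewrite -EFinD -mulrDl (RicE _ _ ip) (div_at_chart g smooth_h smooth_f ip) subrK.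
  rewrite (hess_norm2_chart g smooth_f ip) (drift_laplacian_chart g smooth_h smooth_f ip).
  by rewrite real_normK ?num_real.
rewrite (integralD _ iRic idiv) // divE -addeA; congr (_ + _)%E.
rewrite -(integralD mB iA iB); apply: eq_integral => p; rewrite inE => bp.
by rewrite -EFinD -mulrDl (ABE (chart_at p) p bp (chart_at_dom p)).
Qed.
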